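(* Let $U \subset \mathbb{R}^2$ be open, $f : U \to \mathbb{R}^2$ continuous, and $p \in U$ a fixed point of $f$ such that $\{p\}$ is an isolated invariant set and $p$ is neither a sink nor a source. Then there exist a finite non-empty set $F \subset \mathbb{N}$ and positive integers $a_k$ ($k \in F$) such that $$\{i(f^n, p)\}_{n \ge 1} = \sigma^1 - \sum_{k \in F} a_k \sigma^k,$$ that is, $i(f^n,p) = 1 - \sum_{k \in F,\ k \mid n} k\, a_k$ for every $n \ge 1$. Equivalently, there is a map $\varphi : J \to J$ of a finite non-empty set $J$ with $i(f^n,p) = 1 - \#\mathrm{Fix}(\varphi^n)$ for all $n\ge 1$.
   Context: $i(g,p)$ denotes the fixed point index of $g$ at an isolated fixed point $p$. For $k \ge 1$, $\sigma^k = \{\sigma^k_n\}_{n\ge1}$ is the integer sequence with $\sigma^k_n = k$ if $k \mid n$ and $\sigma^k_n = 0$ otherwise. A solution through $x$ is a sequence $(x_n)_{n\in\mathbb{Z}}$ with $x_0 = x$ and $f(x_n) = x_{n+1}$ for all $n$. For $N \subset U$, $\mathrm{Inv}(f,N)$ is the set of $x \in N$ admitting a solution through $x$ entirely contained in $N$. A compact set $N \subset U$ is an isolating neighborhood if $\mathrm{Inv}(f,N) \subset \mathrm{int}(N)$; a compact invariant set $X$ ($f(X)=X$) is isolated (an isolated invariant set) if $X = \mathrm{Inv}(f,N)$ for some isolating neighborhood $N$. A fixed point $p$ is a sink if $\{p\}$ is isolated and has an isolating neighborhood $N$ with $\mathrm{Inv}(f,N)=\{p\}$ and $f(N) \subset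 N$. A fixed point $p$ is a source if $\{p\}$ is isolated and has an isolating neighborhood $N$ with $\mathrm{Inv}(f,N)=\{p\}$ such that (i) $f(\partial N) \cap \mathrm{int}(N) = \emptyset$ and (ii) the forward orbit of every $x \in N \setminus \{p\}$ eventually leaves $N$. *)

(* Defs.v *)
From Stdlib Require Import Reals Lra Lia ZArith List.
Open Scope R_scope.

Definition pt : Type := (R * R)%type.

Definition dist2 (x y : pt) : R :=
  sqrt ((fst x - fst y)^2 + (snd x - snd y)^2).

Definition psub (x y : pt) : pt := (fst x - fst y, snd x - snd y).

Definition fiter (f : pt -> pt) (n : nat) (x : pt) : pt := Nat.iter n f x.

Definition open2 (U : pt -> Prop) : Prop :=
  forall x, U x -> exists e, 0 < e /\ forall y, dist2 x y < e -> U y.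

Definition cont_on2 (D : pt -> Prop) (g : pt -> pt) : Prop :=
  forall x, D x -> forall e, 0 < e -> exists d, 0 < d /\
    forall y, D y -> dist2 x y < d -> dist2 (g x) (g y) < e.

Definition closed2 (N : pt -> Prop) : Prop := open2 (fun x => ~ N x).

Definition bounded2 (N : pt -> Prop) : Prop :=
  exists M, forall x, N x -> dist2 x (0, 0) <= M.

(* Heine-Borel in R^2 *)
Definition compact2 (N : pt -> Prop) : Prop := closed2 N /\ bounded2 N.

Definition int2 (N : pt -> Prop) (x : pt) : Prop :=
  exists e, 0 < e /\ forall y, dist2 x y < e -> N y.

(* bd2 of a (closed) set N *)
Definition bd2 (N : pt -> Prop) (x : pt) : Prop := N x /\ ~ int2 N x.

Definition subset2 (A B : pt -> Prop) : Prop := forall x, A x -> B x.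

Definition solution_in (f : pt -> pt) (N : pt -> Prop) (x : pt) : Prop :=
  exists s : Z -> pt, s 0%Z = x /\
    (forall n : Z, f (s n) = s (n + 1)%Z) /\ (forall n : Z, N (s n)).

Definition Inv (f : pt -> pt) (N : pt -> Prop) (x : pt) : Prop :=
  N x /\ solution_in f N x.

Definition isolating_nbhd (U : pt -> Prop) (f : pt -> pt) (N : pt -> Prop) : Prop :=
  subset2 N U /\ compact2 N /\ subset2 (Inv f N) (int2 N).

Definition Inv_is_point (f : pt -> pt) (N : pt -> Prop) (p : pt) : Prop :=
  forall x, Inv f N x <-> x = p.

(* {p} is an isolated invariant set (for a fixed point p, {p} is compact invariant) *)
Definition isolated_fixed_set (U : pt -> Prop) (f : pt -> pt) (p : pt) : Prop :=
  f p = p /\ exists N, isolating_nbhd U f N /\ Inv_is_point f N p.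

Definition is_sink (U : pt -> Prop) (f : pt -> pt) (p : pt) : Prop :=
  isolated_fixed_set U f p /\
  exists N, isolating_nbhd U f N /\ Inv_is_point f N p /\
    (forall x, N x -> N (f x)).

Definition is_source (U : pt -> Prop) (f : pt -> pt) (p : pt) : Prop :=
  isolated_fixed_set U f p /\
  exists N, isolating_nbhd U f N /\ Inv_is_point f N p /\
    (forall x, bd2 N x -> ~ int2 N (f x)) /\
    (forall x, N x -> x <> p -> exists n : nat, ~ N (fiter f n x)).

Definition cont_on_unit (g : R -> pt) : Prop :=
  forall t, 0 <= t <= 1 -> forall e, 0 < e -> exists d, 0 < d /\
    forall s, 0 <= s <= 1 -> Rabs (s - t) < d -> dist2 (g t) (g s) < e.

Definition winding_number (gamma : R -> pt) (k : Z) : Prop :=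
  cont_on_unit gamma /\ gamma 0 = gamma 1 /\
  (forall t, 0 <= t <= 1 -> gamma t <> (0, 0)) /\
  exists theta : R -> R,
    (forall t, 0 <= t <= 1 -> forall e, 0 < e -> exists d, 0 < d /\
       forall s, 0 <= s <= 1 -> Rabs (s - t) < d -> Rabs (theta t - theta s) < e) /\
    (forall t, 0 <= t <= 1 ->
       gamma t = (dist2 (gamma t) (0,0) * cos (theta t),
                  dist2 (gamma t) (0,0) * sin (theta t))) /\
    theta 1 - theta 0 = 2 * PI * IZR k.

Definition circ (p : pt) (r t : R) : pt :=
  (fst p + r * cos (2 * PI * t), snd p + r * sin (2 * PI * t)).

Definition fp_index (D : pt -> Prop) (g : pt -> pt) (p : pt) (k : Z) : Prop :=
  g p = p /\
  exists r, 0 < r /\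
    (forall x, dist2 x p <= r -> D x) /\
    cont_on2 (fun x => dist2 x p <= r) g /\
    (forall x, dist2 x p <= r -> g x = x -> x = p) /\
    winding_number (fun t => psub (circ p r t) (g (circ p r t))) k.

Definition fiter_dom (U : pt -> Prop) (f : pt -> pt) (n : nat) (x : pt) : Prop :=
  forall j, (j < n)%nat -> U (fiter f j x).

Definition sigk (k n : nat) : Z :=
  if Nat.eqb (n mod k) 0 then Z.of_nat k else 0%Z.

Definition sum_Z (l : list Z) : Z := fold_right Z.add 0%Z l.

(* Main.v *)
(** Write b(n) = 1 - i(f^n, p).  Fix k large, let g = f^k, and let B be a small square around p
    carrying a fine grid.  On grid chains g induces a chain map F, and i(g^n, p) is the local
    Lefschetz number of F^n at p: both count the crossings of a half axis by x - g^n x along a small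
    square.  Let M be the component at p of the union of the grid squares near the set of those x in
    B whose orbit segment of length k stays in the isolating square and ends in B, and let L be the
    rest of the grid.  A frontier point of M leaves B under g, and its image in the truncated grid
    map is far from M; so F maps the frontier into L, and because the grid is simply connected this
    defines a map psi on the components of L.  Replacing F on L by psi gives a chain map with
    Lefschetz number 1 on the acyclic grid, and closed walks of F that avoid L concentrate at p;
    hence b(kn) = #Fix(psi^n).  When M lies in the interior of B this comparison needs a
    two-dimensional correction term to vanish: it does because, p not being a source, M contains a
    point without long backward orbit.  As p is not a sink, L is not empty, so psi has a cycle.

    The number of periodic points of psi is bounded independently of the mesh, so
    b(kn) = sum_(d | n, d <= C) d a_d for all n.  Comparing different k, b(m) lies in a fixed interval
    [0, P] for all large m.  Finally i(g^q) = i(g) modulo q for q prime, since tr(A^q) = tr(A) modulo q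
    for integer matrices; hence b(n) = b(qn) for one large prime q and all n, and the formula for
    k = q is the theorem. *)

Require Import Defs.
From Stdlib Require Import Reals Lra Lia ZArith List.
From Stdlib Require Import Classical ClassicalEpsilon.
From mathcomp Require all_boot all_algebra finfield zify ssrZ.
Open Scope R_scope.

Module IsolatedFixedPoint.
Import all_boot all_algebra finfield zify ssrZ.
Set Implicit Arguments. Unset Strict Implicit. Unset Printing Implicit Defensive.
Import GRing.Theory.
(* [ssrint] binds the key [%Z] to its own scope. *)
Delimit Scope Z_scope with Z.

(** * The plane with the supremum metric *)

Definition dsup (x y : pt) : R := Rmax (Rabs (x.1 - y.1)) (Rabs (x.2 - y.2)).

Lemma dsup_le x y e : dsup x y <= e <-> Rabs (x.1 - y.1) <= e /\ Rabs (x.2 - y.2) <= e.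
Proof. by rewrite /dsup /Rmax; case: Rle_dec; lra. Qed.

Lemma dsup_lt x y e : dsup x y < e <-> Rabs (x.1 - y.1) < e /\ Rabs (x.2 - y.2) < e.
Proof. by rewrite /dsup /Rmax; case: Rle_dec; lra. Qed.

Lemma dsup_sym x y : dsup x y = dsup y x.
Proof. by rewrite /dsup (Rabs_minus_sym x.1) (Rabs_minus_sym x.2). Qed.

Lemma dsup_ge0 x y : 0 <= dsup x y.
Proof. exact: Rle_trans (Rabs_pos _) (Rmax_l _ _). Qed.

Lemma dsup_refl x : dsup x x = 0.
Proof. by rewrite /dsup !Rminus_diag Rabs_R0 Rmax_left //; lra. Qed.

Lemma dsup_triangle x y z : dsup x z <= dsup x y + dsup y z.
Proof.
have /dsup_le[xy1 xy2] := Rle_refl (dsup x y); have /dsup_le[yz1 yz2] := Rle_refl (dsup y z).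
by apply/dsup_le; split; split_Rabs; lra.
Qed.

Lemma dsup_gt0 x y : x <> y -> 0 < dsup x y.
Proof.
move=> xy; apply: Rnot_le_lt => /dsup_le[d1 d2]; apply: xy.
by rewrite [x]surjective_pairing [y]surjective_pairing; congr pair; split_Rabs; lra.
Qed.

Lemma dsup_le_dist2 x y : dsup x y <= dist2 x y.
Proof.
have sqr1 := pow2_ge_0 (x.1 - y.1); have sqr2 := pow2_ge_0 (x.2 - y.2).
by apply: Rmax_lub; rewrite -sqrt_Rsqr_abs; apply: sqrt_le_1_alt; rewrite Rsqr_pow2; lra.
Qed.

Lemma dist2_le_dsup x y : dist2 x y <= 2 * dsup x y.
Proof.
have /dsup_le := Rle_refl (dsup x y); have d0 := dsup_ge0 x y; move: (dsup x y) d0 => d d0 [d1 d2].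
rewrite /dist2 -(sqrt_square (2 * d)); last lra.
by apply: sqrt_le_1_alt; split_Rabs; nra.
Qed.

Lemma dsup_ge x p r : 0 <= r -> 2 * r ^ 2 <= (x.1 - p.1) ^ 2 + (x.2 - p.2) ^ 2 -> r <= dsup x p.
Proof. by move=> r0 sqr; apply: Rnot_lt_le => /dsup_lt[d1 d2]; split_Rabs; nra. Qed.

(** * Sequences and compactness *)

Definition eventually (P : nat -> Prop) : Prop := exists N, forall n, (N <= n)%N -> P n.

Lemma eventually_and P Q : eventually P -> eventually Q -> eventually (fun n => P n /\ Q n).
Proof.
move=> [N P_eventually] [M Q_eventually]; exists (maxn N M) => n.
by rewrite geq_max => /andP[/P_eventually Pn /Q_eventually].
Qed.

Lemma eventually_imp (P Q : nat -> Prop) :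
  (forall n, P n -> Q n) -> eventually P -> eventually Q.
Proof. by move=> PQ [N P_eventually]; exists N => n /P_eventually /PQ. Qed.

Lemma eventually_all (P : nat -> Prop) : (forall n, P n) -> eventually P.
Proof. by move=> P_eventually; exists 0%N. Qed.

Lemma eventually_ge N : eventually (fun n => (N <= n)%N).
Proof. by exists N. Qed.

Lemma eventually_exists P : eventually P -> exists n, P n.
Proof. by case=> N P_eventually; exists N; apply: P_eventually. Qed.

Lemma eventually_below (P : nat -> nat -> Prop) k : (forall i, (i < k)%N -> eventually (P i)) ->
  eventually (fun n => forall i, (i < k)%N -> P i n).
Proof.
elim: k => [|k IH] P_eventually; first by exists 0%N.
have := eventually_and (IH (fun i ik => P_eventually i (ltnW ik))) (P_eventually k (ltnSn k)).
apply: eventually_imp => n [below at_k] i; rewrite ltnS leq_eqVlt => /orP[/eqP -> //|].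
exact: below.
Qed.

Definition increasing_seq (s : nat -> nat) : Prop := forall n, (s n < s n.+1)%N.

Lemma increasing_seq_id : increasing_seq id.
Proof. by []. Qed.

Lemma increasing_seq_ge s n : increasing_seq s -> (n <= s n)%N.
Proof. by move=> s_inc; elim: n => // n /leq_ltn_trans; apply. Qed.

Lemma increasing_seq_comp s t : increasing_seq s -> increasing_seq t -> increasing_seq (s \o t).
Proof. by move=> s_inc t_inc n; apply: (homo_ltn ltn_trans s_inc (t_inc n)). Qed.

Lemma increasing_seq_shift N s : increasing_seq s -> increasing_seq (fun n => s (N + n)%N).
Proof. by move=> s_inc n; rewrite addnS; apply: s_inc. Qed.

Lemma increasing_seq_exists (P : nat -> nat -> Prop) :
  (forall m n, exists2 k, (m < k)%N & P n k) ->
  exists s, increasing_seq s /\ forall n, P n (s n).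
Proof.
move=> next; have [f f_next] : exists f : nat * nat -> nat, forall q, (q.1 < f q)%N /\ P q.2 (f q).
  apply: (choice (fun q k => (q.1 < k)%N /\ P q.2 k)) => -[m n].
  by have [k] := next m n; exists k.
pose s := fix s n := f (if n is n'.+1 then (s n', n) else (0, 0)%N).
exists s; split=> [n|[|n]]; first by have [] := f_next (s n, n.+1).
  by have [] := f_next (0, 0)%N.
by have [] := f_next (s n, n.+1).
Qed.

Lemma eventually_subseq P s : increasing_seq s -> eventually P -> eventually (fun n => P (s n)).
Proof.
by move=> s_inc [N P_eventually]; exists N => n Nn; apply/P_eventually/(leq_trans Nn)/increasing_seq_ge.
Qed.

Lemma not_eventually (P : nat -> Prop) : ~ eventually P ->
  exists s, increasing_seq s /\ forall n, ~ P (s n).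
Proof.
move=> notP; apply: (increasing_seq_exists (P := fun _ k => ~ P k)) => m _.
apply: NNPP => none; apply: notP; exists m.+1 => k mk.
by apply: NNPP => Pk; apply: none; exists k.
Qed.

(* Compactness arguments by contradiction: the counterexamples form a sequence. *)
Lemma eventually_forall (T : Type) (A B : nat -> T -> Prop) :
  (forall s x, increasing_seq s -> (forall n, A (s n) (x n)) -> exists n, B (s n) (x n)) ->
  eventually (fun n => forall x, A n x -> B n x).
Proof.
move=> seqB; apply: NNPP => /not_eventually[s [s_inc cex]].
have [x x_spec] : exists x : nat -> T, forall n, A (s n) (x n) /\ ~ B (s n) (x n).
  apply: (choice (fun n x => A (s n) x /\ ~ B (s n) x)) => n.
  apply: NNPP => none; apply: (cex n) => x Ax.
  by apply: NNPP => Bx; apply: none; exists x.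
by have [n] := seqB s x s_inc (fun n => proj1 (x_spec n)); have [] := x_spec n.
Qed.

Definition vanishing (e : nat -> R) : Prop := forall d, 0 < d -> eventually (fun n => e n < d).

Lemma vanishing_subseq e s : increasing_seq s -> vanishing e -> vanishing (e \o s).
Proof. by move=> s_inc e0 d /e0; apply: (eventually_subseq s_inc (P := fun n => e n < d)). Qed.

Lemma vanishing_scale c e : 0 < c -> vanishing e -> vanishing (fun n => c * e n).
Proof.
move=> c0 e0 d d0; have := e0 (d / c) (Rdiv_lt_0_compat _ _ d0 c0).
apply: eventually_imp => n en; have -> : d = c * (d / c) by field; lra.
exact: Rmult_lt_compat_l.
Qed.

Lemma inv_INR_gt0 n : 0 < / INR n.+1.
Proof. exact/Rinv_0_lt_compat/lt_0_INR/PeanoNat.Nat.lt_0_succ. Qed.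

Lemma vanishing_inv_INR : vanishing (fun n => / INR n.+1).
Proof.
move=> d d0; have [N [Nd N0]] := archimed_cor1 d d0; exists N => n Nn.
by apply: Rle_lt_trans Nd; apply: Rinv_le_contravar; [apply: lt_0_INR | apply: le_INR]; lia.
Qed.

Lemma tolerance_exists (T : Type) (A : R -> T -> Prop) (B : T -> Prop) :
  (forall e x, vanishing e -> (forall n, A (e n) (x n)) -> exists n, B (x n)) ->
  exists e, 0 < e /\ forall x, A e x -> B x.
Proof.
move=> seqB; suff /eventually_exists[n n_spec] :
    eventually (fun n => forall x, A (/ INR n.+1) x -> B x).
  by exists (/ INR n.+1); split; first exact: inv_INR_gt0.
apply: (eventually_forall (A := fun n => A (/ INR n.+1)) (B := fun=> B)) => s x s_inc Ax.
exact: seqB (vanishing_subseq s_inc vanishing_inv_INR) Ax.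
Qed.

Definition converges (u : nat -> pt) (x : pt) : Prop :=
  vanishing (fun n => dsup (u n) x).

Lemma converges_subseq u x s : increasing_seq s -> converges u x -> converges (u \o s) x.
Proof. exact: vanishing_subseq. Qed.

Lemma converges_const x : converges (fun=> x) x.
Proof. by move=> e e0; exists 0%N => n _; rewrite dsup_refl. Qed.

Lemma converges_near u v x e :
  converges u x -> vanishing e -> eventually (fun n => dsup (v n) (u n) <= e n) -> converges v x.
Proof.
move=> ux e0 vu d d0.
have := eventually_and vu (eventually_and (ux (d / 2) ltac:(lra)) (e0 (d / 2) ltac:(lra))).
apply: eventually_imp => n [vun [uxn en]]; have := dsup_triangle (v n) (u n) x; lra.
Qed.

Lemma converges_ext u v x : u =1 v -> converges u x -> converges v x.
Proof. by move=> uv ux e /ux; apply: eventually_imp => n; rewrite uv. Qed.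

Lemma converges_unique u x y : converges u x -> converges u y -> x = y.
Proof.
move=> ux uy; apply: NNPP => /dsup_gt0 xy.
have [n [uxn uyn]] := eventually_exists
  (eventually_and (ux (dsup x y / 2) ltac:(lra)) (uy (dsup x y / 2) ltac:(lra))).
by have := dsup_triangle x (u n) y; rewrite (dsup_sym x (u n)); lra.
Qed.

Lemma converges_dsup_le u v x y r : converges u x -> converges v y ->
  eventually (fun n => dsup (u n) (v n) <= r) -> dsup x y <= r.
Proof.
move=> ux vy uv; apply: Rnot_lt_le => r_lt; pose d := (dsup x y - r) / 2.
have [n [[uxn vyn] uvn]] := eventually_exists (eventually_and
  (eventually_and (ux d ltac:(rewrite /d; lra)) (vy d ltac:(rewrite /d; lra))) uv).
have := dsup_triangle x (u n) y; have := dsup_triangle (u n) (v n) y.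
by rewrite (dsup_sym x (u n)) /d in uxn vyn *; lra.
Qed.

Lemma converges_in_ball u x p r : converges u x -> eventually (fun n => dsup (u n) p <= r) ->
  dsup x p <= r.
Proof. by move=> ux; apply: converges_dsup_le ux (@converges_const p). Qed.

Lemma converges_off_ball u x p r : converges u x -> eventually (fun n => r <= dsup (u n) p) ->
  r <= dsup x p.
Proof.
move=> ux up; apply: Rnot_lt_le => xp.
have [n [uxn upn]] := eventually_exists (eventually_and (ux (r - dsup x p) ltac:(lra)) up).
by have := dsup_triangle (u n) x p; lra.
Qed.

Lemma bounded_real_subseq (u : nat -> R) a r : (forall n, Rabs (u n - a) <= r) ->
  exists s x, increasing_seq s /\ vanishing (fun n => Rabs (u (s n) - x)).
Proof.
move=> u_bd; have [x x_adh] : exists x, ValAdh u x.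
  apply: (Bolzano_Weierstrass u _ (compact_P3 (a - r) (a + r))) => n.
  by have := u_bd n; split_Rabs; lra.
have [s [s_inc s_near]] : exists s, increasing_seq s /\ forall n, Rabs (u (s n) - x) < / INR n.+1.
  apply: (increasing_seq_exists (P := fun n k => Rabs (u k - x) < / INR n.+1)) => m n.
  pose ball_n := disc x (mkposreal _ (inv_INR_gt0 n)).
  have [k [mk uk]] := x_adh ball_n m.+1 ltac:(by exists (mkposreal _ (inv_INR_gt0 n))).
  by exists k; [lia | apply: uk].
exists s, x; split=> // d /vanishing_inv_INR; apply: eventually_imp => n.
exact: Rlt_trans (s_near n).
Qed.

Lemma bounded_subseq (u : nat -> pt) p r : (forall n, dsup (u n) p <= r) ->
  exists s x, [/\ increasing_seq s, converges (u \o s) x & dsup x p <= r].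
Proof.
move=> u_bd.
have [s [x [s_inc sx]]] := @bounded_real_subseq (fun n => (u n).1) p.1 r
  (fun n => proj1 (proj1 (dsup_le (u n) p r) (u_bd n))).
have [t [y [t_inc ty]]] := @bounded_real_subseq (fun n => (u (s n)).2) p.2 r
  (fun n => proj2 (proj1 (dsup_le (u (s n)) p r) (u_bd (s n)))).
have st_cv : converges (u \o (s \o t)) (x, y).
  move=> e e0; have := eventually_and (vanishing_subseq t_inc sx e0) (ty e e0).
  by apply: eventually_imp => n [d1 d2]; apply/dsup_lt.
exists (s \o t), (x, y); split=> //; first exact: increasing_seq_comp.
by apply: converges_in_ball st_cv (eventually_all _) => n; apply: u_bd.
Qed.

Definition continuous_at (g : pt -> pt) (x : pt) : Prop :=
  forall e, 0 < e -> exists d, 0 < d /\ forall y, dsup x y < d -> dsup (g x) (g y) < e.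

Lemma continuous_at_id x : continuous_at id x.
Proof. by move=> e e0; exists e. Qed.

Lemma continuous_at_converges g x u :
  continuous_at g x -> converges u x -> converges (g \o u) (g x).
Proof.
move=> g_cont ux e /g_cont[d [/ux near close]]; apply: eventually_imp near => n un.
by rewrite dsup_sym; apply: close; rewrite dsup_sym.
Qed.

Lemma continuous_at_comp g h x :
  continuous_at g x -> continuous_at h (g x) -> continuous_at (h \o g) x.
Proof.
by move=> g_cont h_cont e /h_cont[d [/g_cont[d' [d'0 close']] close]]; exists d'; split=> // y /close' /close.
Qed.

Lemma uniform_continuity G p r : (forall x, dsup x p <= r -> continuous_at G x) ->
  forall e, 0 < e ->
  exists d, 0 < d /\ forall x y, dsup x p <= r -> dsup x y <= d -> dsup (G x) (G y) < e.
Proof.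
move=> G_cont e e0.
have [d [d0 close]] : exists d, 0 < d /\ forall q : pt * pt,
    dsup q.1 p <= r /\ dsup q.2 q.1 <= d -> dsup (G q.1) (G q.2) < e.
  apply: tolerance_exists => d q d_van q_spec.
  have [s [x [s_inc sx xp]]] := bounded_subseq (fun n => proj1 (q_spec n)).
  have sy : converges (fun n => (q (s n)).2) x.
    apply: converges_near sx (vanishing_subseq s_inc d_van) (eventually_all _) => n.
    by have [] := q_spec (s n).
  have [n [Gx Gy]] := eventually_exists (eventually_and
    (continuous_at_converges (G_cont x xp) sx (ltac:(lra) : 0 < e / 2))
    (continuous_at_converges (G_cont x xp) sy (ltac:(lra) : 0 < e / 2))).
  exists (s n); have := dsup_triangle (G (q (s n)).1) (G x) (G (q (s n)).2).
  by rewrite /= (dsup_sym (G x)) in Gx Gy *; lra.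
exists d; split=> // x y xp xy; apply: (close (x, y)); split=> //.
by rewrite dsup_sym.
Qed.

Lemma displacement_lower_bound G p r r' :
  (forall x, r' <= dsup x p <= r -> continuous_at G x /\ G x <> x) ->
  exists e, 0 < e /\ forall x, r' <= dsup x p <= r -> e <= dsup x (G x).
Proof.
move=> G_moves.
have [e [e0 displaced]] : exists e, 0 < e /\ forall x, dsup (G x) x <= e -> ~ (r' <= dsup x p <= r).
  apply: tolerance_exists => e x e_van x_spec; apply: NNPP => none.
  have xr n : r' <= dsup (x n) p <= r by apply: NNPP => xn; apply: none; exists n.
  have [s [y [s_inc sy yr]]] := bounded_subseq (fun n => proj2 (xr n)).
  have yr' : r' <= dsup y p.
    by apply: converges_off_ball sy (eventually_all _) => n; have [] := xr (s n).
  have [G_cont Gy] := G_moves y (conj yr' yr); apply: Gy.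
  apply: (converges_unique (u := fun n => G (x (s n)))); first exact: continuous_at_converges.
  by apply: converges_near sy (vanishing_subseq s_inc e_van) (eventually_all _) => n; apply: x_spec.
exists e; split=> // x xr; apply: Rnot_lt_le => /Rlt_le; rewrite dsup_sym => /displaced; exact.
Qed.

(** * Angles *)

Definition norm2 (w : pt) : R := sqrt (w.1 ^ 2 + w.2 ^ 2).

Lemma dist2_origin w : dist2 w (0, 0) = norm2 w.
Proof. by rewrite /dist2 /norm2 /= !Rminus_0_r. Qed.

Lemma norm2_gt0 w : w <> (0, 0) -> 0 < norm2 w.
Proof.
case: w => x y nz; apply: sqrt_lt_R0 => /=.
case: (Req_dec x 0) => [x0|x0]; last by nra.
case: (Req_dec y 0) => [y0|y0]; last by nra.
by case: nz; rewrite x0 y0.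
Qed.

Lemma norm2_sqr w : norm2 w * norm2 w = w.1 ^ 2 + w.2 ^ 2.
Proof. by apply: sqrt_sqrt; nra. Qed.

Lemma cos_sin_sqr t : cos t * cos t + sin t * sin t = 1.
Proof. by have := sin2_cos2 t; rewrite /Rsqr; lra. Qed.

Definition is_angle (th : R) (w : pt) : Prop :=
  w.1 = norm2 w * cos th /\ w.2 = norm2 w * sin th.

Lemma is_angle_cos_sin th al w : w <> (0, 0) -> is_angle th w -> is_angle al w ->
  cos th = cos al /\ sin th = sin al.
Proof. by move=> /norm2_gt0 w0 [c1 s1] [c2 s2]; split; nra. Qed.

Lemma is_angle_shift th al be w g : w <> (0, 0) ->
  is_angle th w -> is_angle al w -> is_angle be g -> is_angle (th + be - al) g.
Proof.
move=> w0 thw alw [c s]; have [Ec Es] := is_angle_cos_sin w0 thw alw.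
have unit_al := cos_sin_sqr al.
have cos1 : cos (th - al) = 1 by rewrite cos_minus Ec Es; lra.
have sin0 : sin (th - al) = 0 by rewrite sin_minus Ec Es; lra.
have -> : th + be - al = be + (th - al) by ring.
by split; [rewrite cos_plus | rewrite sin_plus]; rewrite cos1 sin0; lra.
Qed.

(* The coordinate of [w] along the half axis that is reached from the positive first axis by [k]
   quarter turns; [0 < axis k w] is the open half plane around it. *)
Fixpoint axis (k : nat) (w : pt) : R := if k is k'.+1 then axis k' (w.2, - w.1) else w.1.

Lemma axisSS k w : axis k.+2 w = - axis k w.
Proof. by elim: k w => [|k IH] w; last exact: IH (w.2, - w.1). Qed.

Lemma axis_gt0_neq0 k w : 0 < axis k w -> w <> (0, 0).
Proof.
have axis0 : axis k (0, 0) = 0 by elim: k => //= k; rewrite Ropp_0.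
by move=> + w0; rewrite w0 axis0; lra.
Qed.

Lemma axis_lipschitz k x y e : Rabs (x.1 - y.1) <= e -> Rabs (x.2 - y.2) <= e ->
  axis k y - e <= axis k x.
Proof.
elim: k x y => [|k IH] x y d1 d2 /=; first by move: d1; split_Rabs; lra.
apply: IH => //=; have -> : - x.1 - - y.1 = y.1 - x.1 by ring.
by rewrite Rabs_minus_sym.
Qed.

Lemma axis_ge_Rmax w : exists2 k, (k < 4)%N & axis k w = Rmax (Rabs w.1) (Rabs w.2).
Proof.
rewrite /Rmax /Rabs; case: Rle_dec; case: Rcase_abs; case: Rcase_abs => *;
  by [exists 0%N | exists 1%N | exists 2%N | exists 3%N].
Qed.

(* The argument of [w] on the half plane number [k]. *)
Definition angle (k : nat) (w : pt) : R := INR k * (PI / 2) + atan (axis k.+1 w / axis k w).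

Lemma is_angle_quarter th w : is_angle th (w.2, - w.1) -> is_angle (PI / 2 + th) w.
Proof.
have norm_eq : norm2 (w.2, - w.1) = norm2 w by rewrite /norm2 /=; congr sqrt; ring.
by rewrite /is_angle norm_eq cos_plus sin_plus cos_PI2 sin_PI2 /=; lra.
Qed.

Lemma is_angle_angle k w : 0 < axis k w -> is_angle (angle k w) w.
Proof.
elim: k w => [|k IH] w w0; last first.
  have -> : angle k.+1 w = PI / 2 + angle k (w.2, - w.1) by rewrite /angle S_INR; cbn [axis]; ring.
  exact/is_angle_quarter/IH.
rewrite /angle /= Rmult_0_l Rplus_0_l; set z := w.2 / w.1.
rewrite /= in w0; have zw : z * w.1 = w.2 by rewrite /z; field; lra.
set c := sqrt (1 + z ^ 2).
have c0 : 0 < c by apply: sqrt_lt_R0; nra.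
have norm_w : norm2 w = w.1 * c.
  rewrite -{1}(sqrt_square w.1) ?/c -?sqrt_mult; try nra.
  by congr sqrt; rewrite -zw; ring.
have sqrz : 1 + z² = 1 + z ^ 2 by rewrite /Rsqr; ring.
split; rewrite norm_w ?cos_atan ?sin_atan sqrz -/c; first by field; lra.
by rewrite -zw; field; lra.
Qed.

Lemma atan_quarter a b : 0 < a -> 0 < b -> atan (b / a) = PI / 2 + atan (- a / b).
Proof.
move=> a0 b0; have -> : - a / b = - / (b / a) by field; lra.
by rewrite atan_opp atan_inv; [ring | apply: Rdiv_lt_0_compat].
Qed.

Lemma angle_adjacent k w : 0 < axis k w -> 0 < axis k.+1 w -> angle k w = angle k.+1 w.
Proof. by move=> k0 k1; rewrite /angle axisSS atan_quarter // S_INR; ring. Qed.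

Lemma angle_full_turn k w : angle k.+4 w = angle k w + 2 * PI.
Proof. by rewrite /angle !axisSS !Ropp_involutive !S_INR; field. Qed.

Lemma angle_variation k k' w g : 0 < axis k w -> 0 < axis k g -> 0 < axis k' w -> 0 < axis k' g ->
  angle k g - angle k w = angle k' g - angle k' w.
Proof.
have forward d j : 0 < axis j w -> 0 < axis j g -> 0 < axis (d + j) w -> 0 < axis (d + j) g ->
    angle j g - angle j w = angle (d + j) g - angle (d + j) w.
  elim/ltn_ind: d j => -[|[|[|[|d]]]] IH j; rewrite ?addSn ?add0n; move=> w0 g0 w1 g1 //.
  - by rewrite !(@angle_adjacent j).
  - by rewrite axisSS in w1; lra.
  - have turn3 u : 0 < axis j u -> 0 < axis j.+3 u -> angle j.+3 u = angle j u + 2 * PI.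
      move=> u0 u3; rewrite -angle_full_turn angle_adjacent // !axisSS; lra.
    by rewrite !turn3 //; lra.
  - rewrite !angle_full_turn; have := IH d ltac:(lia) j w0 g0.
    rewrite !axisSS !Ropp_involutive in w1 g1 => /(_ w1 g1); lra.
move=> w0 g0 w1 g1; case: (leqP k k') => [kk'|/ltnW kk'].
  by rewrite -(subnK kk') in w1 g1 *; apply: forward.
by rewrite -(subnK kk') in w0 g0 *; symmetry; apply: forward.
Qed.

(** * Winding numbers from crossings *)

Definition upper (w : pt) : Z := if Rlt_dec 0 w.2 then 1%Z else 0%Z.

(* The argument in (0, 2 PI), cut along the positive first axis; only meant for [w.2 <> 0]. *)
Definition Arg (w : pt) : R := if Rlt_dec 0 w.2 then angle 1 w else angle 3 w.

Lemma is_angle_Arg w : w.2 <> 0 -> is_angle (Arg w) w.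
Proof. by move=> w2; rewrite /Arg; case: Rlt_dec => w2_gt0; apply: is_angle_angle => /=; lra. Qed.

(* The signed crossings of the positive first axis by a path from [w] to [w'] in the half plane
   number [k]. *)
Definition crossing (k : nat) (w w' : pt) : Z :=
  if k is 0%N then (upper w' - upper w)%Z else 0%Z.

Lemma angle_Arg k w : (k < 4)%N -> 0 < axis k w -> w.2 <> 0 ->
  angle k w = Arg w + 2 * PI * (if k is 0%N then IZR (upper w) - 1 else 0).
Proof.
rewrite /Arg /upper => k4 wk nz; case: Rlt_dec => w2 /=; [|move/Rnot_lt_le: w2 => w2];
  case: k k4 wk => [|[|[|[|k]]]] // _ /= wk.
- by rewrite (@angle_adjacent 0) //=; lra.
- by lra.
- by rewrite (@angle_adjacent 1) //=; lra.
- by lra.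
- have := angle_full_turn 0 w; rewrite -(@angle_adjacent 3) /=; lra.
- by lra.
- by rewrite (@angle_adjacent 2) //=; lra.
- by lra.
Qed.

Lemma angle_crossing k w w' : (k < 4)%N ->
  0 < axis k w -> 0 < axis k w' -> w.2 <> 0 -> w'.2 <> 0 ->
  angle k w' - angle k w = Arg w' - Arg w + 2 * PI * IZR (crossing k w w').
Proof.
move=> k4 wk wk' w2 w2'; rewrite !angle_Arg // /crossing.
by case: k {k4 wk wk'} => [|k]; rewrite ?minus_IZR; lra.
Qed.

Definition continuous_path (g : R -> pt) : Prop :=
  continuity (fun t => (g t).1) /\ continuity (fun t => (g t).2).

Lemma continuity_nonexpansive (f : R -> R) :
  (forall x y, Rabs (f x - f y) <= Rabs (x - y)) -> continuity f.
Proof.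
move=> f_le t e e0; exists e; split=> // x [_ xt] /=.
exact: Rle_lt_trans _ _ _ (f_le x t) xt.
Qed.

Lemma continuity_Rmax a : continuity (Rmax a).
Proof.
apply: continuity_nonexpansive => x y; rewrite /Rmax.
by do 2 case: Rle_dec => ?; split_Rabs; lra.
Qed.

Lemma continuity_Rmin a : continuity (Rmin a).
Proof.
apply: continuity_nonexpansive => x y; rewrite /Rmin.
by do 2 case: Rle_dec => ?; split_Rabs; lra.
Qed.

Definition clamp (a b t : R) : R := Rmax a (Rmin b t).

Lemma continuity_clamp a b : continuity (clamp a b).
Proof. exact: continuity_comp _ _ (continuity_Rmin b) (continuity_Rmax a). Qed.

Lemma clamp_bounds a b t : a <= b -> a <= clamp a b t <= b.
Proof. by rewrite /clamp /Rmax /Rmin; do 2 case: Rle_dec; lra. Qed.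

Lemma clamp_id a b t : a <= t <= b -> clamp a b t = t.
Proof. by rewrite /clamp /Rmax /Rmin; do 2 case: Rle_dec; lra. Qed.

Lemma continuous_path_clamp g a b :
  continuous_path g -> continuous_path (fun t => g (clamp a b t)).
Proof.
by case=> g1 g2; split;
  [exact: continuity_comp _ _ (continuity_clamp a b) g1 | exact: continuity_comp _ _ (continuity_clamp a b) g2].
Qed.

Lemma continuity_axis k g : continuous_path g -> continuity (fun t => axis k (g t)).
Proof.
elim: k g => [|k IH] g [g1 g2] //=.
by apply: (IH (fun t => ((g t).2, - (g t).1))); split=> //; exact: continuity_opp _ g1.
Qed.

Lemma continuity_angle k g : continuous_path g -> (forall t, 0 < axis k (g t)) ->
  continuity (fun t => angle k (g t)).
Proof.
move=> g_cont g_pos; have c0 := continuity_axis k g_cont; have c1 := continuity_axis k.+1 g_cont.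
rewrite /angle; apply: (continuity_plus (fun=> INR k * (PI / 2))).
  by apply: continuity_const => x y.
apply: (continuity_comp (fun t => axis k.+1 (g t) / axis k (g t)) atan).
  by apply: (continuity_div _ _ c1 c0) => t; have := g_pos t; lra.
by move=> x; apply: derivable_continuous_pt; apply: derivable_pt_atan.
Qed.

(* [w] and [w'] are approximations of [g a] and [g b], and [c] counts the signed crossings of the
   positive first axis on the way. *)
Definition turn (g : R -> pt) (a : R) (w : pt) (b : R) (w' : pt) (c : Z) : Prop :=
  a <= b /\ exists th : R -> R, [/\ continuity th,
    forall t, a <= t <= b -> is_angle (th t) (g t),
    exists k, [/\ 0 < axis k w, 0 < axis k (g a) & th a = Arg w + angle k (g a) - angle k w] &
    exists k, [/\ 0 < axis k w', 0 < axis k (g b) &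
      th b = Arg w' + angle k (g b) - angle k w' + 2 * PI * IZR c]].

Lemma turn_half_plane g a w b w' k : continuous_path g -> a <= b -> (k < 4)%N ->
  w.2 <> 0 -> w'.2 <> 0 -> 0 < axis k w -> 0 < axis k w' ->
  (forall t, a <= t <= b -> 0 < axis k (g t)) -> turn g a w b w' (crossing k w w').
Proof.
move=> g_cont ab k4 w2 w2' wk wk' gk; split=> //.
have [ga gb] : 0 < axis k (g a) /\ 0 < axis k (g b) by split; apply: gk; lra.
have angle_cont : continuity (fun t => angle k (g (clamp a b t))).
  apply: (@continuity_angle k (fun t => g (clamp a b t))); first exact: continuous_path_clamp.
  by move=> t; apply/gk/clamp_bounds.
exists (fun t => Arg w + angle k (g (clamp a b t)) - angle k w); split.
- apply: (continuity_minus _ (fun=> angle k w)); last by apply: continuity_const.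
  by apply: (continuity_plus (fun=> Arg w)) => //; apply: continuity_const.
- move=> t t_ab; rewrite clamp_id //; apply: (@is_angle_shift _ _ _ w).
  + exact: axis_gt0_neq0 wk.
  + exact: is_angle_Arg.
  + exact: is_angle_angle.
  + exact/is_angle_angle/gk.
- by exists k; rewrite clamp_id; [split | lra].
- exists k; rewrite clamp_id; last lra; split=> //.
  by have := angle_crossing k4 wk wk' w2 w2'; lra.
Qed.

Lemma turn_trans g a w b w' d w'' c c' :
  turn g a w b w' c -> turn g b w' d w'' c' -> turn g a w d w'' (c + c').
Proof.
case=> ab [th [th_cont thP th_a [k [wk gk th_b]]]] [bd [th' [th_cont' thP' [k' [wk' gk' th_b']] th_d]]].
have jump : th b = th' b + 2 * PI * IZR c.
  by rewrite th_b th_b'; have := angle_variation wk gk wk' gk'; lra.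
split; first lra; exists (fun t => th (Rmin b t) + th' (Rmax b t) - th' b); split.
- apply: (continuity_minus _ (fun=> th' b)); last by apply: continuity_const.
  apply: (continuity_plus (fun t => th (Rmin b t)) (fun t => th' (Rmax b t))).
  + exact: continuity_comp _ _ (continuity_Rmin b) th_cont.
  + exact: continuity_comp _ _ (continuity_Rmax b) th_cont'.
- move=> t t_ad; case: (Rle_dec t b) => tb.
    rewrite Rmin_right ?Rmax_left; try lra.
    by rewrite /Rminus Rplus_assoc Rplus_opp_r Rplus_0_r; apply: thP; lra.
  rewrite Rmin_left ?Rmax_right; try lra.
  apply: (@is_angle_shift _ _ _ (g b)); first exact: axis_gt0_neq0 gk.
  + by apply: thP; lra.
  + by apply: thP'; lra.
  + by apply: thP'; lra.
- have [j [wj gj thj]] := th_a; exists j; split=> //.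
  by rewrite Rmin_right ?Rmax_left; lra.
- have [j [wj gj thj]] := th_d; exists j; split=> //.
  by rewrite Rmin_left ?Rmax_right ?plus_IZR; lra.
Qed.

Lemma continuous_pathP g : continuous_path g <-> forall t e, 0 < e ->
  exists d, 0 < d /\ forall s, Rabs (s - t) < d -> dsup (g t) (g s) < e.
Proof.
split=> [[g1 g2] t e e0|g_cont].
  have [d1 [d1_gt0 near1]] := g1 t e e0; have [d2 [d2_gt0 near2]] := g2 t e e0.
  exists (Rmin d1 d2); split; first exact: Rmin_glb_lt.
  move=> s st; have := Rmin_l d1 d2; have := Rmin_r d1 d2 => d_le2 d_le1.
  case: (Req_dec t s) => [<-|ts]; first by rewrite dsup_refl.
  rewrite dsup_sym; apply/dsup_lt; split.
    by apply: (near1 s); split; [|rewrite /= /Rdist; lra].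
  by apply: (near2 s); split; [|rewrite /= /Rdist; lra].
by split=> t e e0; have [d [d0 near]] := g_cont t e e0; exists d; split=> // s [_ st];
  have := near s st; rewrite dsup_sym => /dsup_lt[].
Qed.

Lemma cont_on_unit_path g : continuous_path g -> cont_on_unit g.
Proof.
move=> /continuous_pathP g_cont t _ e e0.
have [d [d0 near]] := g_cont t (e / 2) ltac:(lra); exists d; split=> // s _ /near.
by have := dist2_le_dsup (g t) (g s); lra.
Qed.

Lemma continuous_path_comp G g :
  continuous_path g -> (forall t, continuous_at G (g t)) -> continuous_path (fun t => G (g t)).
Proof.
move=> /continuous_pathP g_cont G_cont; apply/continuous_pathP => t e e0.
have [d [d0 near_d]] := G_cont t e e0; have [d' [d'0 near_d']] := g_cont t d d0.
by exists d'; split=> // s /near_d' /near_d.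
Qed.

Lemma continuous_path_psub g h :
  continuous_path g -> continuous_path h -> continuous_path (fun t => psub (g t) (h t)).
Proof.
by case=> g1 g2 [h1 h2]; split; [exact: continuity_minus _ _ g1 h1 | exact: continuity_minus _ _ g2 h2].
Qed.

Lemma winding_number_intro g th k :
  continuous_path g -> g 0 = g 1 -> (forall t, 0 <= t <= 1 -> g t <> (0, 0)) ->
  continuity th -> (forall t, 0 <= t <= 1 -> is_angle (th t) (g t)) ->
  th 1 - th 0 = 2 * PI * IZR k -> winding_number g k.
Proof.
move=> g_cont g01 g_nz th_cont thP th01; split; first exact: cont_on_unit_path.
do 2 split=> //; exists th; split; last split=> //.
- move=> t _ e e0; have [d [d0 near]] := th_cont t e e0; exists d; split=> // s _ st.
  case: (Req_dec t s) => [<-|ts]; first by rewrite Rminus_diag Rabs_R0.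
  by rewrite Rabs_minus_sym; apply: (near s).
- by move=> t t01; have [c s] := thP t t01; rewrite dist2_origin -c -s; case: (g t).
Qed.

Lemma winding_number_lift g k : winding_number g k ->
  exists th, [/\ continuity th, forall t, 0 <= t <= 1 -> is_angle (th t) (g t) &
    th 1 - th 0 = 2 * PI * IZR k].
Proof.
case=> _ [_ [_ [th [th_cont [thP th01]]]]].
exists (fun t => th (clamp 0 1 t)); split.
- move=> t e e0; have c01 t' := @clamp_bounds 0 1 t' ltac:(lra).
  have [d [d0 near]] := th_cont _ (c01 t) e e0.
  have [d' [d'0 near']] := continuity_clamp 0 1 t d0.
  exists d'; split=> // s st; rewrite /= /Rdist Rabs_minus_sym.
  by apply: near; [exact: c01 | exact: near' s st].
- move=> t t01; rewrite clamp_id //; have := thP t t01; rewrite dist2_origin => gt.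
  by split; rewrite {1}gt.
- by rewrite !clamp_id //; lra.
Qed.

Lemma winding_number_ext g g' k :
  (forall t, 0 <= t <= 1 -> g t = g' t) -> winding_number g k -> winding_number g' k.
Proof.
move=> gg' [g_cont [g01 [g_nz [th [th_cont [thP th01]]]]]]; split; last split; last split.
- move=> t t01 e e0; have [d [d0 near]] := g_cont t t01 e e0; exists d; split=> // s s01 st.
  by rewrite -!gg' //; apply: near.
- by rewrite -!gg' //; lra.
- by move=> t t01; rewrite -gg' //; apply: g_nz.
- by exists th; do 2 split=> //; move=> t t01; rewrite -gg' //; apply: thP.
Qed.

Lemma winding_number_of_turn g w c :
  continuous_path g -> g 0 = g 1 -> (forall t, 0 <= t <= 1 -> g t <> (0, 0)) ->
  turn g 0 w 1 w c -> winding_number g c.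
Proof.
move=> g_cont g01 g_nz [_ [th [th_cont thP [k [wk gk th0]] [k' [wk' gk' th1]]]]].
apply: (winding_number_intro (th := th)) => //; rewrite th0 th1 g01 in gk *.
by have := angle_variation wk gk wk' gk'; lra.
Qed.

(* Between two lifts the difference of the angles is a continuous function with values in
   2 PI Z; the intermediate value theorem would produce a point where it is an odd multiple. *)
Lemma winding_number_le g k k' : winding_number g k -> winding_number g k' -> (k' <= k)%Z.
Proof.
move=> g_k g_k'; case: (Z.le_gt_cases k' k) => // k_lt.
have g_nz : forall t, 0 <= t <= 1 -> g t <> (0, 0) by have [_ [_ []]] := g_k.
have [a [a_cont aP a01]] := winding_number_lift g_k.
have [b [b_cont bP b01]] := winding_number_lift g_k'.
have same_angle t : 0 <= t <= 1 -> cos (b t - a t) = 1 /\ sin (b t - a t) = 0.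
  move=> t01; have [c s] := is_angle_cos_sin (g_nz t t01) (aP t t01) (bP t t01).
  by rewrite cos_minus sin_minus c s; have := cos_sin_sqr (b t); lra.
pose D t := b t - a t - (b 0 - a 0) - PI.
have D_cont : continuity D.
  apply: (continuity_minus _ (fun=> PI)); last by apply: continuity_const.
  apply: (continuity_minus _ (fun=> b 0 - a 0)); last by apply: continuity_const.
  exact: continuity_minus.
have k1 : 1 <= IZR k' - IZR k by rewrite -minus_IZR; apply: IZR_le; lia.
have pi0 := PI_RGT_0.
have [z [z01 Dz]] := IVT D 0 1 D_cont ltac:(lra) ltac:(rewrite /D; lra) ltac:(rewrite /D; nra).
have [cos_z _] := same_angle z z01; have [cos_0 sin_0] := same_angle 0 ltac:(lra).
have diff_z : b z - a z = (b 0 - a 0) + PI by rewrite /D in Dz; lra.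
by move: cos_z; rewrite diff_z cos_plus cos_PI sin_PI cos_0 sin_0; lra.
Qed.

Lemma winding_number_unique g k k' : winding_number g k -> winding_number g k' -> k = k'.
Proof.
by move=> g_k g_k'; have := winding_number_le g_k g_k'; have := winding_number_le g_k' g_k; lia.
Qed.

Definition dot (u v : pt) : R := u.1 * v.1 + u.2 * v.2.
Definition cross (u v : pt) : R := u.1 * v.2 - u.2 * v.1.

Lemma dot_gt0_neq0 u v : 0 < dot u v -> u <> (0, 0) /\ v <> (0, 0).
Proof. by rewrite /dot => uv; split=> E; rewrite E /= in uv; lra. Qed.

Lemma dot_gt0_near v : v <> (0, 0) -> exists e, 0 < e /\ forall x y,
  dsup x v < e -> dsup y v < e -> 0 < dot x y.
Proof.
move=> /dsup_gt0 v0; pose d := dsup v (0, 0); exists (d / 8); split; first by rewrite /d; lra.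
move=> x y /dsup_lt[x1 x2] /dsup_lt[y1 y2].
have close a b w : Rabs (a - w) < d / 8 -> Rabs (b - w) < d / 8 -> Rabs w <= d ->
    w * w - d * d / 2 < a * b.
  by move: v0; rewrite -/d; split_Rabs; nra.
have /dsup_le := Rle_refl d; rewrite /= !Rminus_0_r => -[w1 w2].
have /close/(_ _ w1) := x1 => /(_ _ y1) xy1; have /close/(_ _ w2) := x2 => /(_ _ y2) xy2.
have big : d * d <= v.1 * v.1 + v.2 * v.2.
  by rewrite /d /dsup /Rmax /= !Rminus_0_r; case: Rle_dec => _; split_Rabs; nra.
by rewrite /dot; lra.
Qed.

Lemma norm2_dot_cross u v : norm2 (dot u v, cross u v) = norm2 u * norm2 v.
Proof.
rewrite /norm2 -sqrt_mult; try nra.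
by congr sqrt; rewrite /dot /cross /=; ring.
Qed.

Lemma is_angle_rotate u v th : 0 < dot u v ->
  is_angle th u -> is_angle (th + angle 0 (dot u v, cross u v)) v.
Proof.
move=> uv [u1 u2]; have [u0 _] := dot_gt0_neq0 uv; have n0 := norm2_gt0 u0.
have [] := @is_angle_angle 0 (dot u v, cross u v) uv; rewrite norm2_dot_cross /=.
set be := angle 0 _ => dot_eq cross_eq; have sqr := norm2_sqr u.
have v1 : v.1 * (norm2 u * norm2 u) = dot u v * u.1 - cross u v * u.2.
  by rewrite sqr /dot /cross; ring.
have v2 : v.2 * (norm2 u * norm2 u) = dot u v * u.2 + cross u v * u.1.
  by rewrite sqr /dot /cross; ring.
have nn : norm2 u * norm2 u <> 0 by nra.
split; apply: (Rmult_eq_reg_r _ _ _ _ nn).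
- by rewrite v1 dot_eq cross_eq u1 u2 cos_plus; ring.
- by rewrite v2 dot_eq cross_eq u1 u2 sin_plus; ring.
Qed.

Lemma winding_number_dot_gt0 g g' k : continuous_path g -> continuous_path g' -> g' 0 = g' 1 ->
  (forall t, 0 <= t <= 1 -> 0 < dot (g t) (g' t)) ->
  winding_number g k -> winding_number g' k.
Proof.
move=> g_cont g_cont' g'01 gg' g_k; have g01 : g 0 = g 1 by have [_ []] := g_k.
have [th [th_cont thP th01]] := winding_number_lift g_k.
pose q t := (dot (g t) (g' t), cross (g t) (g' t)).
have q_cont : continuous_path q.
  case: g_cont g_cont' => g1 g2 [h1 h2]; split.
    exact: continuity_plus _ _ (continuity_mult _ _ g1 h1) (continuity_mult _ _ g2 h2).
  exact: continuity_minus _ _ (continuity_mult _ _ g1 h2) (continuity_mult _ _ g2 h1).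
apply: (winding_number_intro (th := fun t => th t + angle 0 (q (clamp 0 1 t)))) => //.
- by move=> t /gg'/dot_gt0_neq0[].
- apply: (continuity_plus th) => //.
  apply: (@continuity_angle 0 (fun t => q (clamp 0 1 t))); first exact: continuous_path_clamp.
  by move=> t; apply: gg'; apply: clamp_bounds; lra.
- by move=> t t01; rewrite clamp_id //; apply: is_angle_rotate; [apply: gg' | apply: thP].
- by rewrite !clamp_id /q ?g'01 ?g01; lra.
Qed.

(** * Local stable and unstable sets *)

Lemma fiterD f m n x : fiter f (m + n) x = fiter f m (fiter f n x).
Proof. by elim: m => //= m; rewrite /fiter /= => ->. Qed.

Lemma fiterM f m n x : fiter f (m * n) x = fiter (fiter f n) m x.
Proof. by elim: m => // m IH; rewrite mulSn fiterD IH. Qed.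

Lemma fiter_fixed f p n : f p = p -> fiter f n p = p.
Proof. by move=> fp; elim: n => //= n; rewrite /fiter /= => ->. Qed.

Lemma continuous_at_fiter f k x :
  (forall i, (i < k)%N -> continuous_at f (fiter f i x)) -> continuous_at (fiter f k) x.
Proof.
elim: k => [|k IH] f_cont; first exact: continuous_at_id.
apply: (@continuous_at_comp (fiter f k) f); last exact: f_cont.
by apply: IH => i ik; apply/f_cont/ltnW.
Qed.

Record isolating_square (f : pt -> pt) (p : pt) (r : R) : Prop := IsolatingSquare {
  isolating_fixed : f p = p;
  isolating_radius_gt0 : 0 < r;
  isolating_continuous : forall x, dsup x p <= r -> continuous_at f x;
  isolating_orbit : forall s : Z -> pt, (forall n, f (s n) = s (n + 1)%Z) ->
    (forall n, dsup (s n) p <= r) -> s 0%Z = p }.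

Section Dynamics.
Variables (f : pt -> pt) (p : pt) (r : R).
Hypothesis square : isolating_square f p r.

Let fp := isolating_fixed square.
Let f_cont := isolating_continuous square.

Definition orbit_in (k : nat) (x : pt) : Prop :=
  forall i, (i <= k)%N -> dsup (fiter f i x) p <= r.
Definition has_past (j : nat) (x : pt) : Prop := exists y, orbit_in j y /\ fiter f j y = x.
Definition stable (x : pt) : Prop := forall i, dsup (fiter f i x) p <= r.
Definition unstable (x : pt) : Prop := forall j, has_past j x.

Lemma orbit_in_le j k x : (j <= k)%N -> orbit_in k x -> orbit_in j x.
Proof. by move=> jk orb i ij; apply/orb/(leq_trans ij). Qed.

Lemma orbit_in_shift j k x : orbit_in (j + k) x -> orbit_in j (fiter f k x).
Proof. by move=> orb i ij; rewrite -fiterD; apply: orb; rewrite leq_add2r. Qed.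

Lemma orbit_in_cat j k x : orbit_in k x -> orbit_in j (fiter f k x) -> orbit_in (j + k) x.
Proof.
move=> orb orb' i ijk; case: (leqP i k) => [/orb //|/ltnW ki].
by rewrite -(subnK ki) fiterD; apply: orb'; rewrite leq_subLR addnC.
Qed.

Lemma orbit_in_continuous k x i : orbit_in k x -> (i <= k.+1)%N -> continuous_at (fiter f i) x.
Proof.
by move=> orb ik; apply: continuous_at_fiter => j ji; apply/f_cont/orb; rewrite -ltnS (leq_trans ji).
Qed.

Lemma orbit_in_fixed k : orbit_in k p.
Proof. by move=> i _; rewrite fiter_fixed // dsup_refl; have := isolating_radius_gt0 square; lra. Qed.

Lemma orbit_in_limit k u x :
  converges u x -> eventually (fun n => orbit_in k (u n)) -> orbit_in k x.
Proof.
move=> ux; elim: k => [|k IH] orb i; rewrite ?leqn0 => ik.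
  rewrite (eqP ik); apply: converges_in_ball ux _.
  by apply: eventually_imp orb => n orb_n; apply: (orb_n 0%N).
have orb_x : orbit_in k x.
  by apply: IH; apply: eventually_imp orb => n; apply: orbit_in_le.
apply: converges_in_ball (continuous_at_converges (orbit_in_continuous orb_x ik) ux) _.
by apply: eventually_imp orb => n; apply.
Qed.

Lemma has_past_le i j x : (i <= j)%N -> has_past j x -> has_past i x.
Proof.
move=> ij [y [orb <-]]; exists (fiter f (j - i) y); rewrite -fiterD subnKC //; split=> //.
by apply: orbit_in_shift; rewrite subnKC.
Qed.

Lemma has_past_in j x : has_past j x -> dsup x p <= r.
Proof. by case=> y [orb <-]; apply: orb. Qed.

Lemma has_past_pred j x : has_past j.+1 x -> exists y, f y = x /\ has_past j y.
Proof.
case=> y [orb yx]; exists (fiter f j y); split=> //; exists y; split=> //.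
exact: orbit_in_le orb.
Qed.

Lemma has_past_limit j u x :
  converges u x -> eventually (fun n => has_past j (u n)) -> has_past j x.
Proof.
move=> ux [N past].
have [y y_spec] := choice (fun n y => orbit_in j y /\ fiter f j y = u (N + n)%N)
  (fun n => past (N + n)%N (leq_addr n N)).
have [s [z [s_inc sz _]]] := bounded_subseq (fun n => proj1 (y_spec n) 0%N (leq0n j)).
have orb_z : orbit_in j z by apply: orbit_in_limit sz (eventually_all _) => n; have [] := y_spec (s n).
exists z; split=> //.
apply: converges_unique (continuous_at_converges (orbit_in_continuous orb_z (leqnSn j)) sz) _.
apply: (converges_ext (u := fun n => u (N + s n)%N)) => [n|].
  by have [_ <-] := y_spec (s n).
by apply: (converges_subseq (s := fun n => (N + s n)%N) _ ux) => n; rewrite ltn_add2l.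
Qed.

Lemma unstable_pred x : unstable x -> exists y, f y = x /\ unstable y.
Proof.
move=> past; have [y y_spec] := choice _ (fun n => has_past_pred (past n.+1)).
have [s [z [s_inc sz zp]]] := bounded_subseq (fun n => has_past_in (proj2 (y_spec n))).
exists z; split.
  apply: converges_unique (continuous_at_converges (f_cont zp) sz) _.
  by apply: converges_ext (@converges_const x) => n; have [] := y_spec (s n).
move=> j; apply: has_past_limit sz _; exists j => n jn.
by apply: has_past_le (proj2 (y_spec (s n))); apply: leq_trans jn (increasing_seq_ge n s_inc).
Qed.

Lemma unstable_orbit n x : unstable x ->
  exists y, fiter f n y = x /\ forall i, (i <= n)%N -> unstable (fiter f i y).
Proof.
elim: n x => [|n IH] x x_unst; first by exists x; split=> // i; rewrite leqn0 => /eqP ->.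
have [y [yx y_unst]] := unstable_pred x_unst; have [z [zy z_unst]] := IH y y_unst.
have zx : fiter f n.+1 z = x by rewrite -yx -zy.
exists z; split=> // i.
rewrite leq_eqVlt => /orP[/eqP ->|]; last exact: z_unst.
by rewrite zx.
Qed.

Lemma unstable_stable_fixed x : unstable x -> stable x -> x = p.
Proof.
move=> x_unst x_stab.
have [prev prev_spec] : exists prev, forall y, unstable y -> f (prev y) = y /\ unstable (prev y).
  apply: (choice (fun y z => unstable y -> f z = y /\ unstable z)) => y.
  case: (classic (unstable y)) => [/unstable_pred[z z_pred]|not_y]; first by exists z.
  by exists y.
have prev_unst n : unstable (iter n prev x) by elim: n => //= n /prev_spec[].
pose orbit (n : Z) := if (0 <=? n)%Z then fiter f (Z.to_nat n) x else iter (Z.to_nat (- n)) prev x.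
apply: (isolating_orbit square (s := orbit)) => n; rewrite /orbit; last first.
  by case: (0 <=? n)%Z; [apply: x_stab | apply: has_past_in (prev_unst _ 0%N)].
case: (Z.leb_spec 0 n) => n0.
  have -> : (0 <=? n + 1)%Z by apply/Z.leb_le; lia.
  by have -> : Z.to_nat (n + 1) = (Z.to_nat n).+1 by lia.
have -> : Z.to_nat (- n) = (Z.to_nat (- (n + 1))).+1 by lia.
rewrite iterS (proj1 (prev_spec _ (prev_unst _))); case: (Z.leb_spec 0 (n + 1)) => // n1.
by have -> : n = (-1)%Z by lia.
Qed.

Lemma periodic_orbit_fixed n x : (0 < n)%N -> orbit_in n x -> fiter f n x = x -> x = p.
Proof.
move=> n0 orb fx.
have periods j : orbit_in (j * n) x /\ fiter f (j * n) x = x.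
  elim: j => [|j [orb_j fx_j]]; first by split=> //; apply: orbit_in_le orb.
  by rewrite mulSn fiterD fx_j; split=> //; apply: orbit_in_cat => //; rewrite fx_j.
apply: unstable_stable_fixed => j; have jn := leq_pmulr j n0.
  by apply: (has_past_le jn); exists x; apply: periods.
by have [orb_j _] := periods j; apply: orb_j.
Qed.

Lemma orbit_in_middle d : 0 < d ->
  eventually (fun k => forall x, orbit_in (k + k) x -> dsup (fiter f k x) p < d).
Proof.
move=> d0; apply: eventually_forall => s x s_inc orb.
have [t [z [t_inc tz _]]] := bounded_subseq (fun n => orb n (s n) (leq_addr _ _)).
have st_ge n : (n <= s (t n))%N := increasing_seq_ge n (increasing_seq_comp s_inc t_inc).
suff zp : z = p.
  by rewrite zp in tz; have [n] := eventually_exists (tz d d0); exists (t n).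
apply: unstable_stable_fixed => j.
  apply: has_past_limit tz _; exists j => n jn.
  apply: (has_past_le (leq_trans jn (st_ge n))); exists (x (t n)); split=> //.
  exact: orbit_in_le (leq_addr _ _) (orb (t n)).
apply: (orbit_in_limit (k := j) tz _ (leqnn j)); exists j => n jn.
by apply: orbit_in_le (leq_trans jn (st_ge n)) _; apply: orbit_in_shift.
Qed.

Lemma tends_or_constant_subseq (l : nat -> nat) :
  (forall i, eventually (fun n => (i <= l n)%N)) \/
  exists a s, increasing_seq s /\ forall n, l (s n) = a.
Proof.
case: (classic (forall i, eventually (fun n => (i <= l n)%N))) => [|bounded]; first by left.
right; have [i /not_eventually[s [s_inc small]]] := not_all_ex_not _ _ bounded.
apply: NNPP => none.
have avoids a : (a < i)%N -> eventually (fun n => l (s n) <> a).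
  move=> _; apply: NNPP => /not_eventually[t [t_inc ta]]; apply: none.
  by exists a, (s \o t); split; [apply: increasing_seq_comp | move=> n; apply: NNPP (ta n)].
have [n walk_avoids] := eventually_exists (eventually_below avoids).
by apply: (walk_avoids (l (s n))) => //; rewrite ltnNge; apply/negP/small.
Qed.

Lemma unstable_limit j u x : converges u p -> (forall n, orbit_in (j n) (u n)) ->
  converges (fun n => fiter f (j n) (u n)) x -> unstable x.
Proof.
move=> up orb ux; case: (tends_or_constant_subseq j) => [j_tends|[a [s [s_inc ja]]]] i.
  apply: has_past_limit ux (eventually_imp _ (j_tends i)) => n ij.
  by apply: (has_past_le ij); exists (u n).
have -> : x = p; last by exists p; split; [apply: orbit_in_fixed | apply: fiter_fixed].
apply: (converges_unique (converges_subseq s_inc ux)).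
rewrite -[p in converges _ p](fiter_fixed a fp).
apply: converges_ext (continuous_at_converges _ (converges_subseq s_inc up)) => [n|].
  by rewrite /= ja.
exact: orbit_in_continuous (@orbit_in_fixed a) (leqnSn a).
Qed.

Lemma stable_limit l u x : converges u x -> (forall n, orbit_in (l n) (u n)) ->
  converges (fun n => fiter f (l n) (u n)) p -> stable x.
Proof.
move=> ux orb up; case: (tends_or_constant_subseq l) => [l_tends|[a [s [s_inc la]]]] i.
  apply: (orbit_in_limit (k := i) ux _ (leqnn i)).
  by apply: eventually_imp (l_tends i) => n il; apply: orbit_in_le (orb n).
have orb_x : orbit_in a x.
  apply: orbit_in_limit (converges_subseq s_inc ux) (eventually_all _) => n /=.
  by have := orb (s n); rewrite la.
have xp : fiter f a x = p.
  apply: converges_unique (converges_subseq s_inc up).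
  have cont := orbit_in_continuous orb_x (leqnSn a).
  by apply: converges_ext (continuous_at_converges cont (converges_subseq s_inc ux)) => n /=; rewrite la.
apply: (orbit_in_le (leq_addr a i)) (leqnn i).
by apply: orbit_in_cat => //; rewrite xp; apply: orbit_in_fixed.
Qed.

Lemma orbit_in_interior : exists d, 0 < d <= r /\ forall k x,
  dsup x p <= d -> orbit_in k x -> dsup (fiter f k x) p <= d ->
  forall j, (j <= k)%N -> dsup (fiter f j x) p < r.
Proof.
have r0 := isolating_radius_gt0 square.
have [d [d0 near_d]] : exists d, 0 < d /\ forall q : pt * nat * nat,
    [/\ dsup q.1.1 p <= d, orbit_in q.1.2 q.1.1, dsup (fiter f q.1.2 q.1.1) p <= d & (q.2 <= q.1.2)%N] ->
    dsup (fiter f q.2 q.1.1) p < r.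
  apply: tolerance_exists => e q e_van q_spec.
  pose x n := (q n).1.1; pose k n := (q n).1.2; pose j n := (q n).2.
  have jk n : (j n <= k n)%N by have [] := q_spec n.
  have xp : converges x p.
    by apply: converges_near (@converges_const p) e_van (eventually_all _) => n; have [] := q_spec n.
  have xkp : converges (fun n => fiter f (k n) (x n)) p.
    by apply: converges_near (@converges_const p) e_van (eventually_all _) => n; have [] := q_spec n.
  have orb n : orbit_in (k n) (x n) by have [] := q_spec n.
  have [s [w [s_inc sw _]]] := bounded_subseq (fun n => orb n (j n) (jk n)).
  suff wp : w = p.
    by rewrite wp in sw; have [n] := eventually_exists (sw r r0); exists (s n).
  apply: unstable_stable_fixed.
    apply: (unstable_limit (j := j \o s) (converges_subseq s_inc xp)) sw => n.
    exact: orbit_in_le (jk (s n)) (orb (s n)).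
  apply: (stable_limit (l := fun n => (k (s n) - j (s n))%N) sw) => [n|].
    by apply: orbit_in_shift; rewrite subnK.
  apply: converges_ext (converges_subseq s_inc xkp) => n /=.
  by rewrite -fiterD subnK.
exists (Rmin d r); split; first by split; [apply: Rmin_glb_lt | apply: Rmin_r].
move=> k x xd orb xkd j jk; have min_le := Rmin_l d r.
by apply: (near_d (x, k, j)); split=> //=; lra.
Qed.

Lemma fiter_near_fixed N e : 0 < e ->
  exists d, 0 < d /\ forall x, dsup x p <= d -> forall t, (t <= N)%N -> dsup (fiter f t x) p <= e.
Proof.
move=> e0; elim: N => [|N [d [d0 near_d]]].
  by exists e; split=> // x xe t; rewrite leqn0 => /eqP ->.
have [d' [d'0 near_d']] := orbit_in_continuous (@orbit_in_fixed N) (leqnn _) e0.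
have [min_l min_r] : Rmin d (d' / 2) <= d /\ Rmin d (d' / 2) <= d' / 2.
  by split; [apply: Rmin_l | apply: Rmin_r].
exists (Rmin d (d' / 2)); split; first by apply: Rmin_glb_lt; lra.
move=> x xd t; rewrite leq_eqVlt => /orP[/eqP ->|tN]; last by apply: near_d => //; lra.
have := near_d' x; rewrite fiter_fixed // dsup_sym (dsup_sym p (fiter _ _ _)) => image_near.
by left; apply: image_near; lra.
Qed.

End Dynamics.

(** * Pseudo-orbits and isolating blocks *)

Section PseudoOrbits.
Variables (f : pt -> pt) (p : pt) (rho : R).
Hypothesis f_cont : forall x, dsup x p <= rho -> continuous_at f x.

Definition pseudo_orbit (e : R) (m : nat) (u : nat -> pt) : Prop :=
  (forall i, (i <= m)%N -> dsup (u i) p <= rho) /\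
  forall i, (i < m)%N -> dsup (f (u i)) (u i.+1) <= e.

Lemma pseudo_orbit0 m u i : pseudo_orbit 0 m u -> (i <= m)%N -> u i = fiter f i (u 0%N).
Proof.
move=> [_ jump0]; elim: i => // i IH im; rewrite -[RHS]/(f (fiter f i (u 0%N))) -IH; last exact: ltnW.
by symmetry; apply: NNPP => /dsup_gt0; have := jump0 i im; lra.
Qed.

Lemma bounded_subseq_below m (u : nat -> nat -> pt) :
  (forall n i, (i <= m)%N -> dsup (u n i) p <= rho) ->
  exists s v, increasing_seq s /\ forall i, (i <= m)%N -> converges (fun n => u (s n) i) (v i).
Proof.
elim: m => [|m IH] u_bd.
  have [s [x [s_inc sx _]]] := bounded_subseq (fun n => u_bd n 0%N (leqnn 0)).
  by exists s, (fun=> x); split=> // i; rewrite leqn0 => /eqP ->.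
have [s [v [s_inc sv]]] := IH (fun n i im => u_bd n i (leqW im)).
have [t [x [t_inc tx _]]] := bounded_subseq (fun n => u_bd (s n) m.+1 (leqnn m.+1)).
exists (s \o t), (fun i => if i == m.+1 then x else v i); split; first exact: increasing_seq_comp.
move=> i; rewrite leq_eqVlt; case: eqP => [-> //|_ /= im].
exact: (converges_subseq t_inc (sv i im)).
Qed.

Lemma pseudo_orbit_limit e d m (u : nat -> nat -> pt) :
  vanishing d -> (forall n, pseudo_orbit (e + d n) m (u n)) ->
  exists s v, [/\ increasing_seq s, forall i, (i <= m)%N -> converges (fun n => u (s n) i) (v i) &
    pseudo_orbit e m v].
Proof.
move=> d_van orb; have [s [v [s_inc sv]]] := bounded_subseq_below (fun n => proj1 (orb n)).
have v_in i : (i <= m)%N -> dsup (v i) p <= rho.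
  by move=> im; apply: converges_in_ball (sv i im) (eventually_all _) => n; apply: (proj1 (orb (s n))).
exists s, v; split=> //; split=> // i im; apply: le_epsilon => a a0.
have fv := continuous_at_converges (f_cont (v_in i (ltnW im))) (sv i (ltnW im)).
apply: converges_dsup_le fv (sv i.+1 im) _.
have := vanishing_subseq s_inc d_van a0; apply: eventually_imp => n /= da.
by have := proj2 (orb (s n)) i im; lra.
Qed.

Definition pseudo_through (e : R) (m j : nat) (x : pt) : Prop :=
  exists u, pseudo_orbit e m u /\ u j = x.

Lemma pseudo_through_in e m j x : (j <= m)%N -> pseudo_through e m j x -> dsup x p <= rho.
Proof. by move=> jm [u [[u_in _] <-]]; apply: u_in. Qed.

Lemma pseudo_through_limit e d m j u x : (j <= m)%N -> vanishing d -> converges u x ->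
  (forall n, pseudo_through (e + d n) m j (u n)) -> pseudo_through e m j x.
Proof.
move=> jm d_van ux through.
have [w w_spec] := choice (fun n w => pseudo_orbit (e + d n) m w /\ w j = u n) through.
have [s [v [s_inc sv orb]]] := pseudo_orbit_limit d_van (fun n => proj1 (w_spec n)).
exists v; split=> //; apply: converges_unique (sv j jm) _.
by apply: converges_ext (converges_subseq s_inc ux) => n; have [_ ->] := w_spec (s n).
Qed.

Lemma pseudo_through_closed e m j u x : (j <= m)%N ->
  converges u x -> (forall n, pseudo_through e m j (u n)) -> pseudo_through e m j x.
Proof.
move=> jm ux through; apply: (pseudo_through_limit (d := fun=> 0)) jm _ ux _ => [d d0|n].
  by exists 0%N.
by rewrite Rplus_0_r.
Qed.

(* The orbits through [x] may be prolonged to pseudo-orbits of any length; [pos m] is the position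
   of [x] on those of length [m]. *)
Lemma pseudo_through_small (pos : nat -> nat) d : 0 < d -> (forall m, pos m <= m)%N ->
  (forall e j m x, (j <= m)%N -> pseudo_through e m (pos m) x -> pseudo_through e j (pos j) x) ->
  (forall x, (forall m, pseudo_through 0 m (pos m) x) -> x = p) ->
  exists m e, 0 < e /\ forall x, pseudo_through e m (pos m) x -> dsup x p < d.
Proof.
move=> d0 pos_le through_le only_p.
suff /eventually_exists[m m_spec] :
    eventually (fun n => forall x, pseudo_through (/ INR n.+1) n (pos n) x -> dsup x p < d).
  by exists m, (/ INR m.+1); split; first exact: inv_INR_gt0.
apply: eventually_forall => s x s_inc through.
have [t [w [t_inc tw _]]] := bounded_subseq (fun n => pseudo_through_in (pos_le _) (through n)).
have st_inc := increasing_seq_comp s_inc t_inc.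
suff wp : w = p by rewrite wp in tw; have [n] := eventually_exists (tw d d0); exists (t n).
apply: only_p => m; have tail_inc := increasing_seq_shift m st_inc.
apply: (pseudo_through_limit (pos_le m) (vanishing_subseq tail_inc vanishing_inv_INR)
  (converges_subseq (increasing_seq_shift m increasing_seq_id) tw)) => n; rewrite Rplus_0_l.
apply: through_le (through (t (m + n)%N)).
exact: leq_trans (leq_addr n m) (increasing_seq_ge _ st_inc).
Qed.

Lemma pseudo_start_le e j m x : (j <= m)%N -> pseudo_through e m 0 x -> pseudo_through e j 0 x.
Proof.
move=> jm [u [[u_in u_jump] <-]]; exists u; split=> //.
by split=> i ij; [apply: u_in | apply: u_jump]; apply: leq_trans jm.
Qed.

Lemma pseudo_end_le e j m x : (j <= m)%N -> pseudo_through e m m x -> pseudo_through e j j x.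
Proof.
move=> jm [u [[u_in u_jump] <-]]; exists (fun i => u (m - j + i)%N); rewrite subnK //; split=> //.
by split=> i ij; rewrite ?addnS; [apply: u_in | apply: u_jump]; lia.
Qed.

Lemma pseudo_start_small d : 0 < d -> (forall x, stable f p rho x -> x = p) ->
  exists m e, 0 < e /\ forall x, pseudo_through e m 0 x -> dsup x p < d.
Proof.
move=> d0 stab; apply: (pseudo_through_small (pos := fun=> 0%N)) => // [|x through].
  exact: pseudo_start_le.
apply: stab => i; have [u [orb <-]] := through i.
by rewrite -(pseudo_orbit0 orb (leqnn i)); apply: (proj1 orb).
Qed.

Lemma pseudo_end_small d : 0 < d -> (forall x, unstable f p rho x -> x = p) ->
  exists m e, 0 < e /\ forall x, pseudo_through e m m x -> dsup x p < d.
Proof.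
move=> d0 unst; apply: (pseudo_through_small (pos := id)) => // [|x through].
  exact: pseudo_end_le.
apply: unst => j; have [u [orb <-]] := through j.
exists (u 0%N); split=> [i ij|]; last by rewrite -(pseudo_orbit0 orb (leqnn j)).
by rewrite -(pseudo_orbit0 orb ij); apply: (proj1 orb).
Qed.

End PseudoOrbits.

(** * Sinks and sources *)

Lemma int2_dsup (N : pt -> Prop) x d : 0 < d -> (forall y, dsup y x < d -> N y) -> int2 N x.
Proof.
by move=> d0 ball; exists d; split=> // y xy; apply: ball; rewrite dsup_sym; have := dsup_le_dist2 x y; lra.
Qed.

Lemma int2_mem (N : pt -> Prop) x : int2 N x -> N x.
Proof.
by case=> e [e0]; apply; rewrite /dist2 !Rminus_diag (_ : 0 ^ 2 + 0 ^ 2 = 0) ?sqrt_0 //; ring.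
Qed.

Lemma compact2_sequential (N : pt -> Prop) p r : (forall x, N x -> dsup x p <= r) ->
  (forall u x, converges u x -> (forall n, N (u n)) -> N x) -> compact2 N.
Proof.
move=> N_bd N_closed; split.
  move=> x Nx; have [e [e0 ball_e]] : exists e, 0 < e /\ forall y, dsup y x <= e -> ~ N y.
    apply: tolerance_exists => e y e_van yx; apply: NNPP => none; apply: Nx.
    apply: (N_closed y) => [|n]; last by apply: NNPP => Ny; apply: none; exists n.
    exact: converges_near (@converges_const x) e_van (eventually_all _).
  by exists e; split=> // y xy; apply: ball_e; rewrite dsup_sym; have := dsup_le_dist2 x y; lra.
exists (2 * (r + dsup p (0, 0))) => x /N_bd xp.
by have := dist2_le_dsup x (0, 0); have := dsup_triangle x p (0, 0); lra.
Qed.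

Lemma isolating_square_exists U f p : open2 U -> cont_on2 U f -> U p -> isolated_fixed_set U f p ->
  exists r, isolating_square f p r /\ forall x, dsup x p <= r -> U x.
Proof.
move=> U_open f_cont Up [fp [N [[NU [N_compact N_isol]] N_inv]]].
have [e [e0 ball_e]] : int2 N p by apply/N_isol/N_inv.
have ball x : dsup x p <= e / 4 -> N x.
  by move=> xp; apply: ball_e; have := dist2_le_dsup p x; rewrite dsup_sym; lra.
exists (e / 4); split=> [|x /ball/NU //]; split=> //; first lra.
- move=> x /ball/NU Ux a a0; have [d [d0 near]] := f_cont x Ux a a0.
  have [d' [d'0 inU]] := U_open x Ux; have min0 := Rmin_glb_lt _ _ _ d0 d'0.
  exists (Rmin d d' / 2); split; first lra.
  move=> y xy; have := Rmin_l d d'; have := Rmin_r d d'; have := dist2_le_dsup x y => xy2 min_r min_l.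
  apply: Rle_lt_trans (dsup_le_dist2 _ _) _; apply: near; last lra.
  by apply: inU; lra.
- move=> s s_orb s_in; apply/N_inv; split; first exact/ball/s_in.
  by exists s; do 2 split=> //; move=> n; apply/ball/s_in.
Qed.

Section Blocks.
Variables (U : pt -> Prop) (f : pt -> pt) (p : pt) (r : R).
Hypothesis square : isolating_square f p r.
Hypothesis square_in : forall x, dsup x p <= r -> U x.
Hypothesis isolated : isolated_fixed_set U f p.

Let fp := isolating_fixed square.
Let r0 := isolating_radius_gt0 square.
Let f_cont := isolating_continuous square.

Lemma isolating_nbhd_closed (N : pt -> Prop) d : 0 < d -> (forall y, dsup y p < d -> N y) ->
  (forall x, N x -> dsup x p <= r) -> (forall u x, converges u x -> (forall n, N (u n)) -> N x) ->
  isolating_nbhd U f N /\ Inv_is_point f N p.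
Proof.
move=> d0 ball N_in N_closed; have Np : N p by apply: ball; rewrite dsup_refl.
have N_inv : Inv_is_point f N p.
  move=> x; split=> [[_ [s [<- [s_orb s_in]]]]|->].
    by apply: (isolating_orbit square) => // n; apply: N_in.
  by split=> //; exists (fun=> p).
split=> //; split; first by move=> x /N_in; apply: square_in.
split; first exact: compact2_sequential N_in N_closed.
by move=> x /N_inv ->; apply: int2_dsup d0 ball.
Qed.

Lemma source_of_stable rho : 0 < rho <= r -> (forall x, stable f p rho x -> x = p) ->
  is_source U f p.
Proof.
move=> [rho0 rho_r] stab.
have f_cont' x : dsup x p <= rho -> continuous_at f x by move=> xp; apply: f_cont; lra.
have [m [e [e0 small]]] := pseudo_start_small f_cont' (ltac:(lra) : 0 < rho / 2) stab.
pose N := pseudo_through f p rho e m 0.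
have N_in x : N x -> dsup x p <= rho := @pseudo_through_in _ _ _ _ _ _ x (leq0n m).
have open_preimage x : dsup x p < rho -> N (f x) ->
    exists d, 0 < d /\ forall y, dsup y x < d -> N y.
  move=> xp [u [[u_in u_jump] ux]]; have [d [d0 near]] := f_cont' x ltac:(lra) e e0.
  exists (Rmin d (rho - dsup x p)); split; first by apply: Rmin_glb_lt; lra.
  move=> y yx; have := Rmin_l d (rho - dsup x p); have := Rmin_r d (rho - dsup x p) => min_r min_l.
  have yp := dsup_triangle y x p; apply: (@pseudo_start_le _ _ _ _ m m.+1) => //.
  exists (fun i => if i is i'.+1 then u i' else y); split=> //.
  split=> [[|i] im|[|i] im]; [lra | exact: u_in | | exact: u_jump].
  by rewrite ux dsup_sym; left; apply: near; rewrite dsup_sym; lra.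
have Np : N p.
  exists (fun=> p); split=> //; split=> i _; rewrite ?fp dsup_refl; lra.
have [d [d0 ball]] : exists d, 0 < d /\ forall y, dsup y p < d -> N y.
  by apply: open_preimage; rewrite ?fp ?dsup_refl.
have [N_nbhd N_inv] := isolating_nbhd_closed d0 ball (fun x Nx => Rle_trans _ _ _ (N_in x Nx) rho_r)
  (fun u x => @pseudo_through_closed _ _ _ f_cont' e m 0 u x (leq0n m)).
split=> //; exists N; do 2 split=> //; split=> [x [Nx bd_x] /int2_mem Nfx|x Nx xp].
  apply: bd_x; have [d' [d'0 ball']] := open_preimage x ltac:(have := small x Nx; lra) Nfx.
  exact: int2_dsup d'0 ball'.
apply: NNPP => never; apply/xp/stab => i; apply: N_in.
by apply: NNPP => out; apply: never; exists i.
Qed.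

Lemma sink_of_unstable : (forall x, unstable f p r x -> x = p) -> is_sink U f p.
Proof.
move=> unst; have [d [d0]] := f_cont (ltac:(rewrite dsup_refl; lra) : dsup p p <= r) r0.
rewrite fp => near; have [m [e [e0 small]]] := pseudo_end_small f_cont d0 unst.
pose N := pseudo_through f p r e m m.
have N_in x : N x -> dsup x p <= r := @pseudo_through_in _ _ _ _ _ _ x (leqnn m).
have min0 := Rmin_glb_lt _ _ _ r0 e0.
have ball y : dsup y p < Rmin r e -> N y.
  have := Rmin_l r e; have := Rmin_r r e => min_r min_l yp.
  exists (fun i => if (i < m)%N then p else y); rewrite ltnn; split=> //.
  split=> i im; first by case: ifP => _; rewrite ?dsup_refl; lra.
  by rewrite im; case: ifP => _; rewrite fp ?dsup_refl ?(dsup_sym p); lra.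
have [N_nbhd N_inv] := isolating_nbhd_closed min0 ball N_in
  (fun u x => @pseudo_through_closed _ _ _ f_cont e m m u x (leqnn m)).
split=> //; exists N; do 2 split=> //; move=> x Nx.
have fx_in : dsup (f x) p <= r by rewrite dsup_sym; left; apply: near; rewrite dsup_sym; apply: small.
move: Nx => [u [[u_in u_jump] ux]]; apply: (@pseudo_end_le _ _ _ _ m m.+1) => //.
exists (fun i => if (i <= m)%N then u i else f x); rewrite ltnn; split=> //.
split=> i im; first by case: ifP => // /u_in.
rewrite ltnS in im; rewrite im; case: ltnP => im'; first exact: u_jump.
by have -> : i = m by [lia|]; rewrite ux dsup_refl; lra.
Qed.

End Blocks.

(** * Deformation of a square path to a circle *)

Definition convex_comb (s : R) (x y : pt) : pt :=
  ((1 - s) * x.1 + s * y.1, (1 - s) * x.2 + s * y.2).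

Lemma convex_comb0 x y : convex_comb 0 x y = x.
Proof. by rewrite /convex_comb [RHS]surjective_pairing; congr pair; ring. Qed.

Lemma convex_comb1 x y : convex_comb 1 x y = y.
Proof. by rewrite /convex_comb [RHS]surjective_pairing; congr pair; ring. Qed.

Lemma dsup_convex_comb s s' x y :
  dsup (convex_comb s x y) (convex_comb s' x y) <= Rabs (s - s') * dsup x y.
Proof.
have /dsup_le[xy1 xy2] := Rle_refl (dsup x y); have abs0 := Rabs_pos (s - s').
apply/dsup_le; rewrite /=; split.
- have -> : (1 - s) * x.1 + s * y.1 - ((1 - s') * x.1 + s' * y.1) = (s - s') * - (x.1 - y.1) by ring.
  by rewrite Rabs_mult Rabs_Ropp; apply: Rmult_le_compat_l.
- have -> : (1 - s) * x.2 + s * y.2 - ((1 - s') * x.2 + s' * y.2) = (s - s') * - (x.2 - y.2) by ring.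
  by rewrite Rabs_mult Rabs_Ropp; apply: Rmult_le_compat_l.
Qed.

Lemma dsup_convex_comb_le s x y p r : 0 <= s <= 1 -> dsup x p <= r -> dsup y p <= r ->
  dsup (convex_comb s x y) p <= r.
Proof.
move=> s01 /dsup_le[x1 x2] /dsup_le[y1 y2]; apply/dsup_le => /=.
by split; apply: Rabs_le; split_Rabs; nra.
Qed.

Lemma continuous_path_convex_comb s g h :
  continuous_path g -> continuous_path h -> continuous_path (fun t => convex_comb s (g t) (h t)).
Proof.
have comb a b : continuity a -> continuity b -> continuity (fun t => (1 - s) * a t + s * b t).
  by move=> a_cont b_cont; exact: continuity_plus _ _ (continuity_scal a (1 - s) a_cont) (continuity_scal b s b_cont).
by case=> g1 g2 [h1 h2]; split; apply: comb.
Qed.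

Lemma psub_eq0 x y : psub x y = (0, 0) -> x = y.
Proof.
by case=> eq1 eq2; rewrite [x]surjective_pairing [y]surjective_pairing; congr pair; lra.
Qed.

Lemma continuous_at_psub G x : continuous_at G x -> continuous_at (fun y => psub y (G y)) x.
Proof.
move=> G_cont e e0; have [d [d0 near]] := G_cont (e / 2) ltac:(lra).
exists (Rmin d (e / 2)); split; first by apply: Rmin_glb_lt; lra.
move=> y xy; have /near/dsup_lt[G1 G2] : dsup x y < d by have := Rmin_l d (e / 2); lra.
have /dsup_lt[xy1 xy2] : dsup x y < e / 2 by have := Rmin_r d (e / 2); lra.
by apply/dsup_lt => /=; split; split_Rabs; lra.
Qed.

Lemma displacement_dot_gt0 G p a b :
  (forall x, a <= dsup x p <= b -> continuous_at G x /\ G x <> x) ->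
  exists e, 0 < e /\ forall x y, a <= dsup x p <= b -> a <= dsup y p <= b -> dsup x y <= e ->
    0 < dot (psub x (G x)) (psub y (G y)).
Proof.
move=> G_moves; have [e [e0 dot_pos]] : exists e, 0 < e /\ forall q : pt * pt,
    [/\ a <= dsup q.1 p <= b, a <= dsup q.2 p <= b & dsup q.2 q.1 <= e] ->
    0 < dot (psub q.1 (G q.1)) (psub q.2 (G q.2)).
  apply: tolerance_exists => e q e_van q_spec.
  have q_in n : dsup (q n).1 p <= b by have [[]] := q_spec n.
  have [s [x [s_inc sx xb]]] := bounded_subseq q_in.
  have xa : a <= dsup x p.
    by apply: converges_off_ball sx (eventually_all _) => n; have [[]] := q_spec (s n).
  have sy : converges (fun n => (q (s n)).2) x.
    apply: converges_near sx (vanishing_subseq s_inc e_van) (eventually_all _) => n.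
    by have [] := q_spec (s n).
  have [G_cont Gx] := G_moves x (conj xa xb).
  have psub_cont := continuous_at_psub G_cont.
  have nz : psub x (G x) <> (0, 0) by move=> /psub_eq0/esym.
  have [d [d0 dot_near]] := dot_gt0_near nz.
  have [n [near_x near_y]] := eventually_exists (eventually_and
    (continuous_at_converges psub_cont sx d0) (continuous_at_converges psub_cont sy d0)).
  by exists (s n); apply: dot_near.
exists e; split=> // x y xp yp xy; apply: (dot_pos (x, y)); split=> //.
by rewrite dsup_sym.
Qed.

Lemma winding_number_deformation (G : pt -> pt) p a b (g h : R -> pt) k :
  (forall x, a <= dsup x p <= b -> continuous_at G x /\ G x <> x) ->
  continuous_path g -> continuous_path h -> g 0 = g 1 -> h 0 = h 1 ->
  (forall s t, 0 <= s <= 1 -> 0 <= t <= 1 -> a <= dsup (convex_comb s (g t) (h t)) p <= b) ->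
  winding_number (fun t => psub (g t) (G (g t))) k ->
  winding_number (fun t => psub (h t) (G (h t))) k.
Proof.
move=> G_moves g_cont h_cont g01 h01 in_annulus g_k.
have [e [e0 close]] := displacement_dot_gt0 G_moves.
have b0 : 0 <= b.
  by have := in_annulus 0 0 ltac:(lra) ltac:(lra); have := dsup_ge0 (convex_comb 0 (g 0) (h 0)) p; lra.
have [M [Me M0]] := archimed_cor1 (e / (2 * b + 1)) ltac:(apply: Rdiv_lt_0_compat; lra).
have M_gt0 : 0 < INR M by apply: lt_0_INR; lia.
pose x i t := convex_comb (INR i / INR M) (g (clamp 0 1 t)) (h (clamp 0 1 t)).
have x_in i t : (i <= M)%N -> a <= dsup (x i t) p <= b.
  move=> iM; apply: in_annulus; last by apply: clamp_bounds; lra.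
  split; first by apply: Rle_mult_inv_pos => //; apply: pos_INR.
  apply: (Rmult_le_reg_r (INR M)) => //; have -> : INR i / INR M * INR M = INR i by field; lra.
  by rewrite Rmult_1_l; apply: le_INR; lia.
have x_cont i : (i <= M)%N -> continuous_path (fun t => psub (x i t) (G (x i t))).
  move=> iM; have cont : continuous_path (x i).
    by apply: continuous_path_convex_comb; apply: continuous_path_clamp.
  by apply: continuous_path_psub => //; apply: continuous_path_comp => // t; have [] := G_moves _ (x_in i t iM).
have x_step i t : dsup (x i t) (x i.+1 t) <= e.
  apply: Rle_trans (dsup_convex_comb _ _ _ _) _; set gt := g _; set ht := h _.
  have gh : dsup gt ht <= 2 * b.
    have c01 := clamp_bounds t (ltac:(lra) : 0 <= 1).
    have := in_annulus 0 _ ltac:(lra) c01; have := in_annulus 1 _ ltac:(lra) c01.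
    rewrite convex_comb0 convex_comb1 -/gt -/ht; have := dsup_triangle gt p ht.
    by rewrite (dsup_sym p); lra.
  have -> : INR i / INR M - INR i.+1 / INR M = - / INR M by rewrite S_INR; field; lra.
  have inv0 := Rinv_0_lt_compat _ M_gt0; rewrite Rabs_Ropp Rabs_pos_eq; last lra.
  have : / INR M * (2 * b + 1) < e.
    apply: (Rmult_lt_reg_r (/ (2 * b + 1))); first by apply: Rinv_0_lt_compat; lra.
    by rewrite Rmult_assoc Rinv_r ?Rmult_1_r; [exact: Me | lra].
  by have := dsup_ge0 gt ht; nra.
have x_k i : (i <= M)%N -> winding_number (fun t => psub (x i t) (G (x i t))) k.
  elim: i => [|i IH] iM.
    apply: winding_number_ext g_k => t t01.
    by rewrite /x clamp_id // (_ : INR 0 / INR M = 0) ?convex_comb0 //= /Rdiv Rmult_0_l.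
  apply: winding_number_dot_gt0 (IH (ltnW iM)); [exact/x_cont/ltnW | exact: x_cont | |].
    by rewrite /x !clamp_id ?g01 ?h01 //; lra.
  by move=> t t01; apply: close; rewrite ?x_step //; apply: x_in; rewrite // ltnW.
apply: winding_number_ext (x_k M (leqnn M)) => t t01.
by rewrite /x clamp_id // (_ : INR M / INR M = 1) ?convex_comb1 //; field; lra.
Qed.

Definition side_param (k t : R) : R := clamp 0 1 (4 * t - k).

(* Counterclockwise along the boundary of the square of radius [rho], from the lower right
   corner. *)
Definition square_path (p : pt) (rho t : R) : pt :=
  (p.1 + rho * (1 + 2 * side_param 3 t - 2 * side_param 1 t),
   p.2 + rho * (-1 + 2 * side_param 0 t - 2 * side_param 2 t)).

Lemma continuity_side_param k : continuity (side_param k).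
Proof.
apply: (continuity_comp (fun t => 4 * t - k) (clamp 0 1)); last exact: continuity_clamp.
by move=> t; apply: derivable_continuous_pt; reg.
Qed.

Lemma side_param_before k t : 4 * t <= k -> side_param k t = 0.
Proof. by move=> tk; rewrite /side_param /clamp Rmin_right ?Rmax_left; lra. Qed.

Lemma side_param_after k t : k + 1 <= 4 * t -> side_param k t = 1.
Proof. by move=> tk; rewrite /side_param /clamp Rmin_left ?Rmax_right; lra. Qed.

Lemma side_param_on k t : k <= 4 * t <= k + 1 -> side_param k t = 4 * t - k.
Proof. by move=> tk; rewrite /side_param clamp_id; lra. Qed.

Lemma square_path_right p rho t : 0 <= 4 * t <= 1 ->
  square_path p rho t = (p.1 + rho, p.2 + rho * (2 * (4 * t - 0) - 1)).
Proof.
by move=> t01; rewrite /square_path (side_param_on (k := 0)) ?side_param_before; try lra; congr pair; ring.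
Qed.

Lemma square_path_top p rho t : 1 <= 4 * t <= 2 ->
  square_path p rho t = (p.1 + rho * (1 - 2 * (4 * t - 1)), p.2 + rho).
Proof.
move=> t12; rewrite /square_path (side_param_on (k := 1)) ?(side_param_after (k := 0)).
  by rewrite !side_param_before; try lra; congr pair; ring.
all: lra.
Qed.

Lemma square_path_left p rho t : 2 <= 4 * t <= 3 ->
  square_path p rho t = (p.1 - rho, p.2 + rho * (1 - 2 * (4 * t - 2))).
Proof.
move=> t23; rewrite /square_path (side_param_on (k := 2)) ?(side_param_before (k := 3)).
  by rewrite !side_param_after; try lra; congr pair; ring.
all: lra.
Qed.

Lemma square_path_bottom p rho t : 3 <= 4 * t <= 4 ->
  square_path p rho t = (p.1 + rho * (2 * (4 * t - 3) - 1), p.2 - rho).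
Proof.
by move=> t34; rewrite /square_path (side_param_on (k := 3)) ?side_param_after; try lra; congr pair; ring.
Qed.

Lemma square_path_closed p rho : square_path p rho 0 = square_path p rho 1.
Proof. by rewrite square_path_right ?square_path_bottom; try lra; congr pair; ring. Qed.

Lemma square_path_clamp p rho t : square_path p rho t = square_path p rho (clamp 0 1 t).
Proof.
have param_clamp k : 0 <= k <= 3 -> side_param k t = side_param k (clamp 0 1 t).
  by move=> k03; rewrite /side_param /clamp /Rmax /Rmin; repeat destruct Rle_dec; lra.
by rewrite /square_path -!param_clamp //; lra.
Qed.

Lemma continuous_path_square p rho : continuous_path (square_path p rho).
Proof.
have comb a b c k l : continuity (fun t => a + b * (c + 2 * side_param k t - 2 * side_param l t)).
  have k_cont := continuity_scal _ 2 (continuity_side_param k).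
  have l_cont := continuity_scal _ 2 (continuity_side_param l).
  apply: (continuity_plus (fun=> a)); first exact: continuity_const.
  apply: (continuity_scal _ b (continuity_minus _ _ (continuity_plus (fun=> c) _ _ k_cont) l_cont)).
  exact: continuity_const.
by split; apply: comb.
Qed.

Lemma continuous_path_circ p r : continuous_path (circ p r).
Proof. by split=> t; apply: derivable_continuous_pt; rewrite /circ /=; reg. Qed.

Lemma circ_closed p r : circ p r 0 = circ p r 1.
Proof. by rewrite /circ Rmult_0_r Rmult_1_r cos_0 sin_0 cos_2PI sin_2PI. Qed.

Lemma square_path_sides p rho t : 0 <= t <= 1 ->
  [\/ square_path p rho t = (p.1 + rho, p.2 + rho * (2 * (4 * t - 0) - 1)) /\ 0 <= 4 * t <= 1,
      square_path p rho t = (p.1 + rho * (1 - 2 * (4 * t - 1)), p.2 + rho) /\ 1 <= 4 * t <= 2,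
      square_path p rho t = (p.1 - rho, p.2 + rho * (1 - 2 * (4 * t - 2))) /\ 2 <= 4 * t <= 3 |
      square_path p rho t = (p.1 + rho * (2 * (4 * t - 3) - 1), p.2 - rho) /\ 3 <= 4 * t <= 4].
Proof.
move=> t01; case: (Rle_dec (4 * t) 1) => t1.
  by constructor 1; split; [apply: square_path_right|]; lra.
case: (Rle_dec (4 * t) 2) => t2; first by constructor 2; split; [apply: square_path_top|]; lra.
case: (Rle_dec (4 * t) 3) => t3; first by constructor 3; split; [apply: square_path_left|]; lra.
by constructor 4; split; [apply: square_path_bottom|]; lra.
Qed.

Lemma dsup_square_path p rho t : 0 <= t <= 1 -> 0 <= rho -> dsup (square_path p rho t) p = rho.
Proof.
move=> t01 rho0; apply: Rle_antisym; case: (square_path_sides p rho t01) => -[-> tk].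
1-4: by apply/dsup_le; split; apply: Rabs_le => /=; nra.
1-4: by apply: Rnot_lt_le => /dsup_lt /= [d1 d2]; split_Rabs; lra.
Qed.

Lemma quarter_circle_dot u : 0 <= u <= / 4 ->
  0 <= cos (2 * PI * u) + (8 * u - 1) * sin (2 * PI * u).
Proof.
move=> u4; have pi0 := PI_RGT_0; set th := 2 * PI * u.
have th_bd : 0 <= th <= PI / 2 by rewrite /th; nra.
have cos0 : 0 <= cos th by apply: cos_ge_0; lra.
have sin0 : 0 <= sin th by apply: sin_ge_0; lra.
case: (Rle_dec 1 (8 * u)) => u8; first by nra.
have th4 : th <= PI / 4 by rewrite /th; nra.
have sin_le : sin th <= sin (PI / 4) by apply: sin_incr_1; lra.
have cos_ge : cos (PI / 4) <= cos th by apply: cos_decr_1; lra.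
by rewrite -sin_cos_PI4 in cos_ge; nra.
Qed.

Lemma square_circ_dot p rho r t : 0 <= t <= 1 -> 0 <= rho -> 0 <= r ->
  0 <= dot (psub (square_path p rho t) p) (psub (circ p r t) p).
Proof.
move=> t01 rho0 r0; have rho_r := Rmult_le_pos _ _ rho0 r0.
pose form u := cos (2 * PI * u) + (8 * u - 1) * sin (2 * PI * u).
suff [u u4 ->] : exists2 u, 0 <= u <= / 4 &
    dot (psub (square_path p rho t) p) (psub (circ p r t) p) = rho * r * form u.
  exact: Rmult_le_pos rho_r (quarter_circle_dot u4).
rewrite /form; case: (square_path_sides p rho t01) => -[-> tk]; rewrite /dot /psub /circ /=.
- by exists t; [lra | ring].
- exists (t - / 4); first lra.
  have -> : 2 * PI * t = PI / 2 + 2 * PI * (t - / 4) by field.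
  by rewrite cos_plus sin_plus cos_PI2 sin_PI2; field.
- exists (t - / 2); first lra.
  have -> : 2 * PI * t = PI + 2 * PI * (t - / 2) by field.
  by rewrite cos_plus sin_plus cos_PI sin_PI; field.
- exists (t - 3 / 4); first lra.
  have -> : 2 * PI * t = 3 * (PI / 2) + 2 * PI * (t - 3 / 4) by field.
  by rewrite cos_plus sin_plus cos_3PI2 sin_3PI2; field.
Qed.

Lemma square_circ_annulus p rho r s t : 0 <= s <= 1 -> 0 <= t <= 1 -> 0 < r -> r / 2 <= rho <= r ->
  r / 4 <= dsup (convex_comb s (square_path p rho t) (circ p r t)) p <= r.
Proof.
move=> s01 t01 r0 rho_r; have rho0 : 0 <= rho by lra.
have dot0 := square_circ_dot p t01 rho0 (Rlt_le _ _ r0).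
have sq_sup := dsup_square_path p t01 rho0.
set x := square_path p rho t in dot0 sq_sup *; set y := circ p r t in dot0 *.
have y_norm : dot (psub y p) (psub y p) = r ^ 2.
  rewrite /dot /y /circ /=; have := cos_sin_sqr (2 * PI * t).
  set c := cos _; set s' := sin _ => unit.
  by transitivity (r ^ 2 * (c * c + s' * s')); [ring | rewrite unit; ring].
have x_norm : rho ^ 2 <= dot (psub x p) (psub x p).
  apply: Rnot_lt_le => x_lt; suff : dsup x p < rho by lra.
  apply/dsup_lt; rewrite /dot /= in x_lt; move: (x.1 - p.1) (x.2 - p.2) x_lt => x1 x2 x_lt.
  by split; apply: Rabs_def1; nra.
split.
  apply: dsup_ge; first lra.
  have -> : ((convex_comb s x y).1 - p.1) ^ 2 + ((convex_comb s x y).2 - p.2) ^ 2 =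
      (1 - s) ^ 2 * dot (psub x p) (psub x p) + s ^ 2 * dot (psub y p) (psub y p) +
      2 * (s * (1 - s)) * dot (psub x p) (psub y p) by rewrite /dot /=; ring.
  have cross0 : 0 <= 2 * (s * (1 - s)) * dot (psub x p) (psub y p) by apply: Rmult_le_pos => //; nra.
  have rho2 : (r / 2) ^ 2 <= dot (psub x p) (psub x p) by nra.
  have sqr0 := pow2_ge_0 (1 - s).
  have part_x := Rmult_le_compat_l _ _ _ sqr0 rho2.
  have halves := pow2_ge_0 (2 * s - 1).
  rewrite y_norm; nra.
apply: dsup_convex_comb_le => //; first lra.
apply/dsup_le; rewrite /dot /= in y_norm; move: (y.1 - p.1) (y.2 - p.2) y_norm => y1 y2 y_norm.
by split; apply: Rabs_le; split; nra.
Qed.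

Lemma winding_number_square_circ (G : pt -> pt) p rho r k : 0 < r -> r / 2 <= rho <= r ->
  (forall x, r / 4 <= dsup x p <= r -> continuous_at G x /\ G x <> x) ->
  winding_number (fun t => psub (square_path p rho t) (G (square_path p rho t))) k ->
  winding_number (fun t => psub (circ p r t) (G (circ p r t))) k.
Proof.
move=> r0 rho_r G_moves; apply: winding_number_deformation G_moves _ _ _ _ _.
- exact: continuous_path_square.
- exact: continuous_path_circ.
- exact: square_path_closed.
- exact: circ_closed.
- by move=> s t s01 t01; apply: square_circ_annulus.
Qed.

Local Open Scope nat_scope.

(** * Periodic points and divisor sums *)

Definition divisor_sum (C : nat) (al : nat -> nat) n : nat := \sum_(1 <= d < C.+1 | d %| n) d * al d.
Definition some_positive (C : nat) (al : nat -> nat) : Prop := exists d, 0 < d <= C /\ 0 < al d.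

Section PeriodicPoints.
Variables (T : finType) (phi : T -> T).

Definition periodic x : bool := iter (order phi x) phi x == x.

Lemma periodicP x : reflect (exists2 n, 0 < n & iter n phi x = x) (periodic x).
Proof.
apply: (iffP eqP) => [x_fixed|[n n0 x_fixed]]; first by exists (order phi x) => //; apply: order_gt0.
by apply: (all_iffLR (@orbitPcycle T phi x) 3 4); exists n.-1; rewrite prednK.
Qed.

Lemma iter_order_mul x k : periodic x -> iter (k * order phi x) phi x = x.
Proof. by move/eqP=> x_fixed; elim: k => [|k IH] //; rewrite mulSn iterD IH x_fixed. Qed.

Lemma iter_fixedE x n : periodic x -> (iter n phi x == x) = (order phi x %| n).
Proof.
move=> x_periodic; have [q [r [nE r_lt]]] : exists q r, n = q * order phi x + r /\ r < order phi x.
  by exists (n %/ order phi x), (n %% order phi x); rewrite -divn_eq ltn_mod order_gt0.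
rewrite nE addnC iterD iter_order_mul // dvdn_addl ?dvdn_mull //.
case: r r_lt {nE} => [|r] r_lt; first by rewrite eqxx dvdn0.
rewrite gtnNdvd //; apply/negbTE/eqP => iter_r.
by have := findex_iter r_lt; rewrite iter_r findex0.
Qed.

Lemma periodic_step x : periodic x -> periodic (phi x) /\ order phi (phi x) = order phi x.
Proof.
move=> x_periodic; split; last by apply: (all_iffLR (@orbitPcycle T phi x) 4 1); apply/eqP.
by apply/periodicP; exists (order phi x); rewrite ?order_gt0 // -iterSr iterS (eqP x_periodic).
Qed.

Lemma periodic_iter n x : periodic x -> periodic (iter n phi x) /\ order phi (iter n phi x) = order phi x.
Proof.
move=> x_periodic; elim: n => [|n [IH1 IH2]] //=.
by have [-> ->] := periodic_step IH1.
Qed.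

Lemma periodic_connect_sym x y : periodic x -> fconnect phi x y -> fconnect phi y x.
Proof.
move=> x_periodic /iter_findex <-; set k := findex _ _ _.
have k_le : k <= k.+1 * order phi x by apply: leq_trans (leqnSn k) _; rewrite leq_pmulr // order_gt0.
by rewrite -{2}(iter_order_mul k.+1 x_periodic) -(subnK k_le) iterD fconnect_iter.
Qed.

Variable L : pred T.
Hypothesis L_phi : forall x, L x -> L (phi x).

Let L_iter n x : L x -> L (iter n phi x).
Proof. by move=> Lx; elim: n => //= n; apply: L_phi. Qed.

Definition periodic_of_order d : {set T} := [set x | L x && periodic x && (order phi x == d)].

Lemma dvd_card_periodic_of_order d : d %| #|periodic_of_order d|.
Proof.
set D := periodic_of_order d; pose R := [rel x y | fconnect phi x y].
have R_equiv : {in D & &, equivalence_rel R}.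
  move=> x y z; rewrite !inE => /andP[/andP[_ x_periodic] _] /andP[/andP[_ y_periodic] _] _ /=.
  split=> // xy; apply/idP/idP; apply: connect_trans => //; exact: periodic_connect_sym.
have partD := equivalence_partitionP R_equiv.
rewrite (@card_uniform_partition _ d _ _ _ partD) ?dvdn_mull // => B /imsetP [x xD ->].
move: (xD); rewrite !inE => /andP[/andP[Lx x_periodic] /eqP dx].
rewrite -[RHS]dx /order; apply: eq_card => y; rewrite !inE /=.
case xy : (fconnect phi x y); last by rewrite andbF.
rewrite andbT; move/iter_findex: (xy) => <-.
by have [-> ->] := periodic_iter (findex phi x y) x_periodic; rewrite dx eqxx L_iter.
Qed.

Lemma order_le_card C x : #|[set x | L x && periodic x]| <= C -> L x -> periodic x ->
  0 < order phi x <= C.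
Proof.
move=> card_le Lx x_periodic; rewrite order_gt0; apply: leq_trans card_le.
apply: subset_leq_card; apply/subsetP => y; rewrite !inE => /iter_findex <-.
by rewrite L_iter //; have [-> _] := periodic_iter (findex phi x y) x_periodic.
Qed.

Lemma card_iter_fixed C n : #|[set x | L x && periodic x]| <= C -> 0 < n ->
  #|[pred x | L x && (iter n phi x == x)]| =
  divisor_sum C (fun d => #|periodic_of_order d| %/ d) n.
Proof.
rewrite /divisor_sum => card_le n0.
under eq_bigr do rewrite mulnC divnK ?dvd_card_periodic_of_order //.
rewrite -sum1_card.
transitivity (\sum_(x | L x && periodic x && (order phi x %| n)) 1).
  apply: eq_bigl => x; rewrite inE.
  case Lx : (L x) => //=; case x_periodic : (periodic x) => /=; first by rewrite iter_fixedE.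
  by apply/negbTE; apply: contraFN x_periodic => /eqP x_fixed; apply/periodicP; exists n.
under [RHS]eq_bigr do rewrite -sum1_card.
rewrite [RHS](exchange_big_dep (fun x => L x && periodic x && (order phi x %| n))) /=; last first.
  by move=> d x dn; rewrite !inE => /andP[-> /eqP ->].
apply: eq_bigr => x /andP[/andP[Lx x_periodic] order_dvd].
rewrite (big_rem (order phi x)) /= ?mem_index_iota ?ltnS ?order_le_card //.
rewrite order_dvd inE Lx x_periodic eqxx /= big1_seq // => d /andP[/andP[_ xd]].
move: xd; rewrite inE => /andP[_ /eqP <-].
by rewrite mem_rem_uniq ?iota_uniq // inE eqxx.
Qed.

Lemma periodic_exists x : L x -> exists2 y, L y & periodic y.
Proof.
move=> Lx; exists (iter (order phi x) phi x); first exact: L_iter.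
have /loopingP/(_ (order phi x))/trajectP[i i_lt iterE] := looping_order phi x.
apply/periodicP; exists (order phi x - i); first by rewrite subn_gt0.
by rewrite {1}iterE -iterD subnK // ltnW.
Qed.

Lemma some_periodic_order C x : #|[set x | L x && periodic x]| <= C -> L x ->
  some_positive C (fun d => #|periodic_of_order d| %/ d).
Proof.
move=> card_le /periodic_exists[y Ly y_periodic].
have /andP[order_gt order_le] := order_le_card card_le Ly y_periodic.
exists (order phi y); rewrite order_gt order_le; split=> //.
rewrite divn_gt0 //; apply: dvdn_leq (dvd_card_periodic_of_order _).
by apply/card_gt0P; exists y; rewrite inE Ly y_periodic eqxx.
Qed.
End PeriodicPoints.

Lemma divisor_sum_split C al n : 0 < n <= C ->
  divisor_sum C al n = n * al n + \sum_(1 <= d < n | d %| n) d * al d.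
Proof.
move=> /andP[n0 nC]; rewrite /divisor_sum (big_cat_nat (n := n)) //=; last exact: leqW.
rewrite addnC (big_ltn_cond (m := n)) ?ltnS // dvdnn big_nat_cond big1 ?addn0 // => d.
by move=> /andP[/andP[nd _] /(dvdn_leq n0)]; lia.
Qed.

Lemma divisor_sum_inj C al al' :
  (forall n, 0 < n <= C -> divisor_sum C al n = divisor_sum C al' n) ->
  forall d, 0 < d <= C -> al d = al' d.
Proof.
move=> sum_eq d; elim/ltn_ind: d => n IH n_range; have := sum_eq n n_range; rewrite !divisor_sum_split //.
have -> : \sum_(1 <= d < n | d %| n) d * al d = \sum_(1 <= d < n | d %| n) d * al' d.
  rewrite big_nat_cond [RHS]big_nat_cond; apply: eq_bigr => d /andP[/andP[d1 d2] _].
  by rewrite IH //; lia.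
by move/addIn/eqP; rewrite eqn_pmul2l; [move/eqP | lia].
Qed.

Lemma divisor_sum_fact C al n : C`! %| n -> divisor_sum C al n = \sum_(1 <= d < C.+1) d * al d.
Proof.
move=> fact_dvd; rewrite /divisor_sum big_mkcond big_nat_cond [RHS]big_nat_cond.
apply: eq_bigr => d /andP[/andP[d1 d2] _].
by rewrite (dvdn_trans (dvdn_fact _) fact_dvd) // d1.
Qed.

Lemma divisor_sum_le C al n : divisor_sum C al n <= \sum_(1 <= d < C.+1) d * al d.
Proof. by rewrite /divisor_sum big_mkcond; apply: leq_sum => d _; case: ifP. Qed.

(* The bound C may depend on k, but the two values of [b] at a common multiple of k and k0 bound b
   uniformly; then [b (q * n) = b n] for all large primes q. *)
Section DivisorSumSequence.
Variables (b : nat -> Z) (k0 : nat).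
Hypothesis k0_gt0 : 0 < k0.
Hypothesis b_multiples : forall k, k0 <= k -> exists C, forall nmax, exists al, some_positive C al /\
  forall n, 0 < n <= nmax -> b (n * k) = Z.of_nat (divisor_sum C al n).
Hypothesis b_prime : forall q m, prime q -> 0 < m -> exists c, b (q * m) = (b m + c * Z.of_nat q)%Z.

Lemma multiples_divisor_sum k : k0 <= k -> exists C al, some_positive C al /\
  forall n, 0 < n -> b (n * k) = Z.of_nat (divisor_sum C al n).
Proof.
move=> k0_k; have [C all_nmax] := b_multiples k0_k; have [al [al_pos bE]] := all_nmax C.
exists C, al; split=> // n n0; have [al' [_ bE']] := all_nmax (maxn C n).
rewrite bE'; last by rewrite n0 leq_maxr.
congr Z.of_nat; rewrite /divisor_sum big_nat_cond [RHS]big_nat_cond.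
apply: eq_bigr => d /andP[/andP[d1 d2] _]; congr (_ * _).
apply: (@divisor_sum_inj C) => [j j_range|]; last by rewrite d1.
by apply: Nat2Z.inj; rewrite -bE // -bE' //; lia.
Qed.

Lemma b_bounded : exists P, forall m, k0 <= m -> (0 <= b m <= Z.of_nat P)%Z.
Proof.
have [C [al [_ bE]]] := multiples_divisor_sum (leqnn k0).
exists (\sum_(1 <= d < C.+1) d * al d) => m k0_m; have m0 : 0 < m by lia.
have [C' [al' [_ bE']]] := multiples_divisor_sum k0_m.
rewrite -[m]mul1n (bE' 1%N isT).
suff <- : \sum_(1 <= d < C'.+1) d * al' d = \sum_(1 <= d < C.+1) d * al d.
  by have := divisor_sum_le C' al' 1; lia.
pose X := C`! * C'`!; have X0 : 0 < X by rewrite muln_gt0 !fact_gt0.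
rewrite -(@divisor_sum_fact C' al' (k0 * X)); last by rewrite /X !dvdn_mull.
rewrite -(@divisor_sum_fact C al (m * X)); last by rewrite /X dvdn_mull // dvdn_mulr.
have k0X : 0 < k0 * X by rewrite muln_gt0 k0_gt0.
have mX : 0 < m * X by rewrite muln_gt0 m0.
apply: Nat2Z.inj; rewrite -(bE' _ k0X) -(bE _ mX).
by rewrite mulnAC (mulnC k0 m) (mulnAC m).
Qed.

Lemma divisor_sum_of_congruences : exists C al, some_positive C al /\
  forall n, 0 < n -> b n = Z.of_nat (divisor_sum C al n).
Proof.
have [P b_le] := b_bounded.
have b_le_all n : 0 < n -> (0 <= b n <= Z.of_nat P)%Z.
  move=> n0; have [q q_large q_prime] := prime_above (k0 + Z.abs_nat (b n) + P + P).
  have [c bE] := b_prime q_prime n0.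
  have qn : k0 <= q * n by have := leq_pmulr q n0; lia.
  have := b_le _ qn; rewrite bE => bound.
  have c0 : c = 0%Z by nia.
  by move: bound; rewrite c0 Z.mul_0_l Z.add_0_r.
have [q q_large q_prime] := prime_above (k0 + P).
have [C [al [al_pos bE]]] := @multiples_divisor_sum q ltac:(lia).
exists C, al; split=> // n n0; rewrite -bE // mulnC.
have [c bqE] := b_prime q_prime n0.
have bound := b_le_all n n0; have := b_le_all (q * n); rewrite muln_gt0 prime_gt0 // n0 => /(_ isT).
rewrite bqE => bound_q; have -> : c = 0%Z by nia.
by lia.
Qed.
End DivisorSumSequence.

Local Open Scope ring_scope.

(** * Restrictions of matrices and their traces *)

Section Restriction.
Variables (K : comNzRingType) (n : nat).
Implicit Types (A : pred 'I_n) (X : 'M[K]_n).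

Definition coord_proj A : 'M[K]_n := diag_mx (\row_i (A i)%:R).
Definition restr_mx A X : 'M[K]_n := coord_proj A *m X *m coord_proj A.

Lemma mul_coord_proj A m (X : 'M[K]_(n, m)) i j : (coord_proj A *m X) i j = (A i)%:R * X i j.
Proof. by rewrite mul_diag_mx !mxE. Qed.

Lemma mul_mx_coord_proj A m (X : 'M[K]_(m, n)) i j : (X *m coord_proj A) i j = X i j * (A j)%:R.
Proof. by rewrite mul_mx_diag !mxE. Qed.

Lemma restr_mxE A X i j : restr_mx A X i j = if A i && A j then X i j else 0.
Proof.
by rewrite mul_mx_coord_proj mul_coord_proj; case: (A i); case: (A j); rewrite ?mul0r ?mulr0 ?mul1r ?mulr1.
Qed.

Lemma coord_proj_idem A : coord_proj A *m coord_proj A = coord_proj A.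
Proof. by apply/matrixP=> i j; rewrite mul_coord_proj !mxE; case: (A i); rewrite ?mul1r // mul0r mul0rn. Qed.

Lemma coord_projC A : coord_proj (predC A) = 1%:M - coord_proj A.
Proof.
by apply/matrixP=> i j; rewrite !mxE /=; case: (A i); case: (i == j); rewrite ?subrr ?subr0 ?mulr0n ?subrr.
Qed.

Lemma restr_exp_projr A X k : coord_proj A *m X *m coord_proj A = X *m coord_proj A ->
  X ^+ k *m coord_proj A = restr_mx A X ^+ k *m coord_proj A.
Proof.
move=> stab; elim: k => [|k IH]; first by rewrite !expr0.
by rewrite !exprSr -!mulmxE -[LHS]mulmxA -stab mulmxA mulmxA IH /restr_mx -!mulmxA coord_proj_idem.
Qed.

Lemma restr_exp_projl A X k : coord_proj A *m X *m coord_proj A = coord_proj A *m X ->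
  coord_proj A *m X ^+ k = coord_proj A *m restr_mx A X ^+ k.
Proof.
move=> stab; elim: k => [|k IH]; first by rewrite !expr0.
rewrite !exprS -!mulmxE [LHS]mulmxA -stab -[LHS]mulmxA IH /restr_mx !mulmxA.
by rewrite coord_proj_idem.
Qed.

Lemma mxtrace_exp_block A X k : (forall i j, ~~ A i -> A j -> X i j = 0) ->
  \tr (X ^+ k.+1) = \tr (restr_mx A X ^+ k.+1) + \tr (restr_mx (predC A) X ^+ k.+1).
Proof.
move=> block; set P := coord_proj A; set Q := coord_proj (predC A).
have PQ : P + Q = 1%:M by rewrite /P /Q coord_projC addrC subrK.
have QXP : Q *m X *m P = 0.
  apply/matrixP=> i j; rewrite mul_mx_coord_proj mul_coord_proj mxE /=.
  case Ai: (A i); first by rewrite !mul0r.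
  by case Aj: (A j); rewrite ?mulr0 // block ?Ai // mulr0 mul0r.
have stabP : P *m X *m P = X *m P by rewrite -[in RHS](mul1mx X) -PQ !mulmxDl QXP addr0.
have stabQ : Q *m X *m Q = Q *m X by rewrite -[in RHS](mulmx1 (Q *m X)) -PQ mulmxDr QXP add0r.
have split_trace Y : \tr (Y ^+ k.+1) = \tr (Y ^+ k.+1 *m P) + \tr (Q *m Y ^+ k.+1).
  by rewrite (mxtrace_mulC Q) -raddfD -mulmxDr PQ mulmx1.
rewrite split_trace (restr_exp_projr _ stabP) (restr_exp_projl _ stabQ); congr (_ + _).
  by rewrite exprSr -mulmxE /restr_mx -!mulmxA coord_proj_idem.
by rewrite exprS -mulmxE /restr_mx !mulmxA coord_proj_idem.
Qed.

Lemma restr_mx_eq0 A X : (forall i j, A i -> X i j = 0) -> restr_mx A X = 0.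
Proof.
by move=> rows0; apply/matrixP=> i j; rewrite restr_mxE mxE; case: ifP => // /andP[/rows0].
Qed.

Lemma mxtrace_exp_restr_rows A X k : (forall i j, ~~ A i -> X i j = 0) ->
  \tr (X ^+ k.+1) = \tr (restr_mx A X ^+ k.+1).
Proof.
move=> rows0; rewrite (mxtrace_exp_block (A := A)) => [|i j Ai _]; last exact: rows0.
by rewrite (restr_mx_eq0 (A := predC A)) ?exprS ?mul0r ?raddf0 ?addr0 // => i j /rows0.
Qed.

Definition graph_mx (a : 'I_n -> 'I_n) : 'M[K]_n := \matrix_(i, j) (j == a i)%:R.

Lemma mul_graph_mx a m (X : 'M[K]_(n, m)) i j : (graph_mx a *m X) i j = X (a i) j.
Proof.
rewrite mxE (bigD1 (a i)) //= big1 ?addr0; first by rewrite mxE eqxx mul1r.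
by move=> k /negPf ki; rewrite mxE ki mul0r.
Qed.

Lemma graph_mx_exp a k : graph_mx a ^+ k = graph_mx (iter k a).
Proof.
elim: k => [|k IH]; first by apply/matrixP=> i j; rewrite !mxE eq_sym.
by rewrite exprSr IH -mulmxE; apply/matrixP=> i j; rewrite mul_graph_mx !mxE.
Qed.

Lemma graph_mx_row_sum a i : \sum_j graph_mx a i j = 1.
Proof.
rewrite (bigD1 (a i)) //= big1 ?addr0; first by rewrite mxE eqxx.
by move=> j /negPf ji; rewrite mxE ji.
Qed.

Lemma mxtrace_graph_exp_restr (A : pred 'I_n) a k : (forall i, A i -> A (a i)) ->
  \tr (restr_mx A (graph_mx a) ^+ k.+1) = #|[pred i | A i && (iter k.+1 a i == i)]|%:R.
Proof.
move=> A_stable.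
have restr_exp j i l : A i -> (restr_mx A (graph_mx a) ^+ j) i l = (l == iter j a i)%:R.
  elim: j i l => [|j IH] i l Ai; first by rewrite expr0 mxE eq_sym.
  rewrite exprS -mulmxE mxE (bigD1 (a i)) //= big1 ?addr0 => [|m /negPf mi].
    by rewrite restr_mxE Ai A_stable // mxE eqxx mul1r IH ?A_stable // -iterSr.
  by rewrite restr_mxE mxE mi; case: ifP => _; rewrite mul0r.
rewrite -sum1_card natr_sum [in RHS]big_mkcond /mxtrace; apply: eq_bigr => i _ /=.
rewrite unfold_in /=; case: ifP => Ai /=.
  by rewrite restr_exp ?(andP Ai).1 // eq_sym (andP Ai).2.
case Ai': (A i); first by rewrite restr_exp // eq_sym -[_ == i]andTb -Ai' Ai.
by rewrite exprS -mulmxE mxE big1 // => l _; rewrite restr_mxE Ai' mul0r.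
Qed.

Definition walk X (k : nat) (w : nat -> 'I_n) : Prop :=
  forall t, (t < k)%N -> X (w t) (w t.+1) != 0.

Lemma mul_neq0 (x y : K) : x * y != 0 -> x != 0 /\ y != 0.
Proof.
by move=> xy; split; apply: contraNneq xy => ->; rewrite ?mul0r ?mulr0.
Qed.

Lemma sum_neq0 (I : finType) (F : I -> K) : \sum_i F i != 0 -> exists i, F i != 0.
Proof.
move=> nz; apply/existsP; apply: contraNT nz => /existsPn F0.
by rewrite big1 // => i _; apply/eqP; rewrite -[_ == _]negbK F0.
Qed.

Lemma exp_walk X k i j : (X ^+ k) i j != 0 ->
  exists w, [/\ w 0%N = i, w k = j & walk X k w].
Proof.
elim: k i j => [|k IH] i j.
  by rewrite expr0 mxE; case: (eqVneq i j) => [-> _|]; [exists (fun=> j) | rewrite eqxx].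
rewrite exprS -mulmxE mxE => /sum_neq0[l /mul_neq0[il /IH[w [w0 wk ww]]]].
by exists (fun t => if t is t'.+1 then w t' else i); split=> // -[|t] tk /=; [rewrite w0 | apply: ww].
Qed.

Lemma walk_cons X k i w : X i (w 0%N) != 0 -> walk X k w ->
  walk X k.+1 (fun t => if t is t'.+1 then w t' else i).
Proof. by move=> iw ww [|t] tk //; apply: ww. Qed.

Lemma exp_restr X A k i j :
  (forall w, walk X k w -> w 0%N = i -> w k = j -> forall t, (t <= k)%N -> A (w t)) ->
  (X ^+ k) i j = (restr_mx A X ^+ k) i j.
Proof.
elim: k i j => [|k IH] i j in_A; first by rewrite !expr0.
rewrite !exprS -!mulmxE !mxE; apply: eq_bigr => l _.
case: (eqVneq (X i l) 0) => [il0|il]; first by rewrite restr_mxE il0 if_same !mul0r.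
have tail w : walk X k w -> w 0%N = l -> w k = j ->
    forall t, (t <= k.+1)%N -> A (if t is t'.+1 then w t' else i).
  move=> ww w0 wk t tk; rewrite -w0 in il.
  exact: (in_A (fun t => if t is t'.+1 then w t' else i) (walk_cons il ww)).
have <- := IH l j (fun w ww w0 wk t tk => tail w ww w0 wk t.+1 tk).
case: (eqVneq ((X ^+ k) l j) 0) => [->|/exp_walk[w [w0 wk ww]]]; first by rewrite !mulr0.
have /= Ai := tail w ww w0 wk 0%N isT; have /= := tail w ww w0 wk 1%N isT.
by rewrite restr_mxE Ai w0 => ->.
Qed.

(* [Om] contains the base points of the closed walks that stay in [A], and no others that are
   closed. *)
Lemma mxtrace_exp_restr_walks X (A Om : pred 'I_n) k :
  (forall w, walk X k.+1 w -> w k.+1 = w 0%N -> Om (w 0%N) -> forall t, (t <= k.+1)%N -> A (w t)) ->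
  (forall w, walk X k.+1 w -> w k.+1 = w 0%N -> (forall t, (t <= k.+1)%N -> A (w t)) -> Om (w 0%N)) ->
  \sum_(i | Om i) (X ^+ k.+1) i i = \tr (restr_mx A X ^+ k.+1).
Proof.
move=> Om_A A_Om; rewrite /mxtrace [RHS](bigID Om) /= [X in _ = _ + X]big1 ?addr0 => [|i].
  apply: eq_bigr => i Oi; apply: exp_restr => w ww w0 wk.
  by apply: Om_A; rewrite ?wk ?w0.
apply: contraNeq => /exp_walk[w [w0 wk ww]].
have in_A t : (t < k.+1)%N -> [/\ A (w t), A (w t.+1) & X (w t) (w t.+1) != 0].
  by move=> /ww; rewrite restr_mxE; case: ifP => [/andP[] //|]; rewrite eqxx.
rewrite -w0; apply: A_Om; rewrite ?wk ?w0 //; first by move=> t /in_A[].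
move=> t; rewrite leq_eqVlt => /orP[/eqP ->|/in_A[] //].
by have [] := in_A k (ltnSn k).
Qed.

End Restriction.

Lemma mxtrace_exp_rank_one (K : idomainType) n (X : 'M[K]_n) (t : 'cV[K]_n) (u : 'rV[K]_n) N q k :
  u *m (X + t *m u) = 0 -> u 0 q != 0 -> (forall i, (X ^+ N) i q = 0) ->
  \tr ((X + t *m u) ^+ k.+1) = \tr (X ^+ k.+1).
Proof.
set Y := X + t *m u => uY uq colN; set d := (u *m t) 0 0.
have ut_scalar : u *m t = d%:M by rewrite [LHS]mx11_scalar.
have uX : u *m X = (- d) *: u.
  move/eqP: uY; rewrite mulmxDr mulmxA ut_scalar mul_scalar_mx addr_eq0 => /eqP ->.
  by rewrite scaleNr.
have uXj j : u *m X ^+ j = (- d) ^+ j *: u.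
  elim: j => [|j IH]; first by rewrite !expr0 mulmx1 scale1r.
  by rewrite exprS -mulmxE mulmxA uX -scalemxAl IH scalerA -exprS.
have d0 : d = 0.
  have := congr1 (fun M : 'rV_n => M 0 q) (uXj N); rewrite [RHS]mxE [LHS]mxE big1 => [/esym/eqP|i _].
    by rewrite mulf_eq0 (negPf uq) orbF expf_eq0 oppr_eq0 => /andP[_ /eqP].
  by rewrite colN mulr0.
have uX0 : u *m X = 0 by rewrite uX d0 oppr0 scale0r.
have ut0 : u *m t = 0 by rewrite ut_scalar d0 raddf0.
have Yj j : Y ^+ j.+1 = X ^+ j.+1 + X ^+ j *m t *m u.
  elim: j => [|j IH]; first by rewrite !expr1 expr0 mul1mx.
  rewrite exprSr -mulmxE IH mulmxDr !mulmxDl -!(mulmxA _ u) uX0 (mulmxA u) ut0 mul0mx !mulmx0 !addr0.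
  by rewrite mulmxA [in RHS]exprSr -mulmxE.
rewrite Yj raddfD /= mxtrace_mulC mulmxA uXj d0 oppr0.
by case: k => [|k]; rewrite ?expr0 ?scale1r ?ut0 ?exprS ?mul0r ?scale0r ?mul0mx raddf0 addr0.
Qed.

Definition Lefschetz_restr (K : comNzRingType) v e s (A0 : pred 'I_v) (A1 : pred 'I_e) (A2 : pred 'I_s)
    (F0 : 'M[K]_v) (F1 : 'M[K]_e) (F2 : 'M[K]_s) (k : nat) : K :=
  \tr (restr_mx A0 F0 ^+ k) - \tr (restr_mx A1 F1 ^+ k) + \tr (restr_mx A2 F2 ^+ k).

(** * Lefschetz numbers of chain maps *)

Section AcyclicComplex.
Variables (K : comNzRingType) (v e s : nat).
Variables (d1 : 'M[K]_(e, v)) (d2 : 'M[K]_(s, e)) (h0 : 'M[K]_(v, e)) (h1 : 'M[K]_(e, s)).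
Variable v0 : 'I_v.
Hypothesis boundary2 : d2 *m d1 = 0.
Hypothesis contraction0 : h0 *m d1 = 1%:M - \matrix_(i, j) (j == v0)%:R.
Hypothesis contraction1 : h1 *m d2 + d1 *m h0 = 1%:M.
Hypothesis contraction2 : d2 *m h1 = 1%:M.

Definition chain_map (F0 : 'M[K]_v) (F1 : 'M[K]_e) : Prop := F1 *m d1 = d1 *m F0.

(* The only extension of a chain map to the faces, as [d2] is injective. *)
Definition face_map (F1 : 'M[K]_e) : 'M[K]_s := d2 *m F1 *m h1.

Lemma face_map_boundary F0 F1 : chain_map F0 F1 -> face_map F1 *m d2 = d2 *m F1.
Proof.
have -> : face_map F1 *m d2 = d2 *m F1 *m (1%:M - d1 *m h0).
  by rewrite /face_map -mulmxA -contraction1 addrK.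
move=> chain; rewrite mulmxBr mulmx1 !mulmxA -(mulmxA d2 F1) chain !mulmxA boundary2 !mul0mx.
by rewrite subr0.
Qed.

Lemma chain_map_exp F0 F1 k : chain_map F0 F1 -> chain_map (F0 ^+ k) (F1 ^+ k).
Proof.
move=> chain; elim: k => [|k IH]; first by rewrite /chain_map !expr0 mul1mx mulmx1.
by rewrite /chain_map !exprS -!mulmxE -mulmxA IH !mulmxA chain.
Qed.

Lemma face_map_exp F0 F1 k : chain_map F0 F1 -> face_map F1 ^+ k = face_map (F1 ^+ k).
Proof.
move=> chain; elim: k => [|k IH]; first by rewrite !expr0 /face_map mulmx1.
by rewrite !exprS -!mulmxE IH /face_map !mulmxA (face_map_boundary chain).
Qed.

Lemma cycle_filling (z : 'rV[K]_e) : z *m d1 = 0 -> z *m h1 *m d2 = z.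
Proof.
by move=> cyc; rewrite -mulmxA -[in RHS](mulmx1 z) -contraction1 mulmxDr (mulmxA z d1) cyc mul0mx addr0.
Qed.

Lemma Lefschetz_acyclic F0 F1 : chain_map F0 F1 -> (forall i, \sum_j F0 i j = 1) ->
  \tr F0 - \tr F1 + \tr (face_map F1) = 1.
Proof.
move=> chain row_sum.
have trF1 : \tr F1 = \tr (F0 *m h0 *m d1) + \tr (face_map F1).
  rewrite -[in LHS](mulmx1 F1) -contraction1 mulmxDr raddfD /= addrC; congr (_ + _).
    by rewrite mulmxA chain -mulmxA mxtrace_mulC.
  by rewrite mulmxA mxtrace_mulC /face_map mulmxA.
have trF0 : \tr F0 = 1 + \tr (F0 *m h0 *m d1).
  rewrite -mulmxA contraction0 mulmxBr mulmx1 raddfB /=; set c := \matrix_(_, _) _.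
  suff -> : \tr (F0 *m c) = 1 by rewrite addrC subrK.
  rewrite /mxtrace (bigD1 v0) //= big1 ?addr0.
    by rewrite mxE -[RHS](row_sum v0); apply: eq_bigr => j _; rewrite mxE eqxx mulr1.
  by move=> i /negPf iv; rewrite mxE big1 // => j _; rewrite mxE iv mulr0.
by rewrite trF0 trF1 addrKA subrK.
Qed.

Lemma row_sum_exp (F0 : 'M[K]_v) k :
  (forall i, \sum_j F0 i j = 1) -> forall i, \sum_j (F0 ^+ k) i j = 1.
Proof.
move=> row_sum; elim: k => [|k IH] i.
  rewrite expr0 (bigD1 i) //= big1 ?addr0 ?mxE ?eqxx // => j /negPf ji.
  by rewrite mxE eq_sym ji.
rewrite exprS -mulmxE; under eq_bigr do rewrite mxE.
rewrite exchange_big /= -[RHS](row_sum i); apply: eq_bigr => j _.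
by rewrite -mulr_sumr IH mulr1.
Qed.

End AcyclicComplex.

(* A chain map [F] is replaced by the vertex map [psi] on the subcomplex L; [fill i] is a chain of
   L from [a i] to [psi i], which repairs the boundary of [F1] next to L. *)
Section ExitTrace.
Variables (K : idomainType) (v e s : nat).
Variables (d1 : 'M[K]_(e, v)) (d2 : 'M[K]_(s, e)) (h0 : 'M[K]_(v, e)) (h1 : 'M[K]_(e, s)).
Variable v0 : 'I_v.
Hypothesis boundary2 : d2 *m d1 = 0.
Hypothesis contraction0 : h0 *m d1 = 1%:M - \matrix_(i, j) (j == v0)%:R.
Hypothesis contraction1 : h1 *m d2 + d1 *m h0 = 1%:M.
Hypothesis contraction2 : d2 *m h1 = 1%:M.
Variables (LV : pred 'I_v) (LE : pred 'I_e) (LS : pred 'I_s).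
Variables (a psi : 'I_v -> 'I_v) (F1 : 'M[K]_e) (fill : 'M[K]_(v, e)).
Let exit_fun i := if LV i then psi i else a i.
Let F0 : 'M[K]_v := graph_mx K a.
Let F2 := face_map d2 h1 F1.
Hypothesis F_chain : chain_map d1 F0 F1.
Hypothesis psi_LV : forall i, LV i -> LV (psi i).
Hypothesis exit_fun_edge : forall i, LE i -> forall j, (d1 *m graph_mx K exit_fun) i j = 0.
Hypothesis LS_LE : forall i j, LS i -> d2 i j != 0 -> LE j.
Hypothesis fill_LE : forall i j, fill i j != 0 -> LE j.
Hypothesis fill_boundary : forall i j k, ~~ LE i -> d1 i j != 0 ->
  (F0 + fill *m d1) j k = graph_mx K exit_fun j k.
Hypothesis frontier_LE : forall i j k, ~~ LS i -> d2 i j != 0 -> LE j -> F1 j k != 0 -> LE k.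

Let G0 : 'M[K]_v := graph_mx K exit_fun.
Let G1 := coord_proj K (predC LE) *m (F1 + d1 *m fill).
Let G2 := face_map d2 h1 G1.

Let G_chain : chain_map d1 G0 G1.
Proof.
rewrite /chain_map /G1 -mulmxA mulmxDl F_chain -mulmxA -mulmxDr.
apply/matrixP=> i j; rewrite mul_coord_proj /=; case Li : (LE i).
  by rewrite mul0r exit_fun_edge.
rewrite mul1r !mxE; apply: eq_bigr => k _.
case: (eqVneq (d1 i k) 0) => [->|nz]; first by rewrite !mul0r.
by rewrite (fill_boundary _ _ nz) ?Li.
Qed.

Let G1_LE i j : LE i -> G1 i j = 0.
Proof. by move=> Li; rewrite /G1 mul_coord_proj /= Li mul0r. Qed.

Let G2_LS i j : LS i -> G2 i j = 0.
Proof.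
move=> Li; rewrite /G2 /face_map mxE big1 // => k _; rewrite mxE big1 ?mul0r // => l _.
case: (eqVneq (d2 i l) 0) => [->|nz]; first by rewrite mul0r.
by rewrite G1_LE ?mulr0 //; apply: LS_LE nz.
Qed.

Let restr_G0 : restr_mx (predC LV) G0 = restr_mx (predC LV) F0.
Proof.
apply/matrixP=> i j; rewrite !restr_mxE !mxE /exit_fun /=.
by case: (LV i).
Qed.

Let restr_G1 : restr_mx (predC LE) G1 = restr_mx (predC LE) F1.
Proof.
apply/matrixP=> i j; rewrite !restr_mxE /G1 mul_coord_proj /=; case: ifP => // /andP[Li Lj].
rewrite Li mul1r mxE [X in _ + X]mxE big1 ?addr0 // => k _.
case: (eqVneq (fill k j) 0) => [->|/fill_LE]; first by rewrite mulr0.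
by rewrite (negPf Lj).
Qed.

(* The boundaries of the two images of a face differ by a cycle in L. *)
Let defect i : 'rV[K]_e := row i (d2 *m G1 - d2 *m F1).

Let defect_cycle i : defect i *m d1 = 0.
Proof.
rewrite /defect -row_mul mulmxBl -(mulmxA d2 G1) -(mulmxA d2 F1) G_chain F_chain.
by rewrite 2!(mulmxA d2 d1) boundary2 !mul0mx subr0; apply/rowP=> j; rewrite !mxE.
Qed.

Let defect_LE i j : ~~ LS i -> defect i 0 j != 0 -> LE j.
Proof.
move=> Li; apply: contraR => Lj; apply/eqP; rewrite /defect !mxE -sumrB big1 // => k _.
rewrite -mulrBr; case: (eqVneq (d2 i k) 0) => [->|nz]; first by rewrite mul0r.
rewrite /G1 mul_coord_proj /= mxE [X in _ * (_ + X) - _]mxE [X in _ * (_ + X) - _]big1 ?addr0 => [|l _].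
  case Lk : (LE k) => /=; last by rewrite mul1r subrr mulr0.
  case: (eqVneq (F1 k j) 0) => [->|nz']; first by rewrite mul0r subr0 mulr0.
  by rewrite (frontier_LE Li nz Lk nz') in Lj.
case: (eqVneq (fill l j) 0) => [->|/fill_LE]; first by rewrite mulr0.
by rewrite (negPf Lj).
Qed.

Let defect_filling i j : (defect i *m h1) 0 j = G2 i j - F2 i j.
Proof. by rewrite /defect -row_mul mulmxBl mxE [LHS]mxE [X in _ + X]mxE. Qed.

Let exit_trace_replaced k :
  Lefschetz_restr (predC LV) (predC LE) (predC LS) F0 F1 G2 k.+1
  = 1 - #|[pred i | LV i && (iter k.+1 psi i == i)]|%:R.
Proof.
have := Lefschetz_acyclic contraction0 contraction1 (chain_map_exp k.+1 G_chain)
  (row_sum_exp k.+1 (graph_mx_row_sum K exit_fun)).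
rewrite -(face_map_exp boundary2 contraction1 contraction2 _ G_chain) -/G0 -/G2.
rewrite (@mxtrace_exp_block _ _ (predC LV) G0) => [|i j /negPn Li Lj]; last first.
  by rewrite mxE /exit_fun Li; case: eqP => // ji; rewrite ji /= psi_LV in Lj.
rewrite (@mxtrace_exp_restr_rows _ _ (predC LE) G1) => [|i j /negPn]; last exact: G1_LE.
rewrite (@mxtrace_exp_restr_rows _ _ (predC LS) G2) => [|i j /negPn]; last exact: G2_LS.
have -> : restr_mx (predC (predC LV)) G0 = restr_mx LV (graph_mx K psi).
  by apply/matrixP=> i j; rewrite !restr_mxE !mxE /exit_fun /= !negbK; case: (LV i).
rewrite (mxtrace_graph_exp_restr K k psi_LV) restr_G0 restr_G1 /Lefschetz_restr.
set c := _%:R => trace; apply/eqP; rewrite eq_sym subr_eq -trace.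
by rewrite (addrAC _ c) (addrAC _ c).
Qed.

Lemma exit_trace_of_zero_fillings k :
  (forall z : 'rV[K]_e, z *m d1 = 0 -> (forall j, z 0 j != 0 -> LE j) ->
     forall i, ~~ LS i -> (z *m h1) 0 i = 0) ->
  Lefschetz_restr (predC LV) (predC LE) (predC LS) F0 F1 F2 k.+1
  = 1 - #|[pred i | LV i && (iter k.+1 psi i == i)]|%:R.
Proof.
move=> fill0; rewrite -exit_trace_replaced /Lefschetz_restr.
suff -> : restr_mx (predC LS) F2 = restr_mx (predC LS) G2 by [].
apply/matrixP=> i j; rewrite !restr_mxE /=; case: ifP => // /andP[Li Lj].
apply/esym/eqP; rewrite -subr_eq0 -defect_filling.
by apply/eqP/fill0 => // l; apply: defect_LE.
Qed.

Lemma exit_trace_of_constant_fillings k N q :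
  (forall z : 'rV[K]_e, z *m d1 = 0 -> (forall j, z 0 j != 0 -> LE j) ->
     exists t, forall i, ~~ LS i -> (z *m h1) 0 i = t) ->
  (forall j, ~~ LE j -> \sum_(i | ~~ LS i) d2 i j = 0) -> ~~ LS q ->
  (forall i, (restr_mx (predC LS) F2 ^+ N) i q = 0) ->
  Lefschetz_restr (predC LV) (predC LE) (predC LS) F0 F1 F2 k.+1
  = 1 - #|[pred i | LV i && (iter k.+1 psi i == i)]|%:R.
Proof.
move=> fill_const total_boundary Lq colN; rewrite -exit_trace_replaced.
have filling i : exists t, ~~ LS i -> forall j, ~~ LS j -> (defect i *m h1) 0 j = t.
  case Li : (LS i); first by exists 0.
  have [t t_value] := fill_const _ (defect_cycle i) (fun j => @defect_LE i j (negbT Li)).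
  by exists t.
have [t t_value] := fin_all_exists filling.
pose u : 'rV[K]_s := \row_j (~~ LS j)%:R; pose t' : 'cV[K]_s := \col_i ((~~ LS i)%:R * t i).
have G2_rank_one : restr_mx (predC LS) G2 = restr_mx (predC LS) F2 + t' *m u.
  apply/matrixP=> i j; rewrite [RHS]mxE !restr_mxE [X in _ + X]mxE big_ord1 [t' _ _]mxE [u _ _]mxE /=.
  case: ifP => [/andP[Li Lj]|/nandP]; last first.
    by rewrite !negbK => -[->|->]; rewrite ?mulr0 ?mul0r add0r ?mul0r.
  by rewrite Li Lj mulr1 mul1r -(t_value i Li j Lj) defect_filling addrC subrK.
have u_proj : u *m coord_proj K (predC LS) = u.
  by apply/matrixP=> i j; rewrite mul_mx_coord_proj !mxE /=; case: (LS j); rewrite ?mulr1 ?mulr0.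
have uG2 : u *m restr_mx (predC LS) G2 = 0.
  suff uG : u *m d2 *m G1 = 0.
    by rewrite /restr_mx 2!(mulmxA u) u_proj /G2 /face_map (mulmxA u) (mulmxA u d2 G1) uG !mul0mx.
  apply/matrixP=> i j; rewrite mxE [RHS]mxE big1 // => l _.
  case Ll : (LE l); first by rewrite G1_LE ?mulr0.
  suff -> : (u *m d2) i l = 0 by rewrite mul0r.
  rewrite mxE -[RHS](total_boundary l (negbT Ll)) [in RHS]big_mkcond; apply: eq_bigr => m _.
  by rewrite mxE; case: (LS m); rewrite ?mul0r ?mul1r.
rewrite /Lefschetz_restr G2_rank_one (mxtrace_exp_rank_one (N := N) (q := q)) //.
- by rewrite -G2_rank_one.
- by rewrite mxE Lq oner_eq0.
Qed.

End ExitTrace.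

(** * Traces of prime powers *)

Lemma poly_exp_prime q (P : {poly 'F_q}) : prime q -> P ^+ q = P \Po 'X^q.
Proof.
move=> q_prime; have chq : q \in [pchar {poly 'F_q}] by rewrite (pchar_poly _) pchar_Fp.
have powE := pFrobenius_autE chq.
have -> : P = \poly_(i < size P) P`_i by rewrite coefK.
rewrite poly_def rmorph_sum -powE rmorph_sum /=; apply: eq_bigr => i _.
rewrite powE exprZn linearZ /= comp_Xn_poly -exprM mulnC exprM; congr (_ *: _).
by rewrite -[X in _ ^+ X](card_Fp q_prime) expf_card.
Qed.

Lemma det_exp (K : comNzRingType) n (M : 'M[K]_n) k : \det (M ^+ k) = \det M ^+ k.
Proof.
by elim: k => [|k IH]; rewrite ?expr0 ?det1 // !exprS -mulmxE det_mulmx IH.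
Qed.

Lemma char_poly_exp_prime q n (A : 'M['F_q]_n.+1) : prime q ->
  char_poly A ^+ q = char_poly (A ^+ q) \Po 'X^q.
Proof.
move=> q_prime; have chq : q \in [pchar {poly 'F_q}] by rewrite (pchar_poly _) pchar_Fp.
have chM : q \in [pchar 'M[{poly 'F_q}]_n.+1].
  rewrite inE q_prime /=; apply/eqP/matrixP=> i j.
  have -> : (q%:R : 'M[{poly 'F_q}]_n.+1) = (q%:R)%:M by rewrite rmorph_nat.
  by rewrite !mxE (pcharf0 chq) mul0rn.
have mx_pow : char_poly_mx A ^+ q = ('X^q)%:M - map_mx polyC (A ^+ q).
  have comm : GRing.comm ('X%:M : 'M_n.+1) (map_mx polyC A).
    by rewrite /GRing.comm -!mulmxE scalar_mxC.
  by have := pFrobenius_autB_comm chM comm; rewrite !pFrobenius_autE => ->; rewrite !rmorphXn.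
rewrite /char_poly -det_exp mx_pow -(det_map_mx (comp_poly 'X^q)); congr (\det _).
by apply/matrixP=> i j; rewrite !mxE /= rmorphB /= rmorphMn /= comp_polyX comp_polyC.
Qed.

Lemma comp_polyXn_inj (K : comNzRingType) q (P Q : {poly K}) : (0 < q)%N ->
  P \Po 'X^q = Q \Po 'X^q -> P = Q.
Proof.
move=> q0 PQ; apply/polyP=> i; have := congr1 (fun P : {poly K} => P`_(i * q)) PQ.
by rewrite !(coef_comp_poly_Xn _ _ q0) dvdn_mull // mulnK.
Qed.

(* In characteristic q, (X - A)^q = X^q - A^q, so A and A^q have the same characteristic
   polynomial. *)
Lemma mxtrace_exp_prime q n (A : 'M['F_q]_n) : prime q -> \tr (A ^+ q) = \tr A.
Proof.
case: n A => [|n] A q_prime; first by rewrite /mxtrace !big_ord0.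
have same_char : char_poly (A ^+ q) = char_poly A.
  apply: (comp_polyXn_inj (prime_gt0 q_prime)).
  exact: etrans (esym (char_poly_exp_prime A q_prime)) (poly_exp_prime (char_poly A) q_prime).
have traceE (M : 'M['F_q]_n.+1) : (char_poly M)`_n = - \tr M.
  exact: (char_poly_trace M (ltn0Sn n)).
by apply: oppr_inj; rewrite -!traceE same_char.
Qed.

Lemma Z_of_nat_dvd_Fp q (z : Z) : prime q -> (int_of_Z z)%:~R = 0 :> 'F_q ->
  exists c, z = c * Z.of_nat q.
Proof.
move=> q_prime z0; have /dvdzP[c zc] : int_of_Z z \in dvdz q.
  case: (intP (int_of_Z z)) z0 => [|m|m]; first by rewrite dvdz0.
    by rewrite dvdzE /= => /eqP; rewrite -pmulrn -(dvdn_pcharf (pchar_Fp q_prime)).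
  rewrite rmorphN /= => /eqP; rewrite oppr_eq0 dvdzE abszN /=.
  by rewrite -pmulrn -(dvdn_pcharf (pchar_Fp q_prime)).
by exists (Z_of_int c); have /(congr1 Z_of_int) := zc; rewrite int_of_ZK rmorphM.
Qed.

Lemma mxtrace_exp_prime_mod q n (A : 'M[Z]_n) : prime q ->
  exists c : Z, \tr (A ^+ q) = \tr A + c * Z.of_nat q.
Proof.
move=> q_prime; pose mod_q : {rmorphism Z -> 'F_q} := intr \o int_of_Z.
have [c cE] : exists c, \tr (A ^+ q) - \tr A = c * Z.of_nat q.
  apply: Z_of_nat_dvd_Fp => //; rewrite -[LHS]/(mod_q _) rmorphB.
  have traceE (M : 'M[Z]_n) : mod_q (\tr M) = \tr (map_mx mod_q M).
    by rewrite /mxtrace rmorph_sum; apply: eq_bigr => i _; rewrite mxE.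
  have expE k : map_mx mod_q (A ^+ k) = map_mx mod_q A ^+ k.
    elim: k => [|k IH]; first by rewrite !expr0 map_mx1.
    by rewrite !exprS -!mulmxE map_mxM IH.
  by rewrite !traceE expE mxtrace_exp_prime // subrr.
by exists c; rewrite -cE addrC subrK.
Qed.

Lemma Lefschetz_restr_prime_mod q v e s (A0 : pred 'I_v) (A1 : pred 'I_e) (A2 : pred 'I_s)
    (F0 : 'M[Z]_v) (F1 : 'M[Z]_e) (F2 : 'M[Z]_s) : prime q ->
  exists c, Lefschetz_restr A0 A1 A2 F0 F1 F2 q = Lefschetz_restr A0 A1 A2 F0 F1 F2 1 + c * Z.of_nat q.
Proof.
move=> q_prime; rewrite /Lefschetz_restr !expr1.
have [c0 ->] := mxtrace_exp_prime_mod (restr_mx A0 F0) q_prime.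
have [c1 ->] := mxtrace_exp_prime_mod (restr_mx A1 F1) q_prime.
have [c2 ->] := mxtrace_exp_prime_mod (restr_mx A2 F2) q_prime.
exists (c0 - c1 + c2); move: (\tr _) (\tr _) (\tr _) => t0 t1 t2; lia.
Qed.

(** * The chain complex of a square grid *)

Notation b2z := Z.b2z.

Lemma sum_delta m k (f : nat -> Z) :
  \sum_(i < m) b2z (i == k :> nat) * f i = if (k < m)%N then f k else 0.
Proof.
case: ifP => km.
  rewrite (bigD1 (Ordinal km)) //= eqxx big1 ?addr0 => [|i]; first exact: mul1r.
  by rewrite -val_eqE /= => /negPf ->; exact: mul0r.
rewrite big1 // => i _; case: eqP => [ik|_]; last exact: mul0r.
by rewrite -ik ltn_ord in km.
Qed.

Lemma sum_delta_succ m k (f : nat -> Z) :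
  \sum_(i < m) b2z (i.+1 == k :> nat) * f i = if (0 < k <= m)%N then f k.-1 else 0.
Proof. by case: k => [|k] /=; [rewrite big1 // => i _; exact: mul0r | apply: sum_delta]. Qed.

Lemma sum_andb m m' (P Q : pred nat) (f : nat * nat -> Z) :
  \sum_(i < m) \sum_(j < m') b2z (P i && Q j) * f (val i, val j) =
  \sum_(i < m) b2z (P i) * \sum_(j < m') b2z (Q j) * f (val i, val j).
Proof.
apply: eq_bigr => i _; rewrite mulr_sumr; apply: eq_bigr => j _.
by rewrite mulrA; congr (_ * _); case: (P i); case: (Q j).
Qed.

Lemma sum_at m m' p (f : nat * nat -> Z) :
  \sum_(i < m) \sum_(j < m') b2z ((val i, val j) == p) * f (val i, val j) =
  if (p.1 < m)%N && (p.2 < m')%N then f p else 0.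
Proof.
case: p => k l; rewrite (sum_andb m m' (eq_op^~ k) (eq_op^~ l)).
under eq_bigr do rewrite (sum_delta m' l (fun j => f (_, j))).
by rewrite (sum_delta m k (fun i => if (l < m')%N then f (i, l) else 0)) /=; case: ifP.
Qed.

Lemma sum_at_succl m m' p (f : nat * nat -> Z) :
  \sum_(i < m) \sum_(j < m') b2z (((val i).+1, val j) == p) * f (val i, val j) =
  if (0 < p.1 <= m)%N && (p.2 < m')%N then f (p.1.-1, p.2) else 0.
Proof.
case: p => k l; rewrite (sum_andb m m' (fun i => i.+1 == k) (eq_op^~ l)).
under eq_bigr do rewrite (sum_delta m' l (fun j => f (_, j))).
by rewrite (sum_delta_succ m k (fun i => if (l < m')%N then f (i, l) else 0)) /=; case: ifP.
Qed.

Lemma sum_at_succr m m' p (f : nat * nat -> Z) :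
  \sum_(i < m) \sum_(j < m') b2z ((val i, (val j).+1) == p) * f (val i, val j) =
  if (p.1 < m)%N && (0 < p.2 <= m')%N then f (p.1, p.2.-1) else 0.
Proof.
case: p => k l; rewrite (sum_andb m m' (eq_op^~ k) (fun j => j.+1 == l)).
under eq_bigr do rewrite (sum_delta_succ m' l (fun j => f (_, j))).
by rewrite (sum_delta m k (fun i => if (0 < l <= m')%N then f (i, l.-1) else 0)) /=; case: ifP.
Qed.

Lemma sum_nat_window N lo hi (f : nat -> Z) : (hi <= N)%N ->
  \sum_(lo <= i < hi) f i = \sum_(i < N) if (lo <= i < hi)%N then f i else 0.
Proof.
move=> hN; rewrite -(big_mkord xpredT (fun i => if (lo <= i < hi)%N then f i else 0)) -big_mkcond.
by rewrite (big_nat_widenl lo 0%N) // (big_nat_widen 0%N hi N).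
Qed.

Lemma sum_nat_telescope lo hi (f g : nat -> Z) : (lo <= hi)%N ->
  \sum_(lo <= i < hi.+1) (f i - g i) + \sum_(lo <= i < hi) (g i.+1 - f i) = f hi - g lo.
Proof.
elim: hi => [|hi IH]; first by rewrite leqn0 => /eqP ->; rewrite big_nat1 big_geq // addr0.
rewrite leq_eqVlt => /orP[/eqP ->|lo_hi]; first by rewrite big_nat1 big_geq // addr0.
rewrite (big_nat_recr hi.+1 lo) /=; last exact: ltnW.
rewrite (big_nat_recr hi lo (fun i => g i.+1 - f i)) //= addrACA IH //; lia.
Qed.

Section Grid.
Variable m : nat.
Let n := m.+1.

Definition vertex := ('I_n.+1 * 'I_n.+1)%type.
Definition edge := ('I_n * 'I_n.+1 + 'I_n.+1 * 'I_n)%type.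
Definition face := ('I_n * 'I_n)%type.

(* A face is located by its lower left corner, an edge by its direction ([true]: horizontal) and
   its lower left end. *)
Definition vpos (v : vertex) : nat * nat := (val v.1, val v.2).
Definition fpos (s : face) : nat * nat := (val s.1, val s.2).
Definition epos (e : edge) : bool * (nat * nat) :=
  match e with inl x => (true, (val x.1, val x.2)) | inr x => (false, (val x.1, val x.2)) end.

Definition vertex_at (p : nat * nat) : vertex := (inord p.1, inord p.2).
Definition hedge i j : edge := inl (inord i, inord j).
Definition vedge i j : edge := inr (inord i, inord j).
Definition face_at (p : nat * nat) : face := (inord p.1, inord p.2).

Definition in_grid (p : nat * nat) : bool := (p.1 <= n)%N && (p.2 <= n)%N.

Lemma vpos_at p : in_grid p -> vpos (vertex_at p) = p.
Proof. by case: p => i j /andP[/= hi hj]; rewrite /vpos /= !inordK. Qed.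

Lemma vertex_at_vpos v : vertex_at (vpos v) = v.
Proof. by case: v => i j; rewrite /vertex_at /= !inord_val. Qed.

Lemma vpos_inj : injective vpos. Proof. exact: can_inj vertex_at_vpos. Qed.

Lemma in_grid_vpos v : in_grid (vpos v).
Proof. by case: v => -[i hi] [j hj]; rewrite /in_grid /=; lia. Qed.

Lemma epos_inj : injective epos.
Proof. by move=> [[i j]|[i j]] [[k l]|[k l]] //= [] /val_inj -> /val_inj ->. Qed.

Lemma fpos_inj : injective fpos.
Proof. by move=> [i j] [k l] [] /val_inj /= -> /val_inj ->. Qed.

Lemma fpos_lt s : ((fpos s).1 < n)%N /\ ((fpos s).2 < n)%N.
Proof. by case: s => i j /=. Qed.

Lemma in_grid_fpos s : in_grid (fpos s).
Proof. by have [s1 s2] := fpos_lt s; rewrite /in_grid (ltnW s1) (ltnW s2). Qed.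

Lemma fpos_at q : (q.1 < n)%N -> (q.2 < n)%N -> fpos (face_at q) = q.
Proof. by case: q => i j /= hi hj; rewrite /fpos /= !inordK. Qed.

Lemma face_at_fpos s : face_at (fpos s) = s.
Proof. by case: s => i j; rewrite /face_at /= !inord_val. Qed.

Lemma epos_hedge i j : (i < n)%N -> (j <= n)%N -> epos (hedge i j) = (true, (i, j)).
Proof. by move=> hi hj; rewrite /= !inordK. Qed.

Lemma epos_vedge i j : (i <= n)%N -> (j < n)%N -> epos (vedge i j) = (false, (i, j)).
Proof. by move=> hi hj; rewrite /= !inordK. Qed.

Definition src_at (r : bool * (nat * nat)) : nat * nat := r.2.
Definition tgt_at (r : bool * (nat * nat)) : nat * nat :=
  if r.1 then (r.2.1.+1, r.2.2) else (r.2.1, r.2.2.+1).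
Definition src e := src_at (epos e).
Definition tgt e := tgt_at (epos e).

Lemma in_grid_src e : in_grid (src e).
Proof. by case: e => -[[i hi] [j hj]]; rewrite /in_grid /src /=; lia. Qed.

Lemma in_grid_tgt e : in_grid (tgt e).
Proof. by case: e => -[[i hi] [j hj]]; rewrite /in_grid /tgt /=; lia. Qed.

Definition edge_bd (e : edge) (w : vertex) : Z := b2z (vpos w == tgt e) - b2z (vpos w == src e).

Definition face_bd_at (s : nat * nat) (r : bool * (nat * nat)) : Z :=
  if r.1 then b2z (r.2 == s) - b2z (r.2 == (s.1, s.2.+1))
  else b2z (r.2 == (s.1.+1, s.2)) - b2z (r.2 == s).
Definition face_bd (s : face) (e : edge) : Z := face_bd_at (fpos s) (epos e).

(* The contraction of the grid to its upper right corner: a vertex moves to the right and then up,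
   an edge sweeps the faces to its right. *)
Definition vertex_cone_at (v : nat * nat) (r : bool * (nat * nat)) : Z :=
  if r.1 then - b2z ((r.2.2 == v.2) && (v.1 <= r.2.1)%N)
  else - b2z ((r.2.1 == n) && (v.2 <= r.2.2)%N).
Definition vertex_cone (v : vertex) (e : edge) : Z := vertex_cone_at (vpos v) (epos e).
Definition edge_cone_at (r : bool * (nat * nat)) (s : nat * nat) : Z :=
  if r.1 then 0 else - b2z ((s.2 == r.2.2) && (r.2.1 <= s.1)%N).
Definition edge_cone (e : edge) (s : face) : Z := edge_cone_at (epos e) (fpos s).

Lemma sum_edge (f : edge -> Z) : \sum_e f e =
  \sum_(i < n) \sum_(j < n.+1) f (inl (i, j)) + \sum_(i < n.+1) \sum_(j < n) f (inr (i, j)).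
Proof. by rewrite big_sumType /= !pair_big /=; congr (_ + _); apply: eq_bigr => -[]. Qed.

Lemma sum_vertex (f : vertex -> Z) : \sum_v f v = \sum_(i < n.+1) \sum_(j < n.+1) f (i, j).
Proof. by rewrite pair_big /=; apply: eq_bigr => -[]. Qed.

Lemma sum_face (f : face -> Z) : \sum_s f s = \sum_(i < n) \sum_(j < n) f (i, j).
Proof. by rewrite pair_big /=; apply: eq_bigr => -[]. Qed.

Lemma sum_vertex_delta (g : nat * nat -> Z) p : in_grid p ->
  \sum_w b2z (vpos w == p) * g (vpos w) = g p.
Proof. by move=> /andP[p1 p2]; rewrite sum_vertex sum_at !ltnS p1 p2. Qed.

Lemma sum_edge_bd e (g : nat * nat -> Z) :
  \sum_w edge_bd e w * g (vpos w) = g (tgt e) - g (src e).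
Proof.
under eq_bigr do rewrite mulrBl.
by rewrite sumrB !sum_vertex_delta ?in_grid_tgt ?in_grid_src.
Qed.

(* The divergence at [w] of a chain, from the four edges around [w]. *)
Lemma sum_chain_edge_bd (z : bool * (nat * nat) -> Z) w : \sum_e z (epos e) * edge_bd e w =
  (if (0 < (vpos w).1)%N then z (true, ((vpos w).1.-1, (vpos w).2)) else 0)
  - (if ((vpos w).1 < n)%N then z (true, vpos w) else 0)
  + (if (0 < (vpos w).2)%N then z (false, ((vpos w).1, (vpos w).2.-1)) else 0)
  - (if ((vpos w).2 < n)%N then z (false, vpos w) else 0).
Proof.
have /andP[w1 w2] := in_grid_vpos w.
under eq_bigr do rewrite /edge_bd mulrC mulrBl ![vpos w == _]eq_sym.
rewrite sumrB !sum_edge /tgt /src /tgt_at /src_at /= opprD addrACA.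
rewrite (sum_at_succl n n.+1 _ (fun q => z (true, q))) (sum_at n n.+1 _ (fun q => z (true, q))).
rewrite (sum_at_succr n.+1 n _ (fun q => z (false, q))) (sum_at n.+1 n _ (fun q => z (false, q))).
by rewrite !ltnS w1 w2 !andbT addrA.
Qed.

Lemma sum_face_bd s (g : bool * (nat * nat) -> Z) : \sum_e face_bd s e * g (epos e) =
  g (true, fpos s) - g (true, ((fpos s).1, (fpos s).2.+1))
  + g (false, ((fpos s).1.+1, (fpos s).2)) - g (false, fpos s).
Proof.
have [/= s1 s2] := fpos_lt s.
rewrite sum_edge; under eq_bigr do under eq_bigr do rewrite /face_bd /face_bd_at /= mulrBl.
under [X in _ + X]eq_bigr do under eq_bigr do rewrite /face_bd /face_bd_at /= mulrBl.
under eq_bigr do rewrite sumrB; under [X in _ + X]eq_bigr do rewrite sumrB.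
rewrite !sumrB !(sum_at n n.+1 _ (fun q => g (true, q))) !(sum_at n.+1 n _ (fun q => g (false, q))).
by rewrite /= !(ltnS _ n) s1 s2 (ltnW s1) (ltnW s2) addrA.
Qed.

Lemma sum_chain_face_bd (y : nat * nat -> Z) e : \sum_s y (fpos s) * face_bd s e =
  let r := epos e in
  if r.1 then (if (r.2.2 < n)%N then y r.2 else 0) - (if (0 < r.2.2)%N then y (r.2.1, r.2.2.-1) else 0)
  else (if (0 < r.2.1)%N then y (r.2.1.-1, r.2.2) else 0) - (if (r.2.1 < n)%N then y r.2 else 0).
Proof.
rewrite sum_face; case: e => -[[k hk] [l hl]] /=.
  under eq_bigr do under eq_bigr do rewrite /face_bd /face_bd_at /= mulrC mulrBl ![(k, l) == _]eq_sym.
  under eq_bigr do rewrite sumrB.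
  by rewrite sumrB sum_at (sum_at_succr n n) /= hk -[(l <= n)%N]ltnS hl andbT.
under eq_bigr do under eq_bigr do rewrite /face_bd /face_bd_at /= mulrC mulrBl ![(k, l) == _]eq_sym.
under eq_bigr do rewrite sumrB.
by rewrite sumrB sum_at (sum_at_succl n n) /= hl -[(k <= n)%N]ltnS hk !andbT.
Qed.

Lemma edge_bd_face_bd s w : \sum_e face_bd s e * edge_bd e w = 0.
Proof.
rewrite (sum_face_bd s (fun r => b2z (vpos w == tgt_at r) - b2z (vpos w == src_at r))).
rewrite /tgt_at /src_at /=; lia.
Qed.

Lemma edge_bd_vertex_cone v w :
  \sum_e vertex_cone v e * edge_bd e w = b2z (v == w) - b2z (vpos w == (n, n)).
Proof.
rewrite (sum_chain_edge_bd (vertex_cone_at (vpos v))) -(inj_eq vpos_inj) /vertex_cone_at.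
have := in_grid_vpos v; have := in_grid_vpos w.
case: (vpos v) (vpos w) => i j [k l] /= /andP[/= ? ?] /andP[/= ? ?].
rewrite !xpair_eqE; repeat (case: ifP => ?); lia.
Qed.

Lemma edge_cone_face_bd s s' : \sum_e face_bd s e * edge_cone e s' = b2z (s == s').
Proof.
rewrite (sum_face_bd s (fun r => edge_cone_at r (fpos s'))) /edge_cone_at -(inj_eq fpos_inj).
case: (fpos s) (fpos s') => i j [k l] /=; rewrite !xpair_eqE; lia.
Qed.

Lemma cone_homotopy e e' : \sum_s edge_cone e s * face_bd s e'
  + \sum_w edge_bd e w * vertex_cone w e' = b2z (e == e').
Proof.
rewrite (sum_chain_face_bd (edge_cone_at (epos e))) (sum_edge_bd e (fun v => vertex_cone_at v (epos e'))).
rewrite -(inj_eq epos_inj).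
have := in_grid_tgt e; have := in_grid_src e; have := in_grid_tgt e'; have := in_grid_src e'.
rewrite /src /tgt; case: (epos e) => [[] [i j]]; case: (epos e') => [[] [k l]];
  rewrite /in_grid /edge_cone_at /vertex_cone_at /tgt_at /src_at /= ?xpair_eqE
    => /andP[? ?] /andP[? ?] /andP[? ?] /andP[? ?]; repeat (case: ifP => ?); lia.
Qed.
End Grid.

Section KernelMatrix.
Variables A B : finType.

Definition kernel_mx (X : A -> B -> Z) : 'M[Z]_(#|A|, #|B|) :=
  \matrix_(i, j) X (enum_val i) (enum_val j).

Lemma kernel_mxE X a b : kernel_mx X (enum_rank a) (enum_rank b) = X a b.
Proof. by rewrite mxE !enum_rankK. Qed.

Lemma sum_enum_rank (f : 'I_#|A| -> Z) : \sum_i f i = \sum_a f (enum_rank a).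
Proof. by rewrite (reindex _ (onW_bij _ (@enum_rank_bij A))). Qed.
End KernelMatrix.

Lemma mul_kernel_mx (A B C : finType) (X : A -> B -> Z) (Y : B -> C -> Z) :
  kernel_mx X *m kernel_mx Y = kernel_mx (fun a c => \sum_b X a b * Y b c).
Proof.
apply/matrixP=> i j; rewrite !mxE sum_enum_rank.
by apply: eq_bigr => k _; rewrite !mxE enum_rankK.
Qed.

Section GridComplex.
Variable m : nat.
Let n := m.+1.

Definition boundary1 := kernel_mx (@edge_bd m).
Definition boundary2 := kernel_mx (@face_bd m).
Definition contraction0 := kernel_mx (@vertex_cone m).
Definition contraction1 := kernel_mx (@edge_cone m).
Definition corner_vertex : 'I_#|{: vertex m}| := enum_rank (vertex_at m (n, n)).

Lemma boundary_boundary : boundary2 *m boundary1 = 0.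
Proof. by rewrite mul_kernel_mx; apply/matrixP=> i j; rewrite !mxE edge_bd_face_bd. Qed.

Lemma vertex_contraction :
  contraction0 *m boundary1 = 1%:M - \matrix_(i, j) (j == corner_vertex)%:R.
Proof.
rewrite mul_kernel_mx; apply/matrixP=> i j; rewrite !mxE edge_bd_vertex_cone (inj_eq enum_val_inj).
have -> : (vpos (enum_val j) == (m.+1, m.+1)) = (j == corner_vertex).
  rewrite -(inj_eq (@enum_val_inj _ _)) enum_rankK -(inj_eq (@vpos_inj m)) vpos_at //.
  by rewrite /in_grid /= leqnn.
by case: (i == j); case: (j == _).
Qed.

Lemma edge_contraction : contraction1 *m boundary2 + boundary1 *m contraction0 = 1%:M.
Proof.
rewrite !mul_kernel_mx; apply/matrixP=> i j; rewrite !mxE cone_homotopy (inj_eq enum_val_inj).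
by case: (i == j).
Qed.

Lemma face_contraction : boundary2 *m contraction1 = 1%:M.
Proof.
rewrite !mul_kernel_mx; apply/matrixP=> i j; rewrite !mxE edge_cone_face_bd (inj_eq enum_val_inj).
by case: (i == j).
Qed.
End GridComplex.

(* The coefficients of the path from [p] to [q] that is first horizontal and then vertical. *)
Definition path_chain (p q : nat * nat) (r : bool * (nat * nat)) : Z :=
  if r.1
  then b2z ((r.2.2 == p.2) && (p.1 <= r.2.1 < q.1)%N) - b2z ((r.2.2 == p.2) && (q.1 <= r.2.1 < p.1)%N)
  else b2z ((r.2.1 == q.1) && (p.2 <= r.2.2 < q.2)%N) - b2z ((r.2.1 == q.1) && (q.2 <= r.2.2 < p.2)%N).

Lemma segment_bd n i i' k : (i <= n)%N -> (i' <= n)%N -> (k <= n)%N ->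
  (if (0 < k)%N then b2z (i <= k.-1 < i')%N - b2z (i' <= k.-1 < i)%N else 0)
  - (if (k < n)%N then b2z (i <= k < i')%N - b2z (i' <= k < i)%N else 0) = b2z (k == i') - b2z (k == i).
Proof.
have segmentE x : b2z (i <= x < i')%N - b2z (i' <= x < i)%N = b2z (x < i')%N - b2z (x < i)%N by lia.
by move=> ? ? ?; rewrite !segmentE; case: (ltnP 0 k) => ?; case: (ltnP k n) => ?; lia.
Qed.

Lemma path_chain_bd m p q (w : vertex m) : in_grid m p -> in_grid m q ->
  \sum_(e : edge m) path_chain p q (epos e) * edge_bd e w = b2z (vpos w == q) - b2z (vpos w == p).
Proof.
case: p q => i j [i' j'] /andP[/= i_le j_le] /andP[/= i'_le j'_le].
rewrite sum_chain_edge_bd /path_chain; have := in_grid_vpos w; case: (vpos w) => k l /andP[/= k_le l_le].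
have factor (c x y z : bool) : (if c then b2z (x && y) - b2z (x && z) else 0)
    = b2z x * (if c then b2z y - b2z z else 0).
  by case: c x => [] [] /=; rewrite ?mul1r ?mul0r ?subrr.
rewrite /= !factor -addrA -!mulrBr (segment_bd i_le) // (segment_bd j_le) // !xpair_eqE.
by case: (l == j); case: (k == i'); case: (l == j'); case: (k == i).
Qed.

Section GridMap.
Variable m : nat.
Let n := m.+1.
Variable a : nat * nat -> nat * nat.
Hypothesis grid_map : forall p, in_grid m p -> in_grid m (a p).

Definition vertex_map (v : vertex m) : vertex m := vertex_at m (a (vpos v)).
Definition edge_map (e e' : edge m) : Z := path_chain (a (src e)) (a (tgt e)) (epos e').

Definition vertex_mx : 'M[Z]_#|{: vertex m}| := graph_mx Z (fun i => enum_rank (vertex_map (enum_val i))).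
Definition edge_mx := kernel_mx edge_map.
Definition face_mx := face_map (boundary2 m) (contraction1 m) edge_mx.

Lemma vpos_vertex_map v : vpos (vertex_map v) = a (vpos v).
Proof. exact: vpos_at (grid_map (in_grid_vpos v)). Qed.

Lemma edge_mx_chain : chain_map (boundary1 m) vertex_mx edge_mx.
Proof.
rewrite /chain_map /edge_mx mul_kernel_mx; apply/matrixP=> i j; rewrite !mxE.
rewrite path_chain_bd ?grid_map ?in_grid_src ?in_grid_tgt // sum_enum_rank.
rewrite -(sum_edge_bd (enum_val i) (fun v => b2z (vpos (enum_val j) == a v))).
apply: eq_bigr => v _; rewrite !mxE !enum_rankK; congr (_ * _).
rewrite -vpos_vertex_map (inj_eq (@vpos_inj m)) -[j in RHS]enum_valK (inj_eq enum_rank_inj).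
by case: (_ == _).
Qed.
End GridMap.

(** * The Lefschetz number of a square as a boundary sum *)

Section GridLefschetz.
Variable m : nat.
Let n := m.+1.

Definition left_flux (x r : nat) (z : edge m -> Z) : Z := \sum_(0 <= i < x) z (vedge m i r).
Definition left_count (x j : nat) (y : nat * nat) : Z := b2z ((y.2 == j) && (y.1 < x)%N).

Definition chain_at (z : edge m -> Z) (r : bool * (nat * nat)) : Z :=
  if r.1 then z (hedge m r.2.1 r.2.2) else z (vedge m r.2.1 r.2.2).

Lemma chain_at_epos z e : chain_at z (epos e) = z e.
Proof. by case: e => -[i j]; rewrite /chain_at /hedge /vedge /= !inord_val. Qed.

Lemma left_fluxS x r z : left_flux x.+1 r z = left_flux x r z + z (vedge m x r).
Proof. by rewrite /left_flux big_nat_recr. Qed.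

Lemma left_flux0 r z : left_flux 0 r z = 0. Proof. by rewrite /left_flux big_geq. Qed.

Lemma left_flux_eq0 x r z : (forall i, (i < x)%N -> z (vedge m i r) = 0) -> left_flux x r z = 0.
Proof. by move=> z0; rewrite /left_flux big_nat big1 // => i /andP[_]; exact: z0. Qed.

Lemma left_countS x l y : left_count x.+1 l y = left_count x l y + b2z ((x, l) == y).
Proof. by case: y => i j; rewrite /left_count /= xpair_eqE; lia. Qed.

Lemma left_count0 l y : left_count 0 l y = 0.
Proof. by rewrite /left_count ltn0 andbF. Qed.

Variables (b : nat * nat -> nat * nat) (F : edge m -> edge m -> Z).
Hypothesis b_grid : forall p, in_grid m p -> in_grid m (b p).
Hypothesis F_chain : forall (e : edge m) (w : vertex m),
  \sum_e' F e e' * edge_bd e' w = b2z (vpos w == b (tgt e)) - b2z (vpos w == b (src e)).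

Lemma divergence_at e k l : (k <= n)%N -> (l <= n)%N ->
  b2z ((k, l) == b (tgt e)) - b2z ((k, l) == b (src e)) =
  (if (0 < k)%N then F e (hedge m k.-1 l) else 0) - (if (k < n)%N then F e (hedge m k l) else 0)
  + (if (0 < l)%N then F e (vedge m k l.-1) else 0) - (if (l < n)%N then F e (vedge m k l) else 0).
Proof.
move=> hk hl; have kl : in_grid m (k, l) by rewrite /in_grid /= hk hl.
have := F_chain e (vertex_at m (k, l)); rewrite vpos_at // => <-.
by under eq_bigr do rewrite -(chain_at_epos (F e)); rewrite sum_chain_edge_bd vpos_at.
Qed.

(* The divergence theorem on the part of the row [l] left of [x]. *)
Lemma left_count_flux e x l : (x < n.+1)%N -> (l <= n)%N ->
  left_count x.+1 l (b (tgt e)) - left_count x.+1 l (b (src e)) =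
  - (if (x < n)%N then F e (hedge m x l) else 0)
  + (if (0 < l)%N then left_flux x.+1 l.-1 (F e) else 0)
  - (if (l < n)%N then left_flux x.+1 l (F e) else 0).
Proof.
move=> + hl; elim: x => [|x IH] hx.
  rewrite !left_fluxS !left_countS opprD addrACA divergence_at //.
  by rewrite /= !left_count0 !left_flux0 subrr !add0r.
rewrite !(left_fluxS x.+1) !(left_countS x.+1) opprD addrACA divergence_at //.
rewrite (IH (ltnW hx)) [(x < n)%N]hx /=; clear IH; repeat case: ifP => _; lia.
Qed.

Lemma left_flux_full e r : (r < n)%N ->
  left_flux n.+1 r (F e) = b2z (r < (b (tgt e)).2)%N - b2z (r < (b (src e)).2)%N.
Proof.
have row l : (l <= n)%N -> b2z ((b (tgt e)).2 == l) - b2z ((b (src e)).2 == l) =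
    (if (0 < l)%N then left_flux n.+1 l.-1 (F e) else 0) - (if (l < n)%N then left_flux n.+1 l (F e) else 0).
  move=> hl; have := left_count_flux e (ltnSn n) hl; rewrite ltnn oppr0 add0r => <-.
  have /andP[t1 _] := b_grid (in_grid_tgt e); have /andP[s1 _] := b_grid (in_grid_src e).
  by rewrite /left_count ![(_ < n.+1)%N]ltnS t1 s1 !andbT.
elim: r => [|r IH] hr; have := row _ (ltnW hr); rewrite hr /= ?(IH (ltnW hr)).
  by move: (left_flux n.+1 0 (F e)) => flux; lia.
by move: (left_flux n.+1 r.+1 (F e)) => flux; lia.
Qed.

Lemma left_flux_all e x r : (r < n)%N -> (x <= n.+1)%N ->
  (forall i, (x <= i <= n)%N -> F e (vedge m i r) = 0) ->
  left_flux x r (F e) = b2z (r < (b (tgt e)).2)%N - b2z (r < (b (src e)).2)%N.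
Proof.
move=> hr hx F0; rewrite -(left_flux_full e hr) /left_flux (big_cat_nat (n := x) (p := n.+1)) //=.
by rewrite [X in _ = _ + X]big_nat [X in _ = _ + X]big1 ?addr0.
Qed.

Variables lo hi : nat.
Hypotheses (lo_gt0 : (0 < lo)%N) (lo_hi : (lo <= hi)%N) (hi_lt : (hi < n)%N).

Definition face_flux (i j : nat) : Z :=
  (- (left_flux i.+1 j (F (hedge m i j)) - left_flux i.+1 j (F (hedge m i j.+1))
      + left_flux i.+1 j (F (vedge m i.+1 j)) - left_flux i.+1 j (F (vedge m i j))))%R.

Definition square_trace : Z :=
  (\sum_(lo <= j < hi.+1) \sum_(lo <= i < hi.+1) b2z (b (i, j) == (i, j))
  - \sum_(lo <= j < hi.+1) \sum_(lo <= i < hi) F (hedge m i j) (hedge m i j)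
  - \sum_(lo <= j < hi) \sum_(lo <= i < hi.+1) F (vedge m i j) (vedge m i j)
  + \sum_(lo <= j < hi) \sum_(lo <= i < hi) face_flux i j)%R.

Definition right_sum : Z :=
  (\sum_(lo <= j < hi.+1) left_count hi.+1 j (b (hi, j))
   - \sum_(lo <= j < hi) left_flux hi.+1 j (F (vedge m hi j)))%R.
Definition top_sum : Z := \sum_(lo <= i < hi) left_flux i.+1 hi (F (hedge m i hi)).
Definition left_sum : Z :=
  (\sum_(lo <= j < hi) left_flux lo j (F (vedge m lo j))
   - \sum_(lo <= j < hi.+1) left_count lo j (b (lo, j)))%R.
Definition bottom_sum : Z := (- \sum_(lo <= i < hi) left_flux i.+1 lo.-1 (F (hedge m i lo)))%R.

Let flux_above j := \sum_(lo <= i < hi) left_flux i.+1 j (F (hedge m i j)).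
Let flux_below j := \sum_(lo <= i < hi) left_flux i.+1 j.-1 (F (hedge m i j)).

Lemma row_trace j : (lo <= j < hi.+1)%N ->
  \sum_(lo <= i < hi.+1) b2z (b (i, j) == (i, j)) - \sum_(lo <= i < hi) F (hedge m i j) (hedge m i j) =
  left_count hi.+1 j (b (hi, j)) - left_count lo j (b (lo, j)) + (flux_above j - flux_below j).
Proof.
move=> /andP[lo_j j_hi].
rewrite -(sum_nat_telescope (fun i => left_count i.+1 j (b (i, j))) (fun i => left_count i j (b (i, j)))) //.
rewrite -sumrB -addrA -big_split /= -sumrN; congr (_ + _).
  by apply: eq_bigr => i _; rewrite left_countS addrC addKr eq_sym.
apply: eq_big_nat => i /andP[lo_i i_hi].
have i_n : (i < n)%N := ltn_trans i_hi hi_lt.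
have j_n : (j < n)%N by lia.
have := left_count_flux (hedge m i j) (ltnW i_n) (ltnW j_n).
rewrite /tgt /src /tgt_at /src_at epos_hedge ?(ltnW j_n) //= i_n j_n (leq_trans lo_gt0 lo_j) => ->.
lia.
Qed.

Lemma strip_trace j : (lo <= j < hi)%N ->
  - \sum_(lo <= i < hi.+1) F (vedge m i j) (vedge m i j) + \sum_(lo <= i < hi) face_flux i j =
  left_flux lo j (F (vedge m lo j)) - left_flux hi.+1 j (F (vedge m hi j)) + (flux_below j.+1 - flux_above j).
Proof.
move=> _; have := sum_nat_telescope (fun i => left_flux i.+1 j (F (vedge m i j)))
  (fun i => left_flux i j (F (vedge m i j))) lo_hi.
under eq_bigr do rewrite left_fluxS addrC addKr.
have -> : \sum_(lo <= i < hi) face_flux i j = (flux_below j.+1 - flux_above j)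
    - \sum_(lo <= i < hi) (left_flux i.+1 j (F (vedge m i.+1 j)) - left_flux i.+1 j (F (vedge m i j))).
  by rewrite /flux_above /flux_below -!sumrB; apply: eq_bigr => i _; rewrite /face_flux /=; lia.
by rewrite addrCA -opprD => ->; rewrite opprB addrC.
Qed.

Lemma square_trace_boundary : square_trace = right_sum + top_sum + left_sum + bottom_sum.
Proof.
have -> : square_trace =
    \sum_(lo <= j < hi.+1) (\sum_(lo <= i < hi.+1) b2z (b (i, j) == (i, j))
      - \sum_(lo <= i < hi) F (hedge m i j) (hedge m i j))
    + \sum_(lo <= j < hi) (- \sum_(lo <= i < hi.+1) F (vedge m i j) (vedge m i j)
      + \sum_(lo <= i < hi) face_flux i j).
  by rewrite /square_trace sumrB big_split /= sumrN addrA.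
rewrite (eq_big_nat _ _ row_trace) (eq_big_nat _ _ strip_trace).
rewrite [X in X + _]big_split [X in _ + X]big_split /= addrACA sum_nat_telescope // !sumrB.
rewrite /right_sum /top_sum /left_sum /bottom_sum -/(flux_above hi) -/(flux_below lo).
have rearrange (c d g h x y : Z) : c - d + (g - h) + (x - y) = c - h + x + (g - d) - y by lia.
exact: rearrange.
Qed.
End GridLefschetz.

Section SquareTrace.
Variable m : nat.
Let n := m.+1.
Variable a : nat * nat -> nat * nat.
Hypothesis grid_map : forall p, in_grid m p -> in_grid m (a p).

Definition in_square (lo hi : nat) (p : nat * nat) : bool := (lo <= p.1 <= hi)%N && (lo <= p.2 <= hi)%N.
Definition vertex_in_square lo hi (v : vertex m) : bool := in_square lo hi (vpos v).
Definition edge_in_square lo hi (e : edge m) : bool := in_square lo hi (src e) && in_square lo hi (tgt e).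
Definition face_in_square lo hi (s : face m) : bool :=
  in_square lo hi (fpos s) && in_square lo hi ((fpos s).1.+1, (fpos s).2.+1).

Definition local_trace N lo hi : Z :=
  (\sum_(i | vertex_in_square lo hi (enum_val i)) (vertex_mx m a ^+ N) i i
  - \sum_(i | edge_in_square lo hi (enum_val i)) (edge_mx m a ^+ N) i i
  + \sum_(i | face_in_square lo hi (enum_val i)) (face_mx m a ^+ N) i i)%R.

Definition iter_edge_map N (e e' : edge m) : Z := (edge_mx m a ^+ N) (enum_rank e) (enum_rank e').

Lemma vpos_iter_vertex_map N (v : vertex m) : vpos (iter N (vertex_map a) v) = iter N a (vpos v).
Proof. by elim: N => //= N IH; rewrite vpos_vertex_map // IH. Qed.

Lemma vertex_mx_exp N (v w : vertex m) :
  (vertex_mx m a ^+ N) (enum_rank v) (enum_rank w) = b2z (vpos w == iter N a (vpos v)).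
Proof.
rewrite graph_mx_exp mxE (_ : iter _ _ _ = enum_rank (iter N (vertex_map a) v)).
  by rewrite (inj_eq enum_rank_inj) -(inj_eq (@vpos_inj m)) vpos_iter_vertex_map; case: (_ == _).
by elim: N => //= N ->; rewrite enum_rankK.
Qed.

Lemma iter_edge_map_chain N e w : \sum_e' iter_edge_map N e e' * edge_bd e' w =
  b2z (vpos w == iter N a (tgt e)) - b2z (vpos w == iter N a (src e)).
Proof.
rewrite -(sum_edge_bd e (fun v => b2z (vpos w == iter N a v))).
have := chain_map_exp N (edge_mx_chain grid_map) => /matrixP/(_ (enum_rank e) (enum_rank w)).
rewrite !mxE !sum_enum_rank; under eq_bigr do rewrite kernel_mxE.
by move=> ->; apply: eq_bigr => v _; rewrite vertex_mx_exp kernel_mxE.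
Qed.

Lemma sum_edge_cone (z : edge m -> Z) s :
  \sum_e z e * edge_cone e s = - left_flux (fpos s).1.+1 (fpos s).2 z.
Proof.
rewrite sum_edge big1 ?add0r; last by move=> i _; rewrite big1 // => j _; exact: mulr0.
case: s => -[k hk] [l hl] /=.
rewrite /left_flux (@sum_nat_window n.+1) 1?ltnW ?ltnS // -sumrN; apply: eq_bigr => i _ /=.
rewrite (bigD1 (Ordinal hl)) //= big1 => [|j].
  rewrite addr0 /edge_cone /edge_cone_at /= eqxx ltnS /= /vedge inord_val.
  rewrite (_ : inord l = Ordinal hl); last by apply: val_inj; rewrite /= inordK.
  by case: (i <= k)%N; [exact: mulrN1 | exact: mulr0].
by rewrite -val_eqE /= /edge_cone /edge_cone_at /= eq_sym => /negPf -> /=; exact: mulr0.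
Qed.

Lemma face_map_coef (X : 'M[Z]_#|{: edge m}|) (s s' : face m) :
  face_map (boundary2 m) (contraction1 m) X (enum_rank s) (enum_rank s') = \sum_e face_bd s e *
    - left_flux (fpos s').1.+1 (fpos s').2 (fun e' => X (enum_rank e) (enum_rank e')).
Proof.
rewrite /face_map -mulmxA mxE sum_enum_rank; apply: eq_bigr => e _.
rewrite kernel_mxE mxE sum_enum_rank -sum_edge_cone; congr (_ * _).
by apply: eq_bigr => e' _; rewrite kernel_mxE.
Qed.

Lemma face_mx_exp N (s : face m) :
  (face_mx m a ^+ N) (enum_rank s) (enum_rank s) = face_flux (iter_edge_map N) (fpos s).1 (fpos s).2.
Proof.
rewrite (face_map_exp (boundary_boundary m) (edge_contraction m) (face_contraction m) N (edge_mx_chain grid_map)).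
rewrite face_map_coef; pose flux (e : edge m) := - left_flux (fpos s).1.+1 (fpos s).2 (iter_edge_map N e).
transitivity (\sum_e face_bd s e * flux e); first by [].
by under eq_bigr do rewrite -(chain_at_epos flux); rewrite sum_face_bd /flux /face_flux /chain_at /=; lia.
Qed.

Lemma sum_nat_window2 N M lo hi hi' (f : nat -> nat -> Z) : (hi <= N)%N -> (hi' <= M)%N ->
  \sum_(lo <= j < hi') \sum_(lo <= i < hi) f i j =
  \sum_(i < N) \sum_(j < M) if (lo <= i < hi)%N && (lo <= j < hi')%N then f i j else 0.
Proof.
move=> hN hM; rewrite exchange_big /= (@sum_nat_window N) //.
apply: eq_bigr => i _; case: ifP => _ /=; last by rewrite big1.
by rewrite (@sum_nat_window M).
Qed.

Lemma vertex_trace_window N lo hi : (hi < n)%N ->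
  \sum_(i | vertex_in_square lo hi (enum_val i)) (vertex_mx m a ^+ N) i i =
  \sum_(lo <= j < hi.+1) \sum_(lo <= i < hi.+1) b2z (iter N a (i, j) == (i, j)).
Proof.
move=> hn; rewrite big_mkcond sum_enum_rank sum_vertex (@sum_nat_window2 n.+1 n.+1) 1?ltnW //.
apply: eq_bigr => i _; apply: eq_bigr => j _.
by rewrite enum_rankK vertex_mx_exp [iter N a _ == _]eq_sym.
Qed.

Lemma edge_trace_window N lo hi : (hi < n)%N ->
  \sum_(i | edge_in_square lo hi (enum_val i)) (edge_mx m a ^+ N) i i =
  \sum_(lo <= j < hi.+1) \sum_(lo <= i < hi) iter_edge_map N (hedge m i j) (hedge m i j)
  + \sum_(lo <= j < hi) \sum_(lo <= i < hi.+1) iter_edge_map N (vedge m i j) (vedge m i j).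
Proof.
move=> hn; have hn' := ltnW hn; rewrite big_mkcond sum_enum_rank sum_edge.
rewrite (@sum_nat_window2 n n.+1) 1?(@sum_nat_window2 n.+1 n) 1?ltnW //.
congr (_ + _); apply: eq_bigr => i _; apply: eq_bigr => j _; rewrite enum_rankK.
  rewrite /iter_edge_map /hedge !inord_val; congr (if _ then _ else _).
  by rewrite /edge_in_square /in_square /src /tgt /=; case: i j => i ? [j ?] /=; lia.
rewrite /iter_edge_map /vedge !inord_val; congr (if _ then _ else _).
by rewrite /edge_in_square /in_square /src /tgt /=; case: i j => i ? [j ?] /=; lia.
Qed.

Lemma face_trace_window N lo hi : (hi < n)%N ->
  \sum_(i | face_in_square lo hi (enum_val i)) (face_mx m a ^+ N) i i =
  \sum_(lo <= j < hi) \sum_(lo <= i < hi) face_flux (iter_edge_map N) i j.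
Proof.
move=> hn; rewrite big_mkcond sum_enum_rank sum_face (@sum_nat_window2 n n) 1?ltnW //.
apply: eq_bigr => i _; apply: eq_bigr => j _; rewrite enum_rankK face_mx_exp /=.
congr (if _ then _ else _); rewrite /face_in_square /in_square /=; case: i j => i ? [j ?] /=; lia.
Qed.

Lemma local_trace_boundary N lo hi : (0 < lo)%N -> (lo <= hi)%N -> (hi < n)%N ->
  local_trace N lo hi = right_sum (iter N a) (iter_edge_map N) lo hi + top_sum (iter_edge_map N) lo hi
    + left_sum (iter N a) (iter_edge_map N) lo hi + bottom_sum (iter_edge_map N) lo hi.
Proof.
move=> lo0 lo_hi hi_n.
rewrite -(square_trace_boundary (@iter_edge_map_chain N) lo0 lo_hi hi_n) /square_trace.
rewrite /local_trace vertex_trace_window // edge_trace_window // face_trace_window //.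
by rewrite opprD !addrA.
Qed.
End SquareTrace.

(** * Regions of the grid *)

Definition corner (x w : nat * nat) : bool := [&& x.1 <= w.1 <= x.1.+1 & x.2 <= w.2 <= x.2.+1]%N.

Section GridRegion.
Variable m : nat.
Let n := m.+1.

Lemma potential_of_cocycle (c : edge m -> Z) : (forall s, \sum_e face_bd s e * c e = 0) ->
  exists W : vertex m -> Z, forall e, W (vertex_at m (tgt e)) - W (vertex_at m (src e)) = c e.
Proof.
move=> cocycle; pose W (v : vertex m) := \sum_e vertex_cone v e * c e.
exists W => e; rewrite -(sum_edge_bd e (fun p => W (vertex_at m p))).
have : \sum_e' (\sum_s edge_cone e s * face_bd s e' + \sum_w edge_bd e w * vertex_cone w e') * c e' = c e.
  rewrite (bigD1 e) //= cone_homotopy eqxx big1 => [|e' /negPf e'e]; first by rewrite addr0; exact: mul1r.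
  by rewrite cone_homotopy eq_sym e'e; exact: mul0r.
under eq_bigr do rewrite mulrDl; rewrite big_split /= => c_e; rewrite -[RHS]c_e.
have -> : \sum_e' (\sum_s edge_cone e s * face_bd s e') * c e' = 0.
  under eq_bigr do rewrite mulr_suml.
  rewrite exchange_big big1 //= => s _.
  by under eq_bigr do rewrite -mulrA; rewrite -mulr_sumr cocycle mulr0.
under [X in _ + X]eq_bigr do rewrite mulr_suml.
rewrite add0r exchange_big; apply: eq_bigr => w _ /=; rewrite vertex_at_vpos mulr_sumr.
by apply: eq_bigr => e' _; rewrite mulrA.
Qed.

Lemma corner_of_face_bd (s : face m) e :
  face_bd s e != 0 -> corner (fpos s) (src e) && corner (fpos s) (tgt e).
Proof.
rewrite /face_bd /face_bd_at /corner /src /tgt /src_at /tgt_at.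
case: (fpos s) (epos e) => i j [[] [k l]] /=; rewrite !xpair_eqE; lia.
Qed.

Lemma face_on_edge (e : edge m) : exists s, face_bd s e != 0.
Proof.
have := in_grid_src e; have := in_grid_tgt e; rewrite /in_grid /src /tgt /src_at /tgt_at.
case eE: (epos e) => [[] [k l]] /= /andP[? ?] /andP[? ?].
- exists (face_at m (k, l - (l == n))%N).
  rewrite /face_bd fpos_at /= ?eE /face_bd_at /= ?xpair_eqE; lia.
- exists (face_at m (k - (k == n), l)%N).
  rewrite /face_bd fpos_at /= ?eE /face_bd_at /= ?xpair_eqE; lia.
Qed.

Definition adjacent (s s' : face m) : bool :=
  (fpos s' == ((fpos s).1.+1, (fpos s).2)) || (fpos s' == ((fpos s).1, (fpos s).2.+1)).

Definition face_connected (M : pred (face m)) : Prop :=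
  forall ph : face m -> Z, (forall s s', M s -> M s' -> adjacent s s' -> ph s = ph s') ->
  forall s s', M s -> M s' -> ph s = ph s'.

Variable M : pred (face m).

(* L is the union of the closed faces outside M, and its cells are called outer. *)
Definition outer_edge (e : edge m) : bool := [exists s, ~~ M s && (face_bd s e != 0)].
Definition inner_edge (e : edge m) : bool := [exists s, M s && (face_bd s e != 0)].
Definition outer_vertex (v : vertex m) : bool := [exists s : face m, ~~ M s && corner (fpos s) (vpos v)].
Definition inner_vertex (v : vertex m) : bool := [exists s : face m, M s && corner (fpos s) (vpos v)].
Definition frontier (v : vertex m) : bool := outer_vertex v && inner_vertex v.

Lemma outer_edge_ends e :
  outer_edge e -> outer_vertex (vertex_at m (src e)) /\ outer_vertex (vertex_at m (tgt e)).
Proof.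
case/existsP=> s /andP[Ms /corner_of_face_bd/andP[cs ct]].
by split; apply/existsP; exists s; rewrite Ms vpos_at ?in_grid_src ?in_grid_tgt.
Qed.

Lemma inner_edge_ends e :
  inner_edge e -> inner_vertex (vertex_at m (src e)) /\ inner_vertex (vertex_at m (tgt e)).
Proof.
case/existsP=> s /andP[Ms /corner_of_face_bd/andP[cs ct]].
by split; apply/existsP; exists s; rewrite Ms vpos_at ?in_grid_src ?in_grid_tgt.
Qed.

Lemma region_of_not_outer_edge e s : ~~ outer_edge e -> face_bd s e != 0 -> M s.
Proof. by move=> /existsPn/(_ s) + nz; rewrite nz andbT negbK. Qed.

Lemma inner_edge_of_not_outer e : ~~ outer_edge e -> inner_edge e.
Proof.
move=> Le; have [s se] := face_on_edge e; apply/existsP; exists s.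
by rewrite se andbT (region_of_not_outer_edge Le se).
Qed.

Section InnerConstant.
Variable ph : nat * nat -> Z.
Hypothesis ph_edge : forall e, inner_edge e -> ph (tgt e) = ph (src e).

Lemma inner_face_const s p : M s -> corner (fpos s) p -> ph p = ph (fpos s).
Proof.
move=> Ms; have [s1 s2] := fpos_lt s.
have hor k l : (k < n)%N -> (l <= n)%N -> face_bd s (hedge m k l) != 0 -> ph (k.+1, l) = ph (k, l).
  move=> hk hl nz; have := ph_edge (e := hedge m k l); rewrite /tgt /src epos_hedge //; apply.
  by apply/existsP; exists s; rewrite Ms.
have ver k l : (k <= n)%N -> (l < n)%N -> face_bd s (vedge m k l) != 0 -> ph (k, l.+1) = ph (k, l).
  move=> hk hl nz; have := ph_edge (e := vedge m k l); rewrite /tgt /src epos_vedge //; apply.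
  by apply/existsP; exists s; rewrite Ms.
have bottom := hor _ _ s1 (ltnW s2); have left := ver _ _ (ltnW s1) s2; have top := hor _ _ s1 s2.
move: bottom left top; rewrite /face_bd !epos_hedge ?epos_vedge ?(ltnW s1) ?(ltnW s2) //.
rewrite /face_bd_at /corner; case: (fpos s) p => i j [k l] /= bottom left top /andP[ik jl].
have {}bottom : ph (i.+1, j) = ph (i, j) by apply: bottom; rewrite !xpair_eqE; lia.
have {}left : ph (i, j.+1) = ph (i, j) by apply: left; rewrite !xpair_eqE; lia.
have {}top : ph (i.+1, j.+1) = ph (i, j.+1) by apply: top; rewrite !xpair_eqE; lia.
have [->|->] : k = i \/ k = i.+1 by lia.
  by have [->|->] : l = j \/ l = j.+1 by lia.
have [->|->] : l = j \/ l = j.+1 by lia.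
  by [].
by rewrite top left.
Qed.

Lemma inner_vertex_const : face_connected M ->
  forall v w, inner_vertex v -> inner_vertex w -> ph (vpos v) = ph (vpos w).
Proof.
move=> M_connected v w /existsP[s /andP[Ms cs]] /existsP[s' /andP[Ms' cs']].
rewrite (inner_face_const Ms cs) (inner_face_const Ms' cs').
apply: (M_connected (fun s => ph (fpos s))) => // t t' Mt _ /orP[] /eqP ->;
  by rewrite (inner_face_const Mt) // /corner !leqnn !leqnSn.
Qed.
End InnerConstant.

Definition outer_rel : rel (vertex m) := [rel v w | [exists e : edge m, outer_edge e &&
  (((vpos v == src e) && (vpos w == tgt e)) || ((vpos w == src e) && (vpos v == tgt e)))]].

Lemma outer_rel_sym : connect_sym outer_rel.
Proof. by apply: sym_connect_sym => v w; apply: eq_existsb => e; rewrite orbC. Qed.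

Lemma outer_rel_edge e : outer_edge e -> outer_rel (vertex_at m (src e)) (vertex_at m (tgt e)).
Proof. by move=> Le; apply/existsP; exists e; rewrite Le !vpos_at ?in_grid_src ?in_grid_tgt // !eqxx. Qed.

Lemma outer_rel_const (ph : vertex m -> Z) :
  (forall e, outer_edge e -> ph (vertex_at m (tgt e)) = ph (vertex_at m (src e))) ->
  forall v w, outer_rel v w -> ph v = ph w.
Proof.
move=> ph_edge v w /existsP[e /andP[/ph_edge ph_e /orP[]/andP[/eqP vE /eqP wE]]];
  by rewrite -(vertex_at_vpos v) -(vertex_at_vpos w) vE wE.
Qed.

Lemma connect_outer_const (ph : vertex m -> Z) :
  (forall e, outer_edge e -> ph (vertex_at m (tgt e)) = ph (vertex_at m (src e))) ->
  forall v w, connect outer_rel v w -> ph v = ph w.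
Proof.
move=> /outer_rel_const ph_rel v w /connectP[q]; elim: q v => [|x q IH] v /= => [_ -> //|].
by move=> /andP[/ph_rel -> path_q] w_last; exact: IH path_q w_last.
Qed.

Lemma outer_vertex_connect v w : connect outer_rel v w -> outer_vertex v -> outer_vertex w.
Proof.
have const : forall e, outer_edge e ->
    b2z (outer_vertex (vertex_at m (tgt e))) = b2z (outer_vertex (vertex_at m (src e))).
  by move=> e /outer_edge_ends[-> ->].
by move=> vw Lv; have := connect_outer_const (ph := b2z \o outer_vertex) const vw; rewrite /= Lv; case: outer_vertex.
Qed.

Lemma connect_outer_chain v w : connect outer_rel v w ->
  exists z : edge m -> Z, (forall e, z e != 0 -> outer_edge e) /\
    forall u, \sum_e z e * edge_bd e u = b2z (u == w) - b2z (u == v).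
Proof.
case/connectP=> q; elim: q v => [|x q IH] v /=.
  by move=> _ ->; exists (fun _ => 0); split=> [e|u]; rewrite ?eqxx // subrr big1.
move=> /andP[vx path_q] w_last; have [z [z_outer z_bd]] := IH x path_q w_last.
have {vx}[e [c [Le ce]]] : exists e (c : Z), outer_edge e /\
    forall u, c * edge_bd e u = b2z (u == x) - b2z (u == v).
  case/existsP: vx => e /andP[Le /orP[]/andP[/eqP h1 /eqP h2]]; exists e.
    by exists 1; split=> // u; rewrite mul1r /edge_bd -h1 -h2 !(inj_eq (@vpos_inj m)).
  by exists (-1); split=> // u; rewrite mulN1r /edge_bd -h1 -h2 !(inj_eq (@vpos_inj m)) opprB.
exists (fun e' => z e' + c * b2z (e' == e)); split.
  by move=> e'; case: (eqVneq e' e) => [-> //|_]; rewrite [c * _]mulr0 addr0; exact: z_outer.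
move=> u; under eq_bigr do rewrite mulrDl.
rewrite big_split /= z_bd (bigD1 e) //= eqxx [c * _]mulr1 ce big1 ?addr0; first lia.
by move=> e' /negPf ->; rewrite [c * _]mulr0 mul0r.
Qed.

(* The grid has no first cohomology, so a locally constant function on the frontier of M
   is the difference of locally constant functions on L and on M. *)
Lemma frontier_const (u : vertex m -> Z) : face_connected M ->
  (forall e, outer_edge e -> inner_edge e -> u (vertex_at m (src e)) = u (vertex_at m (tgt e))) ->
  forall v w, frontier v -> frontier w -> connect outer_rel v w -> u v = u w.
Proof.
move=> M_connected u_edge.
pose ext p := if frontier (vertex_at m p) then u (vertex_at m p) else 0.
pose c (e : edge m) : Z := if inner_edge e then ext (tgt e) - ext (src e) else 0.
have c_outer e : outer_edge e -> c e = 0.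
  move=> Le; rewrite /c; case: ifP => // Me; rewrite /ext /frontier.
  have [-> ->] := outer_edge_ends Le; have [-> ->] := inner_edge_ends Me.
  by rewrite /= u_edge // subrr.
have cocycle s : \sum_e face_bd s e * c e = 0.
  case Ms: (M s); last first.
    rewrite big1 // => e _; case: (eqVneq (face_bd s e) 0) => [->|nz]; first by rewrite mul0r.
    by rewrite c_outer ?mulr0 //; apply/existsP; exists s; rewrite Ms.
  transitivity (\sum_e face_bd s e * (ext (tgt_at (epos e)) - ext (src_at (epos e)))).
    apply: eq_bigr => e _; case: (eqVneq (face_bd s e) 0) => [->|nz]; first by rewrite !mul0r.
    by rewrite /c ifT //; apply/existsP; exists s; rewrite Ms.
  by rewrite (sum_face_bd s (fun r => ext (tgt_at r) - ext (src_at r))) /tgt_at /src_at /=; lia.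
have [W dW] := potential_of_cocycle cocycle.
have W_outer : forall v w, connect outer_rel v w -> W v = W w.
  by apply: connect_outer_const => e Le; apply/eqP; rewrite -subr_eq0 dW c_outer.
have W_inner : forall v w, inner_vertex v -> inner_vertex w -> W v - ext (vpos v) = W w - ext (vpos w).
  have := @inner_vertex_const (fun p => W (vertex_at m p) - ext p) _ M_connected.
  by move=> + v w => /(_ _ v w); rewrite !vertex_at_vpos; apply=> e Me; have := dW e; rewrite /c Me; lia.
move=> v w fv fw vw; have := W_outer _ _ vw.
have /andP[_ Mv] := fv; have /andP[_ Mw] := fw.
by have := W_inner v w Mv Mw; rewrite /ext !vertex_at_vpos fv fw; lia.
Qed.
End GridRegion.

Section Fillings.
Variable m : nat.
Let n := m.+1.

Definition boundary_edge (e : edge m) : bool :=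
  let: (horizontal, (i, j)) := epos e in
  if horizontal then (j == 0%N) || (j == n) else (i == 0%N) || (i == n).

Let face_coef (y : 'rV[Z]_#|{: face m}|) (q : nat * nat) : Z := y 0 (enum_rank (face_at m q)).

Let row_mul_boundary2 y e : (y *m boundary2 m) 0 (enum_rank e) = \sum_s face_coef y (fpos s) * face_bd s e.
Proof.
by rewrite mxE sum_enum_rank; apply: eq_bigr => s _; rewrite kernel_mxE /face_coef face_at_fpos.
Qed.

Lemma edge_between_adjacent (s s' : face m) : adjacent s s' ->
  exists e, (forall t, face_bd t e != 0 -> t = s \/ t = s') /\
    forall y : 'rV_#|{: face m}|, (y *m boundary2 m) 0 (enum_rank e) = 0 ->
      y 0 (enum_rank s) = y 0 (enum_rank s').
Proof.
move=> ss'; suff [e [e_faces e_coef]] : exists e,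
    (forall t, face_bd t e != 0 -> fpos t = fpos s \/ fpos t = fpos s') /\
    forall y : 'rV_#|{: face m}|, (y *m boundary2 m) 0 (enum_rank e) = 0 ->
      face_coef y (fpos s) = face_coef y (fpos s').
  exists e; split=> [t /e_faces [/fpos_inj|/fpos_inj]|y /e_coef]; [by left | by right |].
  by rewrite /face_coef !face_at_fpos.
have [s1 s2] := fpos_lt s; have [s'1 s'2] := fpos_lt s'.
move: ss' s1 s2 s'1 s'2; rewrite /adjacent; case: (fpos s) (fpos s') => i j [i' j'] /=.
move=> + hi hj => /orP[]/eqP[-> ->] hi' hj'.
  exists (vedge m i.+1 j); split=> [t|y].
    rewrite /face_bd /face_bd_at epos_vedge //.
    case: (fpos t) => k l /=; rewrite !xpair_eqE => nz.
    by have [[-> ->]|[-> ->]] : (k = i /\ l = j) \/ (k = i.+1 /\ l = j); [lia | left | right].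
  by rewrite row_mul_boundary2 sum_chain_face_bd epos_vedge //= hi' => /eqP; rewrite subr_eq0 => /eqP.
exists (hedge m i j.+1); split=> [t|y].
  rewrite /face_bd /face_bd_at epos_hedge //.
  case: (fpos t) => k l /=; rewrite !xpair_eqE => nz.
  by have [[-> ->]|[-> ->]] : (k = i /\ l = j) \/ (k = i /\ l = j.+1); [lia | left | right].
rewrite row_mul_boundary2 sum_chain_face_bd epos_hedge //= hj' => /eqP.
by rewrite subr_eq0 => /eqP ->.
Qed.

Lemma face_at_boundary_edge (e : edge m) : boundary_edge e ->
  exists s, face_bd s e != 0 /\
    forall y : 'rV_#|{: face m}|, (y *m boundary2 m) 0 (enum_rank e) = 0 -> y 0 (enum_rank s) = 0.
Proof.
have := in_grid_src e; have := in_grid_tgt e; rewrite /boundary_edge /in_grid /src /tgt /src_at /tgt_at.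
case eE: (epos e) => [[] [i j]] /= /andP[t1 t2] /andP[s1 s2].
- case/orP=> /eqP jE; subst j.
    exists (face_at m (i, 0%N)); rewrite /face_bd eE fpos_at //= /face_bd_at /= !xpair_eqE eqxx.
    by split=> // y; rewrite row_mul_boundary2 sum_chain_face_bd eE /= subr0.
  exists (face_at m (i, m)); rewrite /face_bd eE fpos_at //= /face_bd_at /= !xpair_eqE !eqxx.
  split; first by rewrite andbT; case: eqP => // /esym/eqP; rewrite -/n; lia.
  by move=> y; rewrite row_mul_boundary2 sum_chain_face_bd eE /= ltnn sub0r => /eqP; rewrite oppr_eq0 => /eqP.
- case/orP=> /eqP iE; subst i.
    exists (face_at m (0%N, j)); rewrite /face_bd eE fpos_at //= /face_bd_at /= !xpair_eqE !eqxx.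
    by split=> // y; rewrite row_mul_boundary2 sum_chain_face_bd eE /= sub0r => /eqP; rewrite oppr_eq0 => /eqP.
  exists (face_at m (m, j)); rewrite /face_bd eE fpos_at //= /face_bd_at /= !xpair_eqE !eqxx.
  split; first by rewrite andbT; case: eqP => // /esym/eqP; rewrite -/n; lia.
  by move=> y; rewrite row_mul_boundary2 sum_chain_face_bd eE /= ltnn subr0.
Qed.

Lemma sum_face_bd_interior (e : edge m) : ~~ boundary_edge e -> \sum_s face_bd s e = 0.
Proof.
move=> interior; have := sum_chain_face_bd (fun _ => 1) e; under eq_bigr do rewrite mul1r.
move=> ->; have := in_grid_tgt e; move: interior; rewrite /boundary_edge /in_grid /tgt /tgt_at.
case: (epos e) => [[] [i j]] /= /norP[/eqP ? /eqP ?] /andP[? ?]; repeat (case: ifP => ?); lia.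
Qed.

Variable M : pred (face m).
Definition outer_vertex_index (i : 'I_#|{: vertex m}|) : bool := outer_vertex M (enum_val i).
Definition outer_edge_index (i : 'I_#|{: edge m}|) : bool := outer_edge M (enum_val i).
Definition outer_face_index (i : 'I_#|{: face m}|) : bool := ~~ M (enum_val i).

Lemma region_filling_const (z : 'rV[Z]_#|{: edge m}|) : face_connected M ->
  z *m boundary1 m = 0 -> (forall j, z 0 j != 0 -> outer_edge_index j) ->
  exists t, forall i, ~~ outer_face_index i -> (z *m contraction1 m) 0 i = t.
Proof.
move=> M_connected z_cycle z_outer; have := cycle_filling (edge_contraction m) z_cycle.
set y := z *m contraction1 m => y_bd.
have y_const : forall s s', M s -> M s' -> y 0 (enum_rank s) = y 0 (enum_rank s').
  apply: (M_connected (fun s => y 0 (enum_rank s))) => s s' Ms Ms' /edge_between_adjacent[e [e_faces]].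
  apply; rewrite y_bd; apply/eqP; apply: contraT => /z_outer; rewrite /outer_edge_index enum_rankK.
  by case/existsP=> t /andP[Mt /e_faces[] tE]; rewrite tE ?Ms ?Ms' in Mt.
case: (pickP M) => [s0 Ms0|M0].
  by exists (y 0 (enum_rank s0)) => i /negPn Mi; rewrite -[i in LHS]enum_valK; apply: y_const.
by exists 0 => i; rewrite /outer_face_index M0.
Qed.

Lemma region_filling_zero (z : 'rV[Z]_#|{: edge m}|) : face_connected M ->
  (exists2 e, ~~ outer_edge M e & boundary_edge e) ->
  z *m boundary1 m = 0 -> (forall j, z 0 j != 0 -> outer_edge_index j) ->
  forall i, ~~ outer_face_index i -> (z *m contraction1 m) 0 i = 0.
Proof.
move=> M_connected [e Le /face_at_boundary_edge[s [se y_s]]] z_cycle z_outer i Mi.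
have [t tE] := region_filling_const M_connected z_cycle z_outer.
rewrite tE // -(tE (enum_rank s)); last by rewrite /outer_face_index enum_rankK (region_of_not_outer_edge Le se).
apply: y_s; rewrite (cycle_filling (edge_contraction m) z_cycle).
by apply/eqP; apply: contraNT Le => /z_outer; rewrite /outer_edge_index enum_rankK.
Qed.

Lemma region_total_boundary : (forall e, ~~ outer_edge M e -> ~~ boundary_edge e) ->
  forall j, ~~ outer_edge_index j -> \sum_(i | ~~ outer_face_index i) boundary2 m i j = 0.
Proof.
move=> interior j Lj; rewrite -[RHS](sum_face_bd_interior (interior _ Lj)).
rewrite big_mkcond sum_enum_rank; apply: eq_bigr => s _.
rewrite /outer_face_index negbK enum_rankK mxE enum_rankK; case Ms: (M s) => //.
by apply/esym/eqP; apply: contraFT Ms; apply: region_of_not_outer_edge.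
Qed.
End Fillings.

(** * Exit maps *)

Lemma natr_Z n : n%:R = Z.of_nat n.
Proof. by elim: n => // n IH; rewrite mulrS IH; lia. Qed.

Section ExitMap.
Variable m : nat.
Variable M : pred (face m).
Hypothesis M_connected : face_connected M.
Variables (a : nat * nat -> nat * nat) (v0 : vertex m).
Hypothesis grid_map : forall p, in_grid m p -> in_grid m (a p).
Hypothesis v0_outer : outer_vertex M v0.
Hypothesis frontier_vertex : forall v, frontier M v -> outer_vertex M (vertex_map a v).
Hypothesis frontier_edge : forall e e' : edge m,
  outer_edge M e -> inner_edge M e -> edge_map a e e' != 0 -> outer_edge M e'.

Local Notation linked := (connect (outer_rel M)).

Lemma linked_frontier_edge (e : edge m) : outer_edge M e -> inner_edge M e ->
  linked (vertex_map a (vertex_at m (src e))) (vertex_map a (vertex_at m (tgt e))).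
Proof.
move=> Le Me; rewrite /vertex_map !vpos_at ?in_grid_src ?in_grid_tgt //.
set v := vertex_at m (a (src e)); pose ph p := b2z (linked v (vertex_at m p)).
have ph_outer e' : outer_edge M e' -> ph (tgt e') = ph (src e').
  move=> /outer_rel_edge/connect1 st; rewrite /ph; congr b2z.
  apply/idP/idP => v_end; apply: connect_trans v_end _; last exact: st.
  by rewrite outer_rel_sym.
have chain_end : \sum_w (\sum_e' edge_map a e e' * edge_bd e' w) * ph (vpos w) = ph (a (tgt e)) - ph (a (src e)).
  under eq_bigr => w _ do rewrite path_chain_bd ?grid_map ?in_grid_src ?in_grid_tgt // mulrBl.
  by rewrite sumrB !sum_vertex_delta ?grid_map ?in_grid_src ?in_grid_tgt.
suff : ph (a (tgt e)) = ph (a (src e)).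
  by rewrite /ph -/v connect0; case: connect.
apply/eqP; rewrite -subr_eq0 -chain_end; under eq_bigr do rewrite mulr_suml.
rewrite exchange_big /= big1 // => e' _; under eq_bigr do rewrite -mulrA.
rewrite -mulr_sumr sum_edge_bd; case: (eqVneq (edge_map a e e') 0) => [->|nz]; first by rewrite mul0r.
by rewrite ph_outer ?subrr ?mulr0 //; apply: frontier_edge nz.
Qed.

Lemma linked_frontier_images v w : frontier M v -> frontier M w -> linked v w ->
  linked (vertex_map a v) (vertex_map a w).
Proof.
move=> fv fw vw; pose u x := b2z (linked (vertex_map a v) (vertex_map a x)).
suff : u v = u w by rewrite /u connect0; case: connect.
apply: (frontier_const M_connected) => // e Le Me; rewrite /u; congr b2z.
have st := linked_frontier_edge Le Me; apply/idP/idP => v_end; apply: connect_trans v_end _.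
  exact: st.
by rewrite outer_rel_sym.
Qed.

(* A component of L goes to the component that contains the images of its frontier vertices. *)
Definition exit_map (v : vertex m) : vertex m :=
  if [pick v' | frontier M v' && linked v v'] is Some v' then fingraph.root (outer_rel M) (vertex_map a v')
  else v0.

Lemma exit_map_outer v : outer_vertex M (exit_map v).
Proof.
rewrite /exit_map; case: pickP => [v' /andP[fv _]|_] //.
exact: outer_vertex_connect (connect_root _ _) (frontier_vertex fv).
Qed.

Lemma exit_map_rel v w : outer_rel M v w -> exit_map v = exit_map w.
Proof.
move=> vw; rewrite /exit_map; congr (if _ is Some v' then _ else v0).
apply: eq_pick => x /=; congr (_ && _).
by apply: same_connect => //; [exact: outer_rel_sym | exact: connect1].
Qed.

Lemma linked_exit_map v : frontier M v -> linked (vertex_map a v) (exit_map v).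
Proof.
move=> fv; rewrite /exit_map; case: pickP => [v' /andP[fv' vv']|/(_ v)]; last by rewrite fv connect0.
exact: connect_trans (linked_frontier_images fv fv' vv') (connect_root _ _).
Qed.

Lemma card_exit_map_image C (label : vertex m -> 'I_C) :
  (forall v w, frontier M v -> frontier M w -> label (vertex_map a v) = label (vertex_map a w) ->
     linked (vertex_map a v) (vertex_map a w)) ->
  (#|[set exit_map v | v : vertex m]| <= C.+1)%N.
Proof.
move=> label_linked; pose value (c : option 'I_C) : vertex m := if c is Some c then
  (if [pick v' | frontier M v' && (label (vertex_map a v') == c)] is Some v'
   then fingraph.root (outer_rel M) (vertex_map a v') else v0) else v0.
have -> : C.+1 = #|[set: option 'I_C]| by rewrite cardsT card_option card_ord.
apply: leq_trans (leq_imset_card value _); apply/subset_leq_card/subsetP => x /imsetP[v _ ->] {x}.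
rewrite /exit_map; case: pickP => [v' /andP[fv _]|_]; last by apply/imsetP; exists None; rewrite ?inE.
apply/imsetP; exists (Some (label (vertex_map a v'))); rewrite ?inE //=.
case: pickP => [w /andP[fw /eqP lw]|/(_ v')]; last by rewrite fv eqxx.
by apply/eqP; rewrite root_connect; [apply: label_linked | apply: outer_rel_sym].
Qed.

Definition exit_index_map (i : 'I_#|{: vertex m}|) : 'I_#|{: vertex m}| := enum_rank (exit_map (enum_val i)).

Let exit_fun i := if outer_vertex_index M i then exit_index_map i else enum_rank (vertex_map a (enum_val i)).

Lemma exit_fun_edge i : outer_edge_index M i ->
  forall j, (boundary1 m *m graph_mx Z exit_fun) i j = 0.
Proof.
rewrite -[i]enum_valK /outer_edge_index enum_rankK => Le j; rewrite mxE sum_enum_rank.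
under eq_bigr => v _ do rewrite kernel_mxE mxE -[v in exit_fun (_ v)]vertex_at_vpos.
transitivity (\sum_v edge_bd (enum_val i) v * b2z (j == exit_fun (enum_rank (vertex_at m (vpos v))))).
  by apply: eq_bigr => v _; case: (_ == _).
rewrite (sum_edge_bd _ (fun p => b2z (j == exit_fun (enum_rank (vertex_at m p))))).
have [outer_src outer_tgt] := outer_edge_ends Le.
rewrite /exit_fun /outer_vertex_index /exit_index_map !enum_rankK outer_src outer_tgt.
by rewrite (exit_map_rel (outer_rel_edge Le)) subrr.
Qed.

Definition exit_filling (v : vertex m) (z : edge m -> Z) : Prop :=
  (forall e, z e != 0 -> outer_edge M e) /\
  forall u, \sum_e z e * edge_bd e u =
    if frontier M v then b2z (u == exit_map v) - b2z (u == vertex_map a v) else 0.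

Lemma exit_filling_exists v : exists z, exit_filling v z.
Proof.
rewrite /exit_filling; case fv: (frontier M v).
  exact: connect_outer_chain (linked_exit_map fv).
by exists (fun _ => 0); split=> // u; rewrite big1 // => e _; exact: mul0r.
Qed.

Lemma exit_filling_boundary fill : (forall v, exit_filling v (fill v)) ->
  forall i j l, ~~ outer_edge_index M i -> boundary1 m i j != 0 ->
  (vertex_mx m a + kernel_mx fill *m boundary1 m) j l = graph_mx Z exit_fun j l.
Proof.
move=> fillE i j l Li; rewrite mxE => nz.
have Mj : inner_vertex M (enum_val j).
  have [inner_src inner_tgt] := inner_edge_ends (inner_edge_of_not_outer Li).
  move: nz; rewrite /edge_bd -[in inner_vertex M _](vertex_at_vpos (enum_val j)).
  by case: (_ =P tgt _) => [-> //|_]; case: (_ =P src _) => [-> //|_].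
rewrite mul_kernel_mx !mxE (proj2 (fillE _)) /frontier Mj andbT /exit_fun /outer_vertex_index.
rewrite -[l in l == _]enum_valK -[l in X in _ = X]enum_valK; case: outer_vertex; last first.
  by rewrite addr0 enum_valK.
rewrite /exit_index_map !(inj_eq enum_rank_inj).
by case: (_ == vertex_map _ _); case: (_ == exit_map _).
Qed.

Lemma exit_trace N (q : face m) : M q ->
  (forall i, (restr_mx (predC (outer_face_index M)) (face_mx m a) ^+ N) i (enum_rank q) = 0) -> forall k,
  Lefschetz_restr (predC (outer_vertex_index M)) (predC (outer_edge_index M)) (predC (outer_face_index M))
    (vertex_mx m a) (edge_mx m a) (face_mx m a) k.+1
  = 1 - #|[pred i | outer_vertex_index M i && (iter k.+1 exit_index_map i == i)]|%:R.
Proof.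
move=> Mq colN k; have [fill fillE] := fin_all_exists exit_filling_exists.
have exit_outer i : outer_vertex_index M i -> outer_vertex_index M (exit_index_map i).
  by move=> _; rewrite /outer_vertex_index enum_rankK exit_map_outer.
have outer_face_edges i j : outer_face_index M i -> boundary2 m i j != 0 -> outer_edge_index M j.
  by rewrite mxE /outer_face_index => Mi nz; apply/existsP; exists (enum_val i); rewrite Mi.
have fill_outer i j : kernel_mx fill i j != 0 -> outer_edge_index M j by rewrite mxE => /(proj1 (fillE _)).
have frontier_outer i j l :
    ~~ outer_face_index M i -> boundary2 m i j != 0 -> outer_edge_index M j -> edge_mx m a j l != 0 ->
    outer_edge_index M l.
  rewrite /outer_face_index negbK !mxE => Mi nz Lj; apply: frontier_edge => //.
  by apply/existsP; exists (enum_val i); rewrite Mi.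
have fill_bd := exit_filling_boundary fillE.
case: (pickP [pred e | ~~ outer_edge M e && boundary_edge e]) => [e /= /andP[Le be]|interior].
  apply: (exit_trace_of_zero_fillings (boundary_boundary m) (vertex_contraction m) (edge_contraction m)
    (face_contraction m) (edge_mx_chain grid_map) exit_outer exit_fun_edge outer_face_edges fill_outer
    fill_bd frontier_outer) => z z_cycle z_outer.
  by apply: region_filling_zero => //; exists e.
apply: (exit_trace_of_constant_fillings (boundary_boundary m) (vertex_contraction m) (edge_contraction m)
  (face_contraction m) (edge_mx_chain grid_map) exit_outer exit_fun_edge outer_face_edges fill_outer
  fill_bd frontier_outer k _ _ _ colN).
- by move=> z; exact: region_filling_const.
- move=> j Lj; apply: region_total_boundary Lj => e Le;
  by have := interior e; rewrite /= Le => /negbT.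
- by rewrite /outer_face_index enum_rankK negbK.
Qed.

Lemma card_periodic_exit_map C : (#|[set exit_map v | v : vertex m]| <= C)%N ->
  (#|[set i | outer_vertex_index M i && periodic exit_index_map i]| <= C)%N.
Proof.
apply: leq_trans; apply: leq_trans (leq_imset_card enum_rank _).
apply: subset_leq_card; apply/subsetP => x; rewrite inE => /andP[_ /eqP].
case: (order _ x) (order_gt0 exit_index_map x) => // o _ /= <-.
apply/imsetP; exists (exit_map (enum_val (iter o exit_index_map x))) => //.
by apply/imsetP; exists (enum_val (iter o exit_index_map x)).
Qed.

Lemma exit_trace_divisor_sum C N q : (#|[set exit_map v | v : vertex m]| <= C)%N -> M q ->
  (forall i, (restr_mx (predC (outer_face_index M)) (face_mx m a) ^+ N) i (enum_rank q) = 0) ->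
  exists al, some_positive C al /\ forall k,
    Lefschetz_restr (predC (outer_vertex_index M)) (predC (outer_edge_index M)) (predC (outer_face_index M))
      (vertex_mx m a) (edge_mx m a) (face_mx m a) k.+1
    = 1 - Z.of_nat (divisor_sum C al k.+1).
Proof.
move=> /card_periodic_exit_map card_le Mq colN.
have exit_outer i : outer_vertex_index M i -> outer_vertex_index M (exit_index_map i).
  by move=> _; rewrite /outer_vertex_index enum_rankK exit_map_outer.
exists (fun d => #|periodic_of_order exit_index_map (outer_vertex_index M) d| %/ d)%N; split.
  apply: (some_periodic_order exit_outer (x := enum_rank v0)) => //.
  by rewrite /outer_vertex_index enum_rankK.
by move=> k; rewrite (exit_trace Mq colN) -(card_iter_fixed exit_outer) // natr_Z.
Qed.
End ExitMap.

Local Close Scope ring_scope.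
Local Open Scope R_scope.

(** * From boundary sums to winding numbers *)

Lemma turn_refl g t w k : continuous_path g -> (k < 4)%N -> w.2 <> 0 -> 0 < axis k w ->
  0 < axis k (g t) -> turn g t w t w 0.
Proof.
move=> g_cont k4 w2 wk gk; have -> : 0%Z = crossing k w w by rewrite /crossing; case: (k) => // ; lia.
by apply: turn_half_plane => //; [lra | move=> s st; have -> : s = t by lra].
Qed.

Lemma turn_seq g (t : nat -> R) (W : nat -> pt) (z : nat -> Z) lo hi : (lo <= hi)%N ->
  turn g (t lo) (W lo) (t lo) (W lo) 0 ->
  (forall i, (lo <= i < hi)%N -> turn g (t i) (W i) (t i.+1) (W i.+1) (z i)) ->
  turn g (t lo) (W lo) (t hi) (W hi) (\sum_(lo <= i < hi) z i)%R.
Proof.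
move=> lo_hi turn_lo turn_step; elim: hi lo_hi turn_step => [|hi IH].
  by rewrite leqn0 => /eqP lo0 _; subst lo; rewrite big_geq.
rewrite leq_eqVlt => /orP[/eqP <- _|lo_hi turn_step]; first by rewrite big_geq.
rewrite big_nat_recr //=; apply: turn_trans (IH lo_hi _) (turn_step hi _); last by rewrite ltnSn andbT.
by move=> i /andP[lo_i i_hi]; apply: turn_step; rewrite lo_i leqW.
Qed.

(* With a margin, [v - x] lies in the half plane number [k]. *)
Definition displaced (k : nat) (v x : nat * nat) : bool :=
  match k with
  | 0 => x.1 + 2 <= v.1 | 1 => x.2 + 2 <= v.2 | 2 => v.1 + 2 <= x.1 | _ => v.2 + 2 <= x.2
  end%N.

Definition grid_near (v w : nat * nat) : bool :=
  [&& v.1 <= w.1.+1, w.1 <= v.1.+1, v.2 <= w.2.+1 & w.2 <= v.2.+1]%N.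

Lemma grid_near_refl v : grid_near v v. Proof. by rewrite /grid_near !leqnSn. Qed.

(* The vertical shift keeps the displacement off the first axis, where [Arg] is cut. *)
Definition shifted_displacement (s : R) (v y : nat * nat) : pt :=
  (INR v.1 - INR y.1, INR v.2 + s / 4 - INR y.2).

Definition is_sign (s : R) : Prop := s = 1 \/ s = -1.

Lemma INR_leq a b : (a <= b)%N -> INR a <= INR b.
Proof. by move=> ab; apply: le_INR; lia. Qed.

Lemma shifted_displacement_neq0 s v y : is_sign s -> (shifted_displacement s v y).2 <> 0.
Proof.
move=> s_sign /=; case: (ltngtP y.2 v.2) => [/INR_leq|/INR_leq|->]; rewrite ?S_INR;
  by case: s_sign => ->; lra.
Qed.

Lemma upper_displacement_minus v y : upper (shifted_displacement (-1) v y) = b2z (y.2 < v.2)%N.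
Proof.
rewrite /upper /=; case: Rlt_dec => [?|not_gt]; case: ltnP => /INR_leq; rewrite ?S_INR => ? //;
  exfalso; try apply: not_gt; lra.
Qed.

Lemma upper_displacement_plus v y : upper (shifted_displacement 1 v y) = b2z (y.2 <= v.2)%N.
Proof.
rewrite /upper /=; case: Rlt_dec => [?|not_gt]; case: leqP => /INR_leq; rewrite ?S_INR => ? //;
  exfalso; try apply: not_gt; lra.
Qed.

Lemma axis_shifted_displacement s k v w y : (k < 4)%N -> is_sign s -> grid_near v w -> displaced k v y ->
  0 < axis k (shifted_displacement s w y).
Proof.
move=> k4 s_sign /and4P[? ? ? ?]; case: k k4 => [|[|[|[|//]]]] _ /= far.
- have : (y.1.+1 <= w.1)%N by lia.
  by move=> /INR_leq; rewrite S_INR; lra.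
- have : (y.2.+1 <= w.2)%N by lia.
  by move=> /INR_leq; rewrite S_INR; case: s_sign => ->; lra.
- have : (w.1.+1 <= y.1)%N by lia.
  by move=> /INR_leq; rewrite S_INR; lra.
- have : (w.2.+1 <= y.2)%N by lia.
  by move=> /INR_leq; rewrite S_INR; case: s_sign => ->; lra.
Qed.

Section SideCrossings.
Variable m : nat.
Local Notation n := m.+1.
Variables (b : nat * nat -> nat * nat) (F : edge m -> edge m -> Z).

Definition displaced_images (k : nat) (v : nat * nat) : Prop :=
  (forall w, grid_near v w -> displaced k v (b w)) /\
  (forall e e', grid_near v (src e) -> F e e' != 0%R -> displaced k v (src e')).

Hypothesis b_grid : forall p, in_grid m p -> in_grid m (b p).
Hypothesis F_chain : forall (e : edge m) (w : vertex m),
  (\sum_e' F e e' * edge_bd e' w)%R = (b2z (vpos w == b (tgt e)) - b2z (vpos w == b (src e)))%Z.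

Section AtVertex.
Variables (k : nat) (v : nat * nat).
Hypothesis b_far : displaced_images k v.

Lemma left_flux_near e x r : grid_near v (src e) -> (r < n)%N -> (x <= n.+1)%N ->
  [&& v.1 <= x.+1, x <= v.1.+2, v.2 <= r.+1 & r <= v.2.+1]%N ->
  left_flux x r (F e) =
    if k is 0%N then (b2z (r < (b (tgt e)).2)%N - b2z (r < (b (src e)).2)%N)%Z else 0%Z.
Proof.
move=> e_near r_n x_n /and4P[? ? ? ?].
have F0 i : (i <= n)%N -> ~~ displaced k v (i, r) -> F e (vedge m i r) = 0%R.
  move=> i_n; apply: contraNeq => /(proj2 b_far _ _ e_near).
  by rewrite /src epos_vedge.
case: (k) F0 => [|k'] F0; last by apply: left_flux_eq0 => i i_x; apply: F0; case: k' => [|[|]] /=; lia.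
by apply: (left_flux_all b_grid F_chain) => // i i_x; apply: F0 => /=; lia.
Qed.

Lemma left_count_near w x j : grid_near v w ->
  [&& v.1 <= x.+1, x <= v.1.+2, v.2 <= j.+1 & j <= v.2.+1]%N ->
  left_count x j (b w) = if k is 0%N then b2z ((b w).2 == j) else 0%Z.
Proof.
move=> /(proj1 b_far) + /and4P[? ? ? ?]; rewrite /left_count.
by case: (k) => [|[|[|k']]] /= ?; lia.
Qed.
End AtVertex.

Lemma right_crossing k i j : displaced_images k (i, j) -> (i < n)%N -> (j < n)%N ->
  (left_count i.+1 j (b (i, j)) - left_flux i.+1 j (F (vedge m i j)))%Z
  = crossing k (shifted_displacement (-1) (i, j) (b (i, j)))
      (shifted_displacement (-1) (i, j.+1) (b (i, j.+1))).
Proof.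
move=> b_far i_n j_n; have window : [&& i <= i.+2, i.+1 <= i.+2, j <= j.+1 & j <= j.+1]%N by lia.
have e_at : epos (vedge m i j) = (false, (i, j)) := epos_vedge (ltnW i_n) j_n.
have src_near : grid_near (i, j) (src (vedge m i j)) by rewrite /src e_at grid_near_refl.
rewrite (left_flux_near b_far src_near j_n (leqW i_n) window).
rewrite (left_count_near b_far (grid_near_refl _) window).
rewrite /crossing !upper_displacement_minus /src /tgt /tgt_at e_at /=.
by case: k b_far => [|k] _; lia.
Qed.

Lemma top_crossing k i j : displaced_images k (i.+1, j) -> (i < n)%N -> (j < n)%N ->
  left_flux i.+1 j (F (hedge m i j))
  = crossing k (shifted_displacement 1 (i.+1, j) (b (i.+1, j))) (shifted_displacement 1 (i, j) (b (i, j))).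
Proof.
move=> b_far i_n j_n; have window : [&& i.+1 <= i.+2, i.+1 <= i.+3, j <= j.+1 & j <= j.+1]%N by lia.
have e_at : epos (hedge m i j) = (true, (i, j)) := epos_hedge i_n (ltnW j_n).
have src_near : grid_near (i.+1, j) (src (hedge m i j)) by rewrite /src e_at /grid_near /=; lia.
rewrite (left_flux_near b_far src_near j_n (leqW i_n) window).
rewrite /crossing !upper_displacement_plus /src /tgt /tgt_at e_at /=.
by case: k b_far => [|k] _; lia.
Qed.

Lemma left_crossing k i j : displaced_images k (i, j.+1) -> (i < n)%N -> (j < n)%N ->
  (left_flux i j (F (vedge m i j)) - left_count i j.+1 (b (i, j.+1)))%Z
  = crossing k (shifted_displacement 1 (i, j.+1) (b (i, j.+1))) (shifted_displacement 1 (i, j) (b (i, j))).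
Proof.
move=> b_far i_n j_n.
have window : [&& i <= i.+1, i <= i.+2, j.+1 <= j.+1 & j <= j.+2]%N by lia.
have windowS : [&& i <= i.+1, i <= i.+2, j.+1 <= j.+2 & j.+1 <= j.+2]%N by lia.
have e_at : epos (vedge m i j) = (false, (i, j)) := epos_vedge (ltnW i_n) j_n.
have src_near : grid_near (i, j.+1) (src (vedge m i j)) by rewrite /src e_at /grid_near /=; lia.
rewrite (left_flux_near b_far src_near j_n (leqW (ltnW i_n)) window).
rewrite (left_count_near b_far (grid_near_refl _) windowS).
rewrite /crossing !upper_displacement_plus /src /tgt /tgt_at e_at /=.
by case: k b_far => [|k] _; lia.
Qed.

Lemma bottom_crossing k i j : displaced_images k (i, j) -> (i < n)%N -> (0 < j < n)%N ->
  (- left_flux i.+1 j.-1 (F (hedge m i j)))%Z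
  = crossing k (shifted_displacement (-1) (i, j) (b (i, j)))
      (shifted_displacement (-1) (i.+1, j) (b (i.+1, j))).
Proof.
move=> b_far i_n /andP[j0 j_n].
have window : [&& i <= i.+2, i.+1 <= i.+2, j <= j.-1.+1 & j.-1 <= j.+1]%N by lia.
have e_at : epos (hedge m i j) = (true, (i, j)) := epos_hedge i_n (ltnW j_n).
have src_near : grid_near (i, j) (src (hedge m i j)) by rewrite /src e_at grid_near_refl.
have j1_n : (j.-1 < n)%N by lia.
rewrite (left_flux_near b_far src_near j1_n (leqW i_n) window).
rewrite /crossing !upper_displacement_minus /src /tgt /tgt_at e_at /=.
by case: k b_far => [|k] _; lia.
Qed.

Lemma upper_corner_crossing k v : displaced_images k v ->
  left_count v.1.+1 v.2 (b v) = crossing k (shifted_displacement (-1) v (b v)) (shifted_displacement 1 v (b v)).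
Proof.
move=> b_far; rewrite (left_count_near b_far (grid_near_refl v)); last lia.
by rewrite /crossing upper_displacement_minus upper_displacement_plus; case: k b_far => [|k] _; lia.
Qed.

Lemma lower_corner_crossing k v : displaced_images k v ->
  (- left_count v.1 v.2 (b v))%Z = crossing k (shifted_displacement 1 v (b v)) (shifted_displacement (-1) v (b v)).
Proof.
move=> b_far; rewrite (left_count_near b_far (grid_near_refl v)); last lia.
by rewrite /crossing upper_displacement_minus upper_displacement_plus; case: k b_far => [|k] _; lia.
Qed.
End SideCrossings.

Definition grid_point (p : pt) (c : nat) (mesh : R) (v : nat * nat) : pt :=
  (p.1 + mesh * (INR v.1 - INR c), p.2 + mesh * (INR v.2 - INR c)).

Definition on_square_boundary (lo hi : nat) (v : nat * nat) : bool :=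
  [&& lo <= v.1 <= hi, lo <= v.2 <= hi & [|| v.1 == lo, v.1 == hi, v.2 == lo | v.2 == hi]]%N.

Section SquareBoundary.
Variable m : nat.
Local Notation n := m.+1.
Variables (b : nat * nat -> nat * nat) (F : edge m -> edge m -> Z).
Hypothesis b_grid : forall p, in_grid m p -> in_grid m (b p).
Hypothesis F_chain : forall (e : edge m) (w : vertex m),
  (\sum_e' F e e' * edge_bd e' w)%R = (b2z (vpos w == b (tgt e)) - b2z (vpos w == b (src e)))%Z.
Variables (p : pt) (c l : nat) (mesh : R) (G : pt -> pt).
Hypotheses (mesh_gt0 : 0 < mesh) (l_gt0 : (0 < l)%N) (l_lt : (l < c)%N) (cl_lt : (c + l < n)%N).
Let lo := (c - l)%N.
Let hi := (c + l)%N.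
Hypothesis boundary_displaced : forall v, on_square_boundary lo hi v -> exists k,
  [/\ (k < 4)%N, displaced_images b F k v &
      forall x, dsup x (grid_point p c mesh v) <= mesh -> 0 < axis k (psub x (G x))].
Let rho := INR l * mesh.
Let displacement t := psub (square_path p rho t) (G (square_path p rho t)).
Hypothesis displacement_cont : continuous_path displacement.

(* The path reaches the vertex number [i] of the side number [s] at this time. *)
Let vertex_time (s : R) (i : nat) : R := (s + (INR i - INR lo) / (2 * INR l)) / 4.

Let l_ge1 : 1 <= INR l. Proof. by apply: (le_INR 1); lia. Qed.
Let INR_lo : INR lo = INR c - INR l. Proof. by rewrite /lo minus_INR //; lia. Qed.
Let INR_hi : INR hi = INR c + INR l. Proof. by rewrite /hi plus_INR. Qed.
Let INR_rev i : (i <= hi)%N -> INR (lo + hi - i)%N = 2 * INR c - INR i.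
Proof.
move=> i_hi; have -> : (lo + hi - i = c + c - i)%N by rewrite /lo /hi; lia.
by rewrite minus_INR ?plus_INR; [lra | rewrite /hi in i_hi; lia].
Qed.

Let vertex_timeE s i : 2 * INR l * (4 * vertex_time s i - s) = INR i - INR lo.
Proof. by rewrite /vertex_time; field; lra. Qed.

Let vertex_time_lo s : vertex_time s lo = s / 4. Proof. by rewrite /vertex_time; field; lra. Qed.
Let vertex_time_hi s : vertex_time s hi = (s + 1) / 4.
Proof. by rewrite /vertex_time INR_lo INR_hi; field; lra. Qed.

Let vertex_time_le s i : vertex_time s i <= vertex_time s i.+1.
Proof. by have := vertex_timeE s i; have := vertex_timeE s i.+1; rewrite S_INR; nra. Qed.

Let vertex_time_between s i t : (lo <= i < hi)%N -> vertex_time s i <= t <= vertex_time s i.+1 ->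
  INR i - INR c <= INR l * (2 * (4 * t - s) - 1) <= INR i + 1 - INR c /\ s <= 4 * t <= s + 1.
Proof.
move=> /andP[/INR_leq lo_i /INR_leq i_hi] t_between.
have := vertex_timeE s i; have := vertex_timeE s i.+1; rewrite S_INR in i_hi *.
by rewrite INR_lo in lo_i *; move=> time_i time_iS; split; split; nra.
Qed.

Let near_vertex x y v : Rabs (x - (INR v.1 - INR c)) <= 1 -> Rabs (y - (INR v.2 - INR c)) <= 1 ->
  dsup (p.1 + mesh * x, p.2 + mesh * y) (grid_point p c mesh v) <= mesh.
Proof.
move=> x_near y_near; apply/dsup_le; split=> /=.
  have -> : p.1 + mesh * x - (p.1 + mesh * (INR v.1 - INR c)) = mesh * (x - (INR v.1 - INR c)) by ring.
  by rewrite Rabs_mult Rabs_pos_eq; nra.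
have -> : p.2 + mesh * y - (p.2 + mesh * (INR v.2 - INR c)) = mesh * (y - (INR v.2 - INR c)) by ring.
by rewrite Rabs_mult Rabs_pos_eq; nra.
Qed.

Let near_right i t : (lo <= i < hi)%N -> vertex_time 0 i <= t <= vertex_time 0 i.+1 ->
  dsup (square_path p rho t) (grid_point p c mesh (hi, i)) <= mesh.
Proof.
move=> i_side /(vertex_time_between i_side)[between side].
rewrite square_path_right; last lra.
have -> : (p.1 + rho, p.2 + rho * (2 * (4 * t - 0) - 1))
    = (p.1 + mesh * INR l, p.2 + mesh * (INR l * (2 * (4 * t - 0) - 1))).
  by rewrite /rho; congr pair; ring.
by apply: near_vertex => /=; rewrite ?INR_hi; split_Rabs; lra.
Qed.

Let near_top i t : (lo <= i < hi)%N -> vertex_time 1 i <= t <= vertex_time 1 i.+1 ->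
  dsup (square_path p rho t) (grid_point p c mesh (lo + hi - i, hi)%N) <= mesh.
Proof.
move=> i_side /(vertex_time_between i_side)[between side].
rewrite square_path_top; last lra.
have -> : (p.1 + rho * (1 - 2 * (4 * t - 1)), p.2 + rho)
    = (p.1 + mesh * (- (INR l * (2 * (4 * t - 1) - 1))), p.2 + mesh * INR l).
  by rewrite /rho; congr pair; ring.
have i_hi : (i <= hi)%N by lia.
by apply: near_vertex => /=; rewrite ?(INR_rev i_hi) ?INR_hi; split_Rabs; lra.
Qed.

Let near_left i t : (lo <= i < hi)%N -> vertex_time 2 i <= t <= vertex_time 2 i.+1 ->
  dsup (square_path p rho t) (grid_point p c mesh (lo, lo + hi - i)%N) <= mesh.
Proof.
move=> i_side /(vertex_time_between i_side)[between side].
rewrite square_path_left; last lra.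
have -> : (p.1 - rho, p.2 + rho * (1 - 2 * (4 * t - 2)))
    = (p.1 + mesh * - INR l, p.2 + mesh * (- (INR l * (2 * (4 * t - 2) - 1)))).
  by rewrite /rho; congr pair; ring.
have i_hi : (i <= hi)%N by lia.
by apply: near_vertex => /=; rewrite ?(INR_rev i_hi) ?INR_lo; split_Rabs; lra.
Qed.

Let near_bottom i t : (lo <= i < hi)%N -> vertex_time 3 i <= t <= vertex_time 3 i.+1 ->
  dsup (square_path p rho t) (grid_point p c mesh (i, lo)) <= mesh.
Proof.
move=> i_side /(vertex_time_between i_side)[between side].
rewrite square_path_bottom; last lra.
have -> : (p.1 + rho * (2 * (4 * t - 3) - 1), p.2 - rho)
    = (p.1 + mesh * (INR l * (2 * (4 * t - 3) - 1)), p.2 + mesh * - INR l).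
  by rewrite /rho; congr pair; ring.
by apply: near_vertex => /=; rewrite ?INR_lo; split_Rabs; lra.
Qed.

Let lo_hi : (lo < hi)%N. Proof. by rewrite /lo /hi; lia. Qed.
Let lo_gt0 : (0 < lo)%N. Proof. by rewrite /lo; lia. Qed.
Let hi_lt : (hi < n)%N. Proof. exact: cl_lt. Qed.
Let displacement_at (s : R) (v : nat * nat) : pt := shifted_displacement s v (b v).

Let turn_near v w s s' t t' z : on_square_boundary lo hi v -> grid_near v w -> is_sign s -> is_sign s' ->
  t <= t' -> (forall u, t <= u <= t' -> dsup (square_path p rho u) (grid_point p c mesh v) <= mesh) ->
  (forall k, displaced_images b F k v -> z = crossing k (displacement_at s v) (displacement_at s' w)) ->
  turn displacement t (displacement_at s v) t' (displacement_at s' w) z.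
Proof.
move=> /boundary_displaced[k [k4 b_far G_k]] vw s_sign s'_sign tt' near_v zE; rewrite (zE k b_far).
apply: turn_half_plane => //.
- exact: shifted_displacement_neq0.
- exact: shifted_displacement_neq0.
- exact: axis_shifted_displacement k4 s_sign (grid_near_refl v) (proj1 b_far _ (grid_near_refl v)).
- exact: axis_shifted_displacement k4 s'_sign vw (proj1 b_far _ vw).
- by move=> u /near_v; apply: G_k.
Qed.

Let turn_side s sg t t' (q : nat -> nat * nat) (z : nat -> Z) : 4 * t = s -> 4 * t' = s + 1 -> is_sign sg ->
  (forall i, (lo <= i < hi)%N -> on_square_boundary lo hi (q i) /\ grid_near (q i) (q i.+1)) ->
  (forall i t, (lo <= i < hi)%N -> vertex_time s i <= t <= vertex_time s i.+1 ->
     dsup (square_path p rho t) (grid_point p c mesh (q i)) <= mesh) ->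
  (forall i k, (lo <= i < hi)%N -> displaced_images b F k (q i) ->
     z i = crossing k (displacement_at sg (q i)) (displacement_at sg (q i.+1))) ->
  turn displacement t (displacement_at sg (q lo)) t' (displacement_at sg (q hi))
    (\sum_(lo <= i < hi) z i)%R.
Proof.
move=> ts t's sg_sign q_side near_q zE.
have -> : t = vertex_time s lo by rewrite vertex_time_lo; lra.
have -> : t' = vertex_time s hi by rewrite vertex_time_hi; lra.
have lo_side : (lo <= lo < hi)%N by rewrite leqnn.
apply: (@turn_seq _ (vertex_time s) (fun i => displacement_at sg (q i))); first exact: ltnW.
  have [/boundary_displaced[k [k4 b_far G_k]] _] := q_side lo lo_side.
  apply: (turn_refl displacement_cont k4); first exact: shifted_displacement_neq0.
    exact: axis_shifted_displacement k4 sg_sign (grid_near_refl _) (proj1 b_far _ (grid_near_refl _)).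
  by apply/G_k/near_q => //; split; [lra | exact: vertex_time_le].
move=> i i_side; have [q_boundary q_near] := q_side i i_side.
apply: turn_near => // [u|k b_far]; [exact: near_q | exact: zE].
Qed.

Let turn_right : turn displacement 0 (displacement_at (-1) (hi, lo)) (/ 4) (displacement_at 1 (hi, hi))
  (right_sum b F lo hi).
Proof.
have -> : right_sum b F lo hi = ((\sum_(lo <= j < hi)
    (left_count hi.+1 j (b (hi, j)) - left_flux hi.+1 j (F (vedge m hi j))))%R
    + left_count hi.+1 hi (b (hi, hi)))%Z.
  by rewrite /right_sum big_nat_recr 1?ltnW //= sumrB addrAC.
apply: (@turn_trans _ _ _ (/ 4) (displacement_at (-1) (hi, hi))).
  apply: (@turn_side 0 (-1) _ _ (fun j => (hi, j))); [lra | lra | by right | | |].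
  - by move=> j j_side; rewrite /on_square_boundary /grid_near /=; lia.
  - exact: near_right.
  - by move=> j k j_side b_far; apply: (right_crossing b_grid F_chain b_far); lia.
apply: turn_near; [by rewrite /on_square_boundary /=; lia | exact: grid_near_refl | by right | by left | lra | |].
  move=> u u_time; have -> : (hi, hi) = (lo + hi - lo, hi)%N by congr pair; lia.
  by apply: near_top; rewrite ?leqnn //; have := vertex_time_le 1 lo; rewrite vertex_time_lo; lra.
by move=> k; apply: (@upper_corner_crossing _ _ _ k (hi, hi)).
Qed.

Let turn_top : turn displacement (/ 4) (displacement_at 1 (hi, hi)) (/ 2) (displacement_at 1 (lo, hi))
  (top_sum F lo hi).
Proof.
rewrite /top_sum big_nat_rev /=.
have -> : (hi, hi) = (lo + hi - lo, hi)%N by congr pair; lia.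
have -> : (lo, hi) = (lo + hi - hi, hi)%N by congr pair; lia.
apply: (@turn_side 1 1 _ _ (fun i => (lo + hi - i, hi)%N)); [lra | lra | by left | | |].
- by move=> i i_side; rewrite /on_square_boundary /grid_near /=; lia.
- exact: near_top.
- move=> i k i_side; have -> : (lo + hi - i = (lo + hi - i.+1).+1)%N by lia.
  by move=> b_far; apply: (top_crossing b_grid F_chain b_far); lia.
Qed.

Let turn_left : turn displacement (/ 2) (displacement_at 1 (lo, hi)) (3 / 4) (displacement_at (-1) (lo, lo))
  (left_sum b F lo hi).
Proof.
pose z i := (left_flux lo i (F (vedge m lo i)) - left_count lo i.+1 (b (lo, i.+1)))%Z.
have -> : left_sum b F lo hi =
    ((\sum_(lo <= i < hi) z (lo + hi - i.+1)%N)%R + - left_count lo lo (b (lo, lo)))%Z.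
  rewrite /left_sum -(big_nat_rev _ _ _ _ xpredT z) sumrB.
  rewrite (@big_nat_recl _ _ _ hi lo (fun j => left_count lo j (b (lo, j)))) ?opprD; last exact: ltnW.
  by rewrite addrCA addrC.
apply: (@turn_trans _ _ _ (3 / 4) (displacement_at 1 (lo, lo))).
  have -> : (lo, hi) = (lo, lo + hi - lo)%N by congr pair; lia.
  have -> : (lo, lo) = (lo, lo + hi - hi)%N by congr pair; lia.
  apply: (@turn_side 2 1 _ _ (fun i => (lo, lo + hi - i)%N)); [lra | lra | by left | | |].
  - by move=> i i_side; rewrite /on_square_boundary /grid_near /=; lia.
  - exact: near_left.
  - move=> i k i_side; have -> : (lo + hi - i = (lo + hi - i.+1).+1)%N by lia.
    by move=> b_far; apply: (left_crossing b_grid F_chain b_far); lia.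
apply: turn_near; [by rewrite /on_square_boundary /=; lia | exact: grid_near_refl | by left | by right | lra | |].
  move=> u u_time; apply: near_bottom; rewrite ?leqnn //.
  by have := vertex_time_le 3 lo; rewrite vertex_time_lo; lra.
by move=> k; apply: (@lower_corner_crossing _ _ _ k (lo, lo)).
Qed.

Let turn_bottom : turn displacement (3 / 4) (displacement_at (-1) (lo, lo)) 1 (displacement_at (-1) (hi, lo))
  (bottom_sum F lo hi).
Proof.
rewrite /bottom_sum -sumrN.
apply: (@turn_side 3 (-1) _ _ (fun i => (i, lo))); [lra | lra | by right | | |].
- by move=> i i_side; rewrite /on_square_boundary /grid_near /=; lia.
- exact: near_bottom.
- by move=> i k i_side b_far; apply: (bottom_crossing b_grid F_chain b_far); lia.
Qed.

Lemma winding_number_square_boundary : (forall t, 0 <= t <= 1 -> displacement t <> (0, 0)) ->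
  winding_number displacement
    (right_sum b F lo hi + top_sum F lo hi + left_sum b F lo hi + bottom_sum F lo hi)%R.
Proof.
move=> displacement_nz; apply: (winding_number_of_turn displacement_cont _ displacement_nz).
  by rewrite /displacement square_path_closed.
exact: turn_trans (turn_trans (turn_trans turn_right turn_top) turn_left) turn_bottom.
Qed.
End SquareBoundary.

Local Open Scope ring_scope.

(** * Discretization of a planar map *)

(* [y] lies in the bounding box of the images of the corners of the cell based at [x]. *)
Definition box_step (a : nat * nat -> nat * nat) (x y : nat * nat) : Prop :=
  exists w1 w2 w3 w4, [&& corner x w1, corner x w2, corner x w3 & corner x w4] /\
    [&& (a w1).1 <= y.1, y.1 <= (a w2).1, (a w3).2 <= y.2 & y.2 <= (a w4).2]%N.

Definition box_walk (a : nat * nat -> nat * nat) N (x : nat -> nat * nat) : Prop :=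
  forall t, (t < N)%N -> box_step a (x t) (x t.+1).

Lemma corner_refl x : corner x x. Proof. by rewrite /corner !leqnn !leqnSn. Qed.

Lemma box_step_image a x : box_step a x (a x).
Proof. by exists x, x, x, x; rewrite !corner_refl /= !leqnn. Qed.

Lemma box_walk_iter a N x : box_walk a N (fun t => iter t a x).
Proof. by move=> t _; apply: box_step_image. Qed.

Section BoxSteps.
Variables (m : nat) (a : nat * nat -> nat * nat).
Hypothesis a_grid : forall p, in_grid m p -> in_grid m (a p).

Lemma box_step_vertex v w :
  vertex_mx m a (enum_rank v) (enum_rank w) != 0 -> box_step a (vpos v) (vpos w).
Proof.
rewrite -[vertex_mx m a]expr1 vertex_mx_exp //=.
by case: (vpos w =P a (vpos v)) => [-> _|//]; apply: box_step_image.
Qed.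

Lemma box_step_edge e e' : edge_mx m a (enum_rank e) (enum_rank e') != 0 -> box_step a (src e) (src e').
Proof.
have [cs ct] : corner (src e) (src e) /\ corner (src e) (tgt e).
  by rewrite corner_refl; split=> //; case: e => -[[i hi] [j hj]]; rewrite /corner /src /tgt /=; lia.
rewrite kernel_mxE /edge_map /path_chain /src; case: (epos e') => -[] [k l] /=; rewrite -/(src e).
  case E1 : (_ && _); first by move=> _; exists (src e), (tgt e), (src e), (src e); rewrite cs ct /=; lia.
  case E2 : (_ && _); first by move=> _; exists (tgt e), (src e), (src e), (src e); rewrite cs ct /=; lia.
  by [].
case E1 : (_ && _); first by move=> _; exists (tgt e), (tgt e), (src e), (tgt e); rewrite cs ct /=; lia.
case E2 : (_ && _); first by move=> _; exists (tgt e), (tgt e), (tgt e), (src e); rewrite cs ct /=; lia.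
by [].
Qed.

Lemma left_flux_path_chain p q k l : (k < m.+1)%N -> (l < m.+1)%N -> in_grid m q ->
  left_flux k.+1 l (fun e' : edge m => path_chain p q (epos e')) =
  if (q.1 <= k)%N then b2z (l < q.2)%N - b2z (l < p.2)%N else 0.
Proof.
move=> k_m l_m /andP[q1 q2]; rewrite /left_flux.
transitivity (\sum_(i < k.+1) b2z (i == q.1 :> nat) * (b2z (l < q.2)%N - b2z (l < p.2)%N)).
  rewrite big_mkord; apply: eq_bigr => -[i i_k] _; rewrite epos_vedge //=; last by lia.
  rewrite /path_chain /=; case: (i == q.1) => /=; last by rewrite mul0r.
  rewrite mul1r; lia.
by rewrite (sum_delta k.+1 q.1 (fun _ => b2z (l < q.2)%N - b2z (l < p.2)%N)) ltnS.
Qed.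

Let edge_flux (k l : nat) (src_image tgt_image : nat * nat) : Z :=
  if (tgt_image.1 <= k)%N then b2z (l < tgt_image.2)%N - b2z (l < src_image.2)%N else 0.

Lemma face_mxE i j s s' : fpos s = (i, j) -> face_mx m a (enum_rank s) (enum_rank s') =
  let flux := edge_flux (fpos s').1 (fpos s').2 in
  flux (a (i, j.+1)) (a (i.+1, j.+1)) - flux (a (i, j)) (a (i.+1, j))
  - flux (a (i.+1, j)) (a (i.+1, j.+1)) + flux (a (i, j)) (a (i, j.+1)).
Proof.
move=> s_ij; have [s'1 s'2] := fpos_lt s'.
pose flux r := - edge_flux (fpos s').1 (fpos s').2 (a (src_at r)) (a (tgt_at r)).
transitivity (\sum_e face_bd s e * flux (epos e)).
  rewrite face_map_coef; apply: eq_bigr => e _; congr (_ * - _).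
  rewrite /edge_flux -/(tgt e) -/(src e) -(left_flux_path_chain _ s'1 s'2 (a_grid (in_grid_tgt e))).
  by apply: eq_bigr => i' _; rewrite kernel_mxE.
by rewrite sum_face_bd /flux s_ij /tgt_at /src_at /=; lia.
Qed.

Lemma box_step_face s s' :
  face_mx m a (enum_rank s) (enum_rank s') != 0 -> box_step a (fpos s) (fpos s').
Proof.
case sE: (fpos s) => [i j]; rewrite (face_mxE _ sE) /edge_flux /= => nz.
have corner_with (P : pred (nat * nat)) :
    P (a (i, j)) || P (a (i.+1, j)) || P (a (i, j.+1)) || P (a (i.+1, j.+1)) ->
    exists2 w, corner (i, j) w & P (a w).
  by case/orP=> [/orP[/orP[]|]|] Pw;
    [exists (i, j) | exists (i.+1, j) | exists (i, j.+1) | exists (i.+1, j.+1)];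
    rewrite // /corner /= !leqnn ?leqnSn.
have [w1 c1 P1] : exists2 w, corner (i, j) w & ((a w).1 <= s'.1)%N.
  by apply: (corner_with (fun c => c.1 <= s'.1)%N); apply: contraNT nz => /=; repeat (case: ifP => ?); lia.
have [w2 c2 P2] : exists2 w, corner (i, j) w & (s'.1 <= (a w).1)%N.
  by apply: (corner_with (fun c => s'.1 <= c.1)%N); apply: contraNT nz => /=; repeat (case: ifP => ?); lia.
have [w3 c3 P3] : exists2 w, corner (i, j) w & ((a w).2 <= s'.2)%N.
  by apply: (corner_with (fun c => c.2 <= s'.2)%N); apply: contraNT nz => /=; repeat (case: ifP => ?); lia.
have [w4 c4 P4] : exists2 w, corner (i, j) w & (s'.2 <= (a w).2)%N.
  by apply: (corner_with (fun c => s'.2 <= c.2)%N); apply: contraNT nz => /=; repeat (case: ifP => ?); lia.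
by exists w1, w2, w3, w4; rewrite c1 c2 c3 c4 P1 P2 P3 P4.
Qed.

Lemma box_walk_edge_exp N (e e' : edge m) : iter_edge_map a N e e' != 0 ->
  exists x, [/\ x 0%N = src e, x N = src e' & box_walk a N x].
Proof.
move=> /exp_walk[w [w0 wN w_walk]]; exists (fun t => src (enum_val (w t))).
split; [by rewrite w0 enum_rankK | by rewrite wN enum_rankK |] => t /w_walk.
by rewrite -[w t]enum_valK -[w t.+1]enum_valK !enum_rankK; apply: box_step_edge.
Qed.
End BoxSteps.

Local Close Scope ring_scope.

Definition nfloor (x : R) : nat := Z.to_nat (Int_part x).

Lemma nfloor_spec x : 0 <= x -> INR (nfloor x) <= x < INR (nfloor x) + 1.
Proof.
move=> x0; have [floor_le floor_gt] := base_Int_part x.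
have floor_ge0 : (0 <= Int_part x)%Z.
  have : (-1 < Int_part x)%Z by apply: lt_IZR; lra.
  by lia.
by rewrite /nfloor INR_IZR_INZ Z2Nat.id //; lra.
Qed.

Lemma INR_gt0 h : (0 < h)%N -> 0 < INR h.
Proof. by move=> h0; apply: lt_0_INR; lia. Qed.

Section Mesh.
Variables (g : pt -> pt) (p : pt) (s : R).
Hypothesis s_gt0 : 0 < s.

(* The square of radius [s] about [p] is cut into cells of side [s / INR h]. *)
Definition mesh_point (h : nat) (v : nat * nat) : pt := grid_point p h (s / INR h) v.
Definition mesh_index (h : nat) (q z : R) : nat := nfloor (clamp 0 (2 * INR h) ((z - q) / (s / INR h) + INR h)).
Definition discretize (h : nat) (v : nat * nat) : nat * nat :=
  (mesh_index h p.1 (g (mesh_point h v)).1, mesh_index h p.2 (g (mesh_point h v)).2).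
Definition mesh_size (h : nat) : nat := (h + h).-1.

Lemma mesh_gt0 h : (0 < h)%N -> 0 < s / INR h.
Proof. by move=> /INR_gt0 h0; apply: Rdiv_lt_0_compat. Qed.

Lemma mesh_sizeS h : (0 < h)%N -> (mesh_size h).+1 = (h + h)%N.
Proof. by rewrite /mesh_size => h0; rewrite prednK // addn_gt0 h0. Qed.

Lemma mesh_index_floor h q z : let x := clamp 0 (2 * INR h) ((z - q) / (s / INR h) + INR h) in
  0 <= x <= 2 * INR h /\ INR (mesh_index h q z) <= x < INR (mesh_index h q z) + 1.
Proof.
have h0 := pos_INR h; have bounds := clamp_bounds ((z - q) / (s / INR h) + INR h) (ltac:(lra) : 0 <= 2 * INR h).
by split=> //; apply: nfloor_spec (proj1 bounds).
Qed.

Lemma discretize_grid h v : (0 < h)%N -> in_grid (mesh_size h) (discretize h v).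
Proof.
move=> h0; have index_le q z : (mesh_index h q z <= h + h)%N.
  have [bounds floor] := mesh_index_floor h q z.
  have /INR_le : INR (mesh_index h q z) <= INR (h + h) by rewrite plus_INR; lra.
  by lia.
by rewrite /in_grid mesh_sizeS // !index_le.
Qed.

Lemma mesh_index_near h q z z0 e : (0 < h)%N -> Rabs (z0 - q) <= s -> Rabs (z - z0) <= e ->
  Rabs (q + s / INR h * (INR (mesh_index h q z) - INR h) - z0) <= e + s / INR h.
Proof.
move=> h_gt0 z0_in z_near; have h0 := INR_gt0 h_gt0; have mesh0 := mesh_gt0 h_gt0.
have [_ floor] := mesh_index_floor h q z; move: floor.
set mesh := s / INR h in mesh0 *; set k := INR (mesh_index h q z).
have h_mesh : INR h * mesh = s by rewrite /mesh; field; lra.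
set x := (z - q) / mesh + INR h; set x0 := (z0 - q) / mesh + INR h => floor.
have x0E : mesh * (x0 - INR h) = z0 - q by rewrite /x0; field; lra.
have xE : mesh * (x - x0) = z - z0 by rewrite /x /x0; field; lra.
have x0_bounds : 0 <= x0 <= 2 * INR h by split_Rabs; split; nra.
have clamp_near : Rabs (clamp 0 (2 * INR h) x - x0) <= Rabs (x - x0).
  by rewrite /clamp /Rmax /Rmin; repeat destruct Rle_dec; split_Rabs; lra.
have -> : q + mesh * (k - INR h) - z0 = mesh * (k - x0) by lra.
rewrite Rabs_mult (Rabs_pos_eq mesh); last lra.
have : mesh * Rabs (x - x0) <= e by move: z_near; rewrite -xE Rabs_mult (Rabs_pos_eq mesh); lra.
have : Rabs (k - x0) <= Rabs (x - x0) + 1 by split_Rabs; lra.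
by nra.
Qed.

Lemma mesh_point_near h v w : (0 < h)%N -> grid_near v w ->
  dsup (mesh_point h w) (mesh_point h v) <= s / INR h.
Proof.
move=> h0 /and4P[/INR_leq n1 /INR_leq n2 /INR_leq n3 /INR_leq n4].
rewrite !S_INR in n1 n2 n3 n4; have mesh0 := mesh_gt0 h0.
by apply/dsup_le; rewrite /mesh_point /grid_point /=; split; apply: Rabs_le; nra.
Qed.

Lemma grid_near_corner x w : corner x w -> grid_near x w.
Proof. by rewrite /corner /grid_near; lia. Qed.

Lemma box_step_near h x y z e : (0 < h)%N -> dsup z p <= s -> box_step (discretize h) x y ->
  (forall w, dsup w (mesh_point h x) <= s / INR h -> dsup (g w) z <= e) ->
  dsup (mesh_point h y) z <= e + s / INR h.
Proof.
move=> h0 /dsup_le[z1 z2] [w1 [w2 [w3 [w4 [/and4P[c1 c2 c3 c4]]]]]].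
move=> /and4P[/INR_leq y1 /INR_leq y2 /INR_leq y3 /INR_leq y4] g_near.
have mesh0 := mesh_gt0 h0; rewrite Rabs_minus_sym in z1; rewrite Rabs_minus_sym in z2.
have image_near w : corner x w ->
    Rabs ((mesh_point h (discretize h w)).1 - z.1) <= e + s / INR h /\
    Rabs ((mesh_point h (discretize h w)).2 - z.2) <= e + s / INR h.
  move=> /grid_near_corner/(mesh_point_near h0)/g_near/dsup_le[n1 n2].
  by split; apply: mesh_index_near => //; rewrite Rabs_minus_sym.
have [a1 _] := image_near _ c1; have [a2 _] := image_near _ c2.
have [_ a3] := image_near _ c3; have [_ a4] := image_near _ c4.
have monotone u v : u <= v -> s / INR h * (u - INR h) <= s / INR h * (v - INR h) by move=> ?; nra.
move: (monotone _ _ y1) (monotone _ _ y2) (monotone _ _ y3) (monotone _ _ y4).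
move: a1 a2 a3 a4; rewrite /mesh_point /grid_point /= => a1 a2 a3 a4 m1 m2 m3 m4.
by apply/dsup_le; split=> /=; split_Rabs; lra.
Qed.

Lemma vanishing_mesh sg : increasing_seq sg -> vanishing (fun n => s / INR (sg n)).
Proof.
move=> sg_inc d d0.
have [N small] := vanishing_scale s_gt0 vanishing_inv_INR d0.
exists N.+1 => n N_n; have n_sg := increasing_seq_ge n sg_inc.
have := small (sg n).-1; rewrite prednK; last lia.
by apply; lia.
Qed.

Section WalkLimit.
Variable sg : nat -> nat.
Hypothesis sg_inc : increasing_seq sg.

Lemma box_step_converges (x y : nat -> nat * nat) X :
  (forall n, box_step (discretize (sg n)) (x n) (y n)) ->
  converges (fun n => mesh_point (sg n) (x n)) X -> continuous_at g X -> dsup (g X) p <= s ->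
  converges (fun n => mesh_point (sg n) (y n)) (g X).
Proof.
move=> steps xX g_cont gX e e0; have [d [d0 g_near]] := g_cont (e / 2) ltac:(lra).
have mesh_small := vanishing_mesh sg_inc.
apply: eventually_imp (eventually_and (eventually_and (xX (d / 2) ltac:(lra)) (eventually_ge 1))
  (eventually_and (mesh_small (d / 2) ltac:(lra)) (mesh_small (e / 2) ltac:(lra)))) => n.
move=> [[x_near n1] [mesh_d mesh_e]].
have sg_gt0 : (0 < sg n)%N by have := increasing_seq_ge n sg_inc; lia.
apply: Rle_lt_trans (box_step_near (e := e / 2) sg_gt0 gX (steps n) _) _; last lra.
move=> w w_near; rewrite dsup_sym; left; apply: g_near.
by have := dsup_triangle w (mesh_point (sg n) (x n)) X; rewrite (dsup_sym X); lra.
Qed.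

Lemma box_walk_converges N (x : nat -> nat -> nat * nat) X :
  (forall n, box_walk (discretize (sg n)) N (x n)) ->
  converges (fun n => mesh_point (sg n) (x n 0%N)) X ->
  (forall t, (t <= N)%N -> continuous_at g (fiter g t X) /\ dsup (fiter g t X) p <= s) ->
  forall t, (t <= N)%N -> converges (fun n => mesh_point (sg n) (x n t)) (fiter g t X).
Proof.
move=> walks x0X X_orbit; elim=> [|t IH] t_N //.
apply: (@box_step_converges (fun n => x n t)); first by move=> n; apply: walks.
- exact: IH (ltnW t_N).
- by have [] := X_orbit t (ltnW t_N).
- by have [] := X_orbit t.+1 t_N.
Qed.
End WalkLimit.

Definition orbits_within (r : R) (N : nat) : Prop := forall x, dsup x p <= r -> forall t, (t <= N)%N ->
  continuous_at g (fiter g t x) /\ dsup (fiter g t x) p <= s.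

Lemma orbits_within_continuous r N x : orbits_within r N -> dsup x p <= r ->
  forall t, (t <= N)%N -> continuous_at (fiter g t) x.
Proof.
by move=> orbits x_in t tN; apply: continuous_at_fiter => i it; have [] := orbits x x_in i ltac:(lia).
Qed.

Lemma eventually_box_walk_near N r e : 0 < e -> orbits_within r N ->
  eventually (fun h => forall x : nat -> nat * nat,
    box_walk (discretize h) N x /\ dsup (mesh_point h (x 0%N)) p <= r ->
    forall t, (t <= N)%N -> dsup (mesh_point h (x t)) (fiter g t (mesh_point h (x 0%N))) <= e).
Proof.
move=> e0 orbits; apply: eventually_forall => sg x sg_inc walks.
have [sg' [X [sg'_inc x0X X_in]]] := bounded_subseq (fun n => proj2 (walks n)).
have walk_cv := box_walk_converges (increasing_seq_comp sg_inc sg'_inc)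
  (fun n => proj1 (walks (sg' n))) x0X (orbits X X_in).
have [n near] : exists n, forall t, (t < N.+1)%N -> dsup (mesh_point (sg (sg' n)) (x (sg' n) t))
    (fiter g t (mesh_point (sg (sg' n)) (x (sg' n) 0%N))) < e.
  apply/eventually_exists/eventually_below => t tN.
  have fiter_cv := continuous_at_converges (orbits_within_continuous orbits X_in tN) x0X.
  apply: eventually_imp (eventually_and (walk_cv t tN (e / 2) ltac:(lra)) (fiter_cv (e / 2) ltac:(lra))).
  move=> n [x_near f_near]; apply: Rle_lt_trans (dsup_triangle _ (fiter g t X) _) _.
  by rewrite (dsup_sym (fiter g t X)) /= in f_near x_near *; lra.
by exists (sg' n) => t tN; left; apply: near.
Qed.
End Mesh.

(** * The fixed point index as a local trace *)

Lemma displaced_of_axis p s h k v y z e : 0 < s -> (0 < h)%N -> (k < 4)%N -> s / INR h <= e ->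
  10 * e <= axis k (psub (mesh_point p s h v) z) -> dsup (mesh_point p s h y) z <= 3 * e ->
  displaced k v y.
Proof.
move=> s0 h0 k4 mesh_e v_far /dsup_le[y1 y2]; have mesh_gt0 := mesh_gt0 s0 h0.
move: mesh_e v_far y1 y2; rewrite /mesh_point /grid_point; set mesh := s / INR h in mesh_gt0 * => /=.
have index_gap (i j : nat) : 7 * mesh <= mesh * (INR i - INR j) -> (j + 2 <= i)%N.
  move=> gap; suff /INR_le : INR (j + 2) <= INR i by lia.
  by rewrite plus_INR /=; nra.
move=> mesh_e v_far y1 y2.
by case: k k4 v_far => [|[|[|[|//]]]] _ /= v_far; apply: index_gap; split_Rabs; lra.
Qed.

Definition square_radius (r s : R) (h : nat) : nat := nfloor (r * INR h / s).

Definition discrete_trace g p s h N r : Z :=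
  local_trace (mesh_size h) (discretize g p s h) N (h - square_radius r s h)%N (h + square_radius r s h)%N.

Lemma square_radius_bounds r s h : 0 < s -> (0 < h)%N -> 0 <= r ->
  INR (square_radius r s h) * (s / INR h) <= r < (INR (square_radius r s h) + 1) * (s / INR h).
Proof.
move=> s0 h0 r0; have mesh0 := mesh_gt0 s0 h0; have h_gt0 := INR_gt0 h0.
have rE : r * INR h / s * (s / INR h) = r by field; lra.
have : INR (square_radius r s h) <= r * INR h / s < INR (square_radius r s h) + 1.
  by apply/nfloor_spec/Rle_mult_inv_pos => //; nra.
by move: rE; set q := r * INR h / s => rE floor; split; nra.
Qed.

Lemma square_radius_lt r s h : 0 < s -> (0 < h)%N -> 0 <= r < s -> (square_radius r s h < h)%N.
Proof.
move=> s0 h0 [r0 r_s]; have mesh0 := mesh_gt0 s0 h0; have h_gt0 := INR_gt0 h0.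
have := square_radius_bounds s0 h0 r0; have h_mesh : INR h * (s / INR h) = s by field; lra.
set l := square_radius r s h => -[l_r _]; have /INR_lt : INR l < INR h by nra.
by lia.
Qed.

Lemma dsup_square_boundary p s h l v : 0 < s -> (0 < h)%N -> (l < h)%N ->
  on_square_boundary (h - l) (h + l) v -> dsup (mesh_point p s h v) p = INR l * (s / INR h).
Proof.
move=> s0 h0 lh /and3P[/andP[/INR_leq a1 /INR_leq a2] /andP[/INR_leq a3 /INR_leq a4] side].
have mesh0 := mesh_gt0 s0 h0; rewrite !minus_INR ?plus_INR in a1 a2 a3 a4; try lia.
move: a1 a2 a3 a4; rewrite /mesh_point /grid_point; set mesh := s / INR h in mesh0 * => a1 a2 a3 a4.
apply: Rle_antisym; first by apply/dsup_le; split=> /=; apply: Rabs_le; nra.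
have l0 := pos_INR l; apply: Rnot_lt_le => /dsup_lt /= [d1 d2].
by case/or4P: side => /eqP vE; rewrite vE ?minus_INR ?plus_INR in d1 d2; try lia; split_Rabs; nra.
Qed.

Section IndexTrace.
Variables (g : pt -> pt) (p : pt) (s r : R) (N : nat).
Hypotheses (s_gt0 : 0 < s) (r_gt0 : 0 < r) (r_s : 2 * r < s).
Hypothesis orbits : orbits_within g p s (2 * r) N.
Hypothesis only_fixed : forall x, dsup x p <= 2 * r -> fiter g N x = x -> x = p.
Let G := fiter g N.

Lemma iterate_moves x : r / 4 <= dsup x p <= 2 * r -> continuous_at G x /\ G x <> x.
Proof.
move=> [x_off x_in]; split; first exact: orbits_within_continuous orbits x_in _ (leqnn N).
by move=> /(only_fixed x_in) xp; rewrite xp dsup_refl in x_off; lra.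
Qed.

Section AtScale.
Variables (h : nat) (e : R).
Hypothesis h_gt0 : (0 < h)%N.
Hypotheses (mesh_e : s / INR h <= e) (e_r : e <= r / 8).
Hypothesis G_moves : forall x, r / 4 <= dsup x p <= 2 * r -> 10 * e <= dsup x (G x).
Hypothesis G_near : forall x y, dsup x p <= 2 * r -> dsup x y <= s / INR h -> dsup (G x) (G y) <= e.
Hypothesis walk_near : forall x, box_walk (discretize g p s h) N x /\ dsup (mesh_point p s h (x 0%N)) p <= 2 * r ->
  forall t, (t <= N)%N -> dsup (mesh_point p s h (x t)) (fiter g t (mesh_point p s h (x 0%N))) <= e.
Let mesh := s / INR h.
Let l := square_radius r s h.
Let a := discretize g p s h.
Let position := mesh_point p s h.

Let mesh_pos : 0 < mesh. Proof. exact: mesh_gt0. Qed.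

Let l_bounds : r / 2 <= INR l * mesh <= r.
Proof.
have := square_radius_bounds s_gt0 h_gt0 (Rlt_le _ _ r_gt0); rewrite -/l -/mesh.
by have := mesh_e; rewrite -/mesh; lra.
Qed.

Let l_lt_h : (l < h)%N.
Proof. by apply: square_radius_lt => //; lra. Qed.

Let l_gt0 : (0 < l)%N.
Proof. by rewrite lt0n; apply/eqP => l0; have := l_bounds; rewrite l0 /=; lra. Qed.

Let near_boundary_in v w : on_square_boundary (h - l) (h + l) v -> grid_near v w ->
  dsup (position w) p <= 2 * r.
Proof.
move=> v_bd /(mesh_point_near p s_gt0 h_gt0) vw.
have := dsup_square_boundary p s_gt0 h_gt0 l_lt_h v_bd.
have := dsup_triangle (position w) (position v) p; have := l_bounds; have := mesh_e.
by rewrite -/mesh /position in vw *; lra.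
Qed.

Let boundary_displaced v : on_square_boundary (h - l) (h + l) v -> exists k,
  [/\ (k < 4)%N, displaced_images (iter N a) (iter_edge_map a N : edge (mesh_size h) -> _) k v &
      forall x, dsup x (grid_point p h mesh v) <= mesh -> 0 < axis k (psub x (G x))].
Proof.
move=> v_bd; have v_in := near_boundary_in v_bd (grid_near_refl v).
have v_sup := dsup_square_boundary p s_gt0 h_gt0 l_lt_h v_bd; rewrite -/mesh in v_sup.
have := G_moves (x := position v); rewrite [dsup _ p]v_sup => /(_ ltac:(lra)) v_moves.
have [k k4 kE] := axis_ge_Rmax (psub (position v) (G (position v))).
have {kE}v_far : 10 * e <= axis k (psub (position v) (G (position v))) by rewrite kE.
have G_near_v x : dsup x (position v) <= mesh -> dsup (G x) (G (position v)) <= e.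
  by move=> xv; rewrite dsup_sym; apply: G_near => //; rewrite dsup_sym.
have walk_displaced x : grid_near v (x 0%N) -> box_walk a N x -> displaced k v (x N).
  move=> near_x0 walk; apply: (displaced_of_axis s_gt0 h_gt0 k4 mesh_e v_far).
  have := walk_near (conj walk (near_boundary_in v_bd near_x0)) (leqnn N).
  have := G_near_v _ (mesh_point_near p s_gt0 h_gt0 near_x0).
  have := dsup_triangle (position (x N)) (G (position (x 0%N))) (G (position v)).
  by have := mesh_e; have := mesh_pos; rewrite /position /G /mesh; lra.
exists k; split=> //.
  split=> [w vw|ed ed' v_ed /box_walk_edge_exp[x [x0 xN walk]]].
    exact: (walk_displaced (fun t => iter t a w) vw (@box_walk_iter a N w)).
  by rewrite -xN; apply: walk_displaced; rewrite ?x0.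
move=> x xv; have /dsup_le[x1 x2] := xv; have /dsup_le[g1 g2] := G_near_v x xv.
have := @axis_lipschitz k (psub x (G x)) (psub (position v) (G (position v))) (2 * e).
rewrite /= in x1 x2 g1 g2 *; have := mesh_e; have := mesh_pos; rewrite -/mesh => mesh0 mesh_le.
move=> /(_ ltac:(split_Rabs; lra) ltac:(split_Rabs; lra)).
by lra.
Qed.

Lemma winding_number_discrete_trace :
  winding_number (fun t => psub (circ p r t) (G (circ p r t))) (discrete_trace g p s h N r).
Proof.
have sizeE := mesh_sizeS h_gt0.
have a_grid v : in_grid (mesh_size h) v -> in_grid (mesh_size h) (a v) by move=> _; apply: discretize_grid.
have iter_grid v : in_grid (mesh_size h) v -> in_grid (mesh_size h) (iter N a v).
  by move=> v_in; elim: (N) => //= k; apply: a_grid.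
have annulus t : 0 <= t <= 1 -> r / 4 <= dsup (square_path p (INR l * mesh) t) p <= 2 * r.
  by move=> t01; rewrite dsup_square_path //; have := l_bounds; lra.
rewrite /discrete_trace -/l local_trace_boundary //; first last; try by rewrite ?sizeE; lia.
apply: (winding_number_square_circ (rho := INR l * mesh) r_gt0 l_bounds).
  by move=> x x_in; apply: iterate_moves; lra.
apply: (winding_number_square_boundary iter_grid (iter_edge_map_chain a_grid N) mesh_pos l_gt0 l_lt_h) => //.
- by rewrite sizeE; lia.
- apply: continuous_path_psub; first exact: continuous_path_square.
  apply: continuous_path_comp; first exact: continuous_path_square.
  move=> t; rewrite square_path_clamp.
  by have /annulus/iterate_moves[] := clamp_bounds t (ltac:(lra) : 0 <= 1).
- by move=> t /annulus/iterate_moves[_ moves] /psub_eq0 /esym.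
Qed.
End AtScale.

Lemma eventually_winding_discrete_trace : eventually (fun h => (0 < h)%N /\
  winding_number (fun t => psub (circ p r t) (G (circ p r t))) (discrete_trace g p s h N r)).
Proof.
have [e0 [e0_gt0 G_moves]] := displacement_lower_bound iterate_moves.
pose e := Rmin (e0 / 10) (r / 8).
have e_gt0 : 0 < e by apply: Rmin_glb_lt; lra.
have e_e0 : e <= e0 / 10 := Rmin_l _ _; have e_r : e <= r / 8 := Rmin_r _ _.
have [d [d_gt0 G_near]] :=
  uniform_continuity (fun x x_in => orbits_within_continuous orbits x_in (leqnn N)) e_gt0.
have mesh_small := vanishing_mesh s_gt0 increasing_seq_id.
have walk_near := eventually_box_walk_near s_gt0 e_gt0 orbits.
apply: eventually_imp (eventually_and (eventually_and walk_near (eventually_ge 1))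
  (eventually_and (mesh_small d d_gt0) (mesh_small e e_gt0))) => h [[walks h_gt0] [mesh_d mesh_e]].
split=> //; apply: winding_number_discrete_trace walks => //; first exact: Rlt_le.
- by move=> x /G_moves; lra.
- by move=> x y x_in xy; left; apply: G_near => //; rewrite /= in mesh_d; lra.
Qed.
End IndexTrace.

Section LocalTrace.
Variables (m : nat) (a : nat * nat -> nat * nat) (N lo hi : nat).
Hypothesis a_grid : forall p, in_grid m p -> in_grid m (a p).
Variables (near inside : nat * nat -> Prop).
Variables (AV : pred (vertex m)) (AE : pred (edge m)) (AS : pred (face m)).
Hypothesis near_of_start : forall x, box_walk a N.+1 x -> x N.+1 = x 0%N ->
  in_square lo hi (x 0%N) -> forall t, (t <= N.+1)%N -> near (x t).
Hypothesis near_of_inside : forall x, box_walk a N.+1 x -> x N.+1 = x 0%N ->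
  (forall t, (t <= N.+1)%N -> inside (x t)) -> near (x 0%N).
Hypothesis near_vertex : forall v, near (vpos v) -> AV v && vertex_in_square lo hi v.
Hypothesis near_edge : forall e, near (src e) -> AE e && edge_in_square lo hi e.
Hypothesis near_face : forall q, near (fpos q) -> AS q && face_in_square lo hi q.
Hypothesis inside_vertex : forall v, AV v -> inside (vpos v).
Hypothesis inside_edge : forall e, AE e -> inside (src e).
Hypothesis inside_face : forall q, AS q -> inside (fpos q).

Let cell_trace (T : finType) (base : T -> nat * nat) (in_sq A : pred T) (X : 'M[Z]_#|T|) :
  (forall c c', X (enum_rank c) (enum_rank c') != 0%R -> box_step a (base c) (base c')) ->
  (forall c, in_sq c -> in_square lo hi (base c)) -> (forall c, near (base c) -> A c && in_sq c) ->
  (forall c, A c -> inside (base c)) ->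
  (\sum_(i | in_sq (enum_val i)) (X ^+ N.+1) i i = \tr (restr_mx (A \o enum_val) X ^+ N.+1))%R.
Proof.
move=> X_step in_sq_base near_A A_inside.
have base_walk w : walk X N.+1 w -> box_walk a N.+1 (fun t => base (enum_val (w t))).
  by move=> w_walk t /w_walk; rewrite -[w t]enum_valK -[w t.+1]enum_valK !enum_rankK; apply: X_step.
rewrite -(@mxtrace_exp_restr_walks _ _ X (A \o enum_val) (in_sq \o enum_val)) // => w w_walk w_closed.
all: have base_closed := congr1 (fun i => base (enum_val i)) w_closed.
  move=> w_sq t tN.
  by have /near_A/andP[] := near_of_start (base_walk w w_walk) base_closed (in_sq_base _ w_sq) tN.
move=> Aw.
by have /near_A/andP[] := near_of_inside (base_walk w w_walk) base_closed (fun t tN => A_inside _ (Aw t tN)).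
Qed.

Lemma local_trace_restr : local_trace m a N.+1 lo hi =
  Lefschetz_restr (AV \o enum_val) (AE \o enum_val) (AS \o enum_val)
    (vertex_mx m a) (edge_mx m a) (face_mx m a) N.+1.
Proof.
rewrite /local_trace /Lefschetz_restr; congr (_ - _ + _)%R.
- by apply: (@cell_trace _ (@vpos m)) => // v w; apply: box_step_vertex.
- by apply: (@cell_trace _ (@src m)) => // [e e'|e /andP[]] //; apply: box_step_edge.
- by apply: (@cell_trace _ (@fpos m)) => // [q q'|q /andP[]] //; apply: box_step_face.
Qed.
End LocalTrace.

Section SquareCells.
Variables (p : pt) (s r : R) (h : nat).
Hypotheses (s_gt0 : 0 < s) (h_gt0 : (0 < h)%N) (r_gt0 : 0 < r) (r_s : r < s).
Let l := square_radius r s h.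

Lemma dsup_in_square v : in_square (h - l) (h + l) v -> dsup (mesh_point p s h v) p <= r.
Proof.
move=> /andP[/andP[/INR_leq a1 /INR_leq a2] /andP[/INR_leq a3 /INR_leq a4]].
have mesh0 := mesh_gt0 s_gt0 h_gt0; have [l_r _] := square_radius_bounds s_gt0 h_gt0 (Rlt_le _ _ r_gt0).
have l_h : (l < h)%N by apply: square_radius_lt => //; lra.
rewrite -/l in l_r; rewrite minus_INR ?plus_INR in a1 a2 a3 a4; try lia.
by apply/dsup_le; rewrite /mesh_point /grid_point /=; split; apply: Rabs_le; nra.
Qed.

Lemma near_center_in_square v : 4 * (s / INR h) <= r -> dsup (mesh_point p s h v) p <= r / 2 ->
  in_square (h - l) (h + l) v && in_square (h - l) (h + l) (v.1.+1, v.2.+1).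
Proof.
have mesh0 := mesh_gt0 s_gt0 h_gt0; have [_ l_r] := square_radius_bounds s_gt0 h_gt0 (Rlt_le _ _ r_gt0).
have l_h : (l < h)%N by apply: square_radius_lt => //; lra.
rewrite -/l in l_r; move: l_r mesh0; rewrite /mesh_point /grid_point; set mesh := s / INR h => l_r mesh0.
move=> mesh_r /dsup_le /= [v1 v2].
have leq_mesh (i j : nat) : mesh * INR i <= mesh * INR j -> (i <= j)%N.
  by move=> ij; apply/leP/INR_le; nra.
have low : INR (h - l)%N = INR h - INR l by rewrite minus_INR //; lia.
have c1 : (h - l <= v.1)%N by apply: leq_mesh; rewrite low; split_Rabs; lra.
have c2 : (v.1.+1 <= h + l)%N by apply: leq_mesh; rewrite S_INR plus_INR; split_Rabs; lra.
have c3 : (h - l <= v.2)%N by apply: leq_mesh; rewrite low; split_Rabs; lra.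
have c4 : (v.2.+1 <= h + l)%N by apply: leq_mesh; rewrite S_INR plus_INR; split_Rabs; lra.
by rewrite /in_square /=; lia.
Qed.
End SquareCells.

Section ClosedWalks.
Variables (g : pt -> pt) (p : pt) (s : R).
Hypothesis s_gt0 : 0 < s.

Lemma eventually_closed_walk_near N r e : 0 < e -> orbits_within g p s r N ->
  (forall x, dsup x p <= r -> fiter g N x = x -> x = p) -> g p = p ->
  eventually (fun h => forall x, [/\ box_walk (discretize g p s h) N x, x N = x 0%N &
    dsup (mesh_point p s h (x 0%N)) p <= r] ->
    forall t, (t <= N)%N -> dsup (mesh_point p s h (x t)) p <= e).
Proof.
move=> e0 orbits only_fixed gp; apply: eventually_forall => sg x sg_inc walks.
have start_in n : dsup (mesh_point p s (sg n) (x n 0%N)) p <= r by have [] := walks n.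
have is_walk n : box_walk (discretize g p s (sg n)) N (x n) by have [] := walks n.
have [sg' [X [sg'_inc x0X X_in]]] := bounded_subseq start_in.
have walk_cv := box_walk_converges s_gt0 (increasing_seq_comp sg_inc sg'_inc)
  (fun n => is_walk (sg' n)) x0X (orbits X X_in).
have Xp : X = p.
  apply: only_fixed => //; apply: converges_unique (walk_cv N (leqnn N)) _.
  by apply: converges_ext x0X => n; have [_ -> _] := walks (sg' n).
have [n near] : exists n, forall t, (t < N.+1)%N -> dsup (mesh_point p s (sg (sg' n)) (x (sg' n) t)) p < e.
  apply/eventually_exists/eventually_below => t tN; have := walk_cv t tN e e0.
  by rewrite Xp fiter_fixed.
by exists (sg' n) => t tN; left; apply: near.
Qed.

(* [cell h v] says that the cell [v] of the mesh [h] belongs to a region; [region] contains the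
   limits of such cells. *)
Variables (cell : nat -> nat * nat -> Prop) (region : pt -> Prop).
Hypothesis cell_in : forall h v, cell h v -> dsup (mesh_point p s h v) p <= s.
Hypothesis cell_limit : forall sg c X, increasing_seq sg -> (forall n, cell (sg n) (c n)) ->
  converges (fun n => mesh_point p s (sg n) (c n)) X -> region X.
Hypothesis region_step : forall X, region X -> continuous_at g X /\ dsup (g X) p <= s.

Lemma cell_walk_limit N sg (x : nat -> nat -> nat * nat) : increasing_seq sg ->
  (forall n, box_walk (discretize g p s (sg n)) N (x n)) ->
  (forall n t, (t <= N)%N -> cell (sg n) (x n t)) ->
  exists sg' X, [/\ increasing_seq sg', forall t, (t <= N)%N -> region (fiter g t X) &
    forall t, (t <= N)%N -> converges (fun n => mesh_point p s (sg (sg' n)) (x (sg' n) t)) (fiter g t X)].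
Proof.
move=> sg_inc walks cells.
have [sg' [X [sg'_inc x0X X_in]]] := bounded_subseq (fun n => cell_in (cells n 0%N isT)).
have sgg_inc := increasing_seq_comp sg_inc sg'_inc; exists sg', X.
have limit t : (t <= N)%N -> region (fiter g t X) /\
    converges (fun n => mesh_point p s (sg (sg' n)) (x (sg' n) t)) (fiter g t X).
  elim: t => [|t IH] tN; first by split=> //; apply: cell_limit sgg_inc _ x0X => n; apply: cells.
  have [region_t cv_t] := IH (ltnW tN); have [g_cont g_in] := region_step region_t.
  have cv_tS := box_step_converges s_gt0 sgg_inc (fun n => walks (sg' n) t tN) cv_t g_cont g_in.
  by split=> //; apply: cell_limit sgg_inc _ cv_tS => n; apply: cells.
by split=> // t /limit[].
Qed.

Lemma eventually_closed_cell_walk_near N e : 0 < e ->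
  (forall X, (forall t, (t <= N)%N -> region (fiter g t X)) -> fiter g N X = X -> X = p) ->
  eventually (fun h => forall x, [/\ box_walk (discretize g p s h) N x, x N = x 0%N &
    forall t, (t <= N)%N -> cell h (x t)] -> dsup (mesh_point p s h (x 0%N)) p <= e).
Proof.
move=> e0 only_fixed; apply: eventually_forall => sg x sg_inc walks.
have is_walk n : box_walk (discretize g p s (sg n)) N (x n) by have [] := walks n.
have cells n t : (t <= N)%N -> cell (sg n) (x n t) by have [_ _] := walks n; apply.
have [sg' [X [sg'_inc X_region x_cv]]] := cell_walk_limit sg_inc is_walk cells.
have Xp : X = p.
  apply: only_fixed => //; apply: converges_unique (x_cv N (leqnn N)) _.
  by apply: converges_ext (x_cv 0%N isT) => n; have [_ -> _] := walks (sg' n).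
have := x_cv 0%N isT e e0; rewrite /= Xp => /eventually_exists[n near].
by exists (sg' n); left.
Qed.
End ClosedWalks.

(** * The index of iterates *)

Definition circle_index (g : pt -> pt) (p : pt) (r : R) (k : Z) : Prop :=
  winding_number (fun t => psub (circ p r t) (g (circ p r t))) k.

Definition isolating_iterates (g : pt -> pt) (p : pt) (s r : R) (N : nat) : Prop :=
  orbits_within g p s (2 * r) N /\
  forall x, dsup x p <= 2 * r -> forall t, (0 < t <= N)%N -> fiter g t x = x -> x = p.

Lemma isolating_iterates_le g p s r N r' N' : r' <= r -> (N' <= N)%N ->
  isolating_iterates g p s r N -> isolating_iterates g p s r' N'.
Proof.
move=> r_le N_le [orbits only_fixed].
by split=> x x_in t tN; [apply: orbits | apply: only_fixed]; try lra; lia.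
Qed.

Definition restricted_trace g p s h r N : Z :=
  let m := mesh_size h in let a := discretize g p s h in
  let lo := (h - square_radius r s h)%N in let hi := (h + square_radius r s h)%N in
  Lefschetz_restr (@vertex_in_square m lo hi \o enum_val) (@edge_in_square m lo hi \o enum_val)
    (@face_in_square m lo hi \o enum_val) (vertex_mx m a) (edge_mx m a) (face_mx m a) N.

Section IndexOfIterates.
Variables (g : pt -> pt) (p : pt) (s : R).
Hypotheses (s_gt0 : 0 < s) (g_fixed : g p = p).

Lemma eventually_discrete_trace_restr N r r' : 0 < r < s -> 0 < r' < s ->
  isolating_iterates g p s r N.+1 -> isolating_iterates g p s r' N.+1 ->
  eventually (fun h => discrete_trace g p s h N.+1 r = restricted_trace g p s h r' N.+1).
Proof.
move=> [r0 r_s] [r'0 r'_s] [orbits only_fixed] [orbits' only_fixed'].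
pose e := Rmin (r / 2) (r' / 2).
have e0 : 0 < e by apply: Rmin_glb_lt; lra.
have e_r : e <= r / 2 := Rmin_l _ _; have e_r' : e <= r' / 2 := Rmin_r _ _.
have walk_near q : 0 < q -> isolating_iterates g p s q N.+1 -> eventually (fun h => forall x,
    [/\ box_walk (discretize g p s h) N.+1 x, x N.+1 = x 0%N & dsup (mesh_point p s h (x 0%N)) p <= q] ->
    forall t, (t <= N.+1)%N -> dsup (mesh_point p s h (x t)) p <= e).
  move=> q0 [q_orbits q_fixed]; apply: eventually_closed_walk_near => // x x_in.
    by apply: q_orbits; lra.
  by apply: q_fixed; [lra | rewrite ltnSn].
have mesh_small := vanishing_mesh s_gt0 increasing_seq_id (ltac:(lra) : 0 < e / 2).
apply: eventually_imp (eventually_and (eventually_and (walk_near r r0 (conj orbits only_fixed))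
  (walk_near r' r'0 (conj orbits' only_fixed'))) (eventually_and mesh_small (eventually_ge 1))).
move=> h [[near_r near_r'] [mesh_e h0]]; rewrite /= in mesh_e.
have in_squares v q : dsup (mesh_point p s h v) p <= e -> 0 < q < s -> e <= q / 2 ->
    in_square (h - square_radius q s h) (h + square_radius q s h) v &&
    in_square (h - square_radius q s h) (h + square_radius q s h) (v.1.+1, v.2.+1).
  by move=> v_near [q0 q_s] e_q; apply: (@near_center_in_square p) => //; lra.
rewrite /discrete_trace /restricted_trace; set m := mesh_size h.
set lo := (h - square_radius r' s h)%N; set hi := (h + square_radius r' s h)%N.
apply: (@local_trace_restr _ _ N _ _ (fun v _ => discretize_grid g p s v h0)
  (fun v => dsup (mesh_point p s h v) p <= e)
  (in_square lo hi) (@vertex_in_square m lo hi) (@edge_in_square m lo hi) (@face_in_square m lo hi)).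
- by move=> x walk closed /(dsup_in_square p s_gt0 h0 r0 r_s) start; apply: near_r.
- by move=> x walk closed /(_ 0%N isT)/(dsup_in_square p s_gt0 h0 r'0 r'_s) start; apply: near_r'.
- move=> v v_near; have := in_squares _ r v_near (conj r0 r_s) e_r.
  by have := in_squares _ r' v_near (conj r'0 r'_s) e_r'; rewrite /vertex_in_square => /andP[-> _] /andP[].
- move=> ed ed_near; have := in_squares _ r ed_near (conj r0 r_s) e_r.
  have := in_squares _ r' ed_near (conj r'0 r'_s) e_r'; rewrite /edge_in_square /in_square /src /tgt.
  by case: (epos ed) => [[] [i j]] /=; rewrite /src_at /tgt_at /=; lia.
- move=> q q_near; have := in_squares _ r q_near (conj r0 r_s) e_r.
  by have := in_squares _ r' q_near (conj r'0 r'_s) e_r'; rewrite /face_in_square => -> ->.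
- by [].
- by move=> v /andP[].
- by move=> v /andP[].
Qed.

Lemma eventually_circle_index N r r' : 0 < r -> 2 * r < s -> 0 < r' < s ->
  isolating_iterates g p s r N.+1 -> isolating_iterates g p s r' N.+1 ->
  eventually (fun h => circle_index (fiter g N.+1) p r (restricted_trace g p s h r' N.+1)).
Proof.
move=> r0 r_s r'_s iso iso'; have [orbits only_fixed] := iso.
have index := eventually_winding_discrete_trace s_gt0 r0 r_s orbits
  (fun x x_in => only_fixed x x_in N.+1 (leqnn N.+1)).
have traces := eventually_discrete_trace_restr (conj r0 (ltac:(lra) : r < s)) r'_s iso iso'.
by apply: eventually_imp (eventually_and index traces) => h [[_ +] <-].
Qed.

Lemma circle_index_radius N r r' : 0 < r -> 2 * r < s -> 0 < r' -> 2 * r' < s ->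
  isolating_iterates g p s r N.+1 -> isolating_iterates g p s r' N.+1 ->
  exists k, circle_index (fiter g N.+1) p r k /\ circle_index (fiter g N.+1) p r' k.
Proof.
move=> r0 r_s r'0 r'_s iso iso'.
have [h [index index']] := eventually_exists (eventually_and
  (eventually_circle_index r0 r_s (conj r0 (ltac:(lra) : r < s)) iso iso)
  (eventually_circle_index r'0 r'_s (conj r0 (ltac:(lra) : r < s)) iso' iso)).
by exists (restricted_trace g p s h r N.+1).
Qed.

Lemma circle_index_prime r q : prime q -> 0 < r -> 2 * r < s -> isolating_iterates g p s r q ->
  exists i c, circle_index g p r i /\ circle_index (fiter g q) p r (i + c * Z.of_nat q)%Z.
Proof.
move=> q_prime r0 r_s iso; have q0 := prime_gt0 q_prime.
have iso1 : isolating_iterates g p s r 1 by apply: isolating_iterates_le iso; [lra|].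
have r_s' : 0 < r < s by lra.
have index_q : eventually (fun h => circle_index (fiter g q) p r (restricted_trace g p s h r q)).
  by rewrite -(prednK q0) in iso *; apply: eventually_circle_index.
have [h [index1 {}index_q]] := eventually_exists (eventually_and
  (eventually_circle_index r0 r_s r_s' iso1 iso1) index_q).
have [c traceE] : exists c, restricted_trace g p s h r q = (restricted_trace g p s h r 1 + c * Z.of_nat q)%Z.
  exact: Lefschetz_restr_prime_mod.
by exists (restricted_trace g p s h r 1), c; rewrite -traceE.
Qed.
End IndexOfIterates.

(** * The block of cells around a region *)

Section Block.
Variables (p : pt) (s : R) (h : nat) (region : pt -> Prop).
Hypotheses (s_gt0 : 0 < s) (h_gt0 : (0 < h)%N).
Let m := mesh_size h.
Let mesh := s / INR h.
Let position := mesh_point p s h.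

Let mesh_pos : 0 < mesh. Proof. exact: mesh_gt0. Qed.
Let sizeE : m.+1 = (h + h)%N. Proof. exact: mesh_sizeS. Qed.

Definition near_region (d : R) (x : pt) : Prop := exists z, region z /\ dsup x z <= d.

Lemma near_region_le d d' x : d <= d' -> near_region d x -> near_region d' x.
Proof. by move=> dd' [z [z_in xz]]; exists z; split=> //; lra. Qed.

Lemma near_region_triangle d d' x y : near_region d x -> dsup y x <= d' -> near_region (d + d') y.
Proof. by move=> [z [z_in xz]] yx; exists z; split=> //; have := dsup_triangle y x z; lra. Qed.

Definition near_face (t : face m) : bool :=
  is_left (excluded_middle_informative (near_region mesh (position (fpos t)))).
Definition near_face_rel : rel (face m) := [rel x y | near_face x && near_face y && (adjacent x y || adjacent y x)].
Definition center_face : face m := face_at m (h, h).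
(* The set M, a union of closed grid squares. *)
Definition block (t : face m) : bool := connect near_face_rel center_face t.

Hypothesis region_center : region p.

Lemma mesh_point_center : position (h, h) = p.
Proof. by rewrite /position /mesh_point /grid_point /=; case: p => x y /=; congr pair; ring. Qed.

Lemma mesh_point_corner x v : corner x v -> dsup (position v) (position x) <= mesh.
Proof. by move=> /grid_near_corner; apply: mesh_point_near. Qed.

Lemma block_near_face t : block t -> near_face t.
Proof.
have near0 : near_face center_face.
  apply/sumboolP; exists p; split=> //; rewrite fpos_at /= ?sizeE; try lia.
  by rewrite mesh_point_center dsup_refl; lra.
case/connectP=> q; elim: q (center_face) near0 => [|x q IH] y near_y /=; first by move=> _ ->.
by move=> /andP[/andP[/andP[_ near_x] _] path_q] /(IH _ near_x path_q).
Qed.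

Lemma block_corner_near t v : block t -> corner (fpos t) v -> near_region (2 * mesh) (position v).
Proof.
move=> /block_near_face/sumboolP t_near /mesh_point_corner.
by have -> : 2 * mesh = mesh + mesh by [ring|]; apply: near_region_triangle.
Qed.

Lemma block_step t t' : block t -> near_face t' -> adjacent t t' || adjacent t' t -> block t'.
Proof.
move=> Bt near_t' tt'; apply: (connect_trans Bt); apply: connect1.
by rewrite /near_face_rel /= near_t' tt' (block_near_face Bt).
Qed.

Lemma block_connected : face_connected block.
Proof.
move=> ph ph_adjacent.
have ph_center t : block t -> ph t = ph center_face.
  case/connectP=> q; have : block center_face by apply: connect0.
  elim: q (center_face) => [|x q IH] y By /=; first by move=> _ ->.
  move=> /andP[yx path_q] t_last.
  have Bx : block x by apply: (connect_trans By); apply: connect1.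
  rewrite (IH x Bx path_q t_last); case/andP: yx => _ /orP[] adj; first by rewrite (ph_adjacent y x).
  by rewrite (ph_adjacent x y).
by move=> t t' /ph_center -> /ph_center ->.
Qed.

Lemma frontier_off_region (v : vertex m) : frontier block v -> ~ region (position (vpos v)).
Proof.
case/andP=> /existsP[t /andP[Bt ct]] /existsP[t' /andP[Bt' ct']] v_in.
have near_corner q : corner (fpos q) (vpos v) -> near_face q.
  by move=> cq; apply/sumboolP; exists (position (vpos v)); split=> //; rewrite dsup_sym; apply: mesh_point_corner.
have [t1 t2] := fpos_lt t; have [t'1 t'2] := fpos_lt t'.
pose q := face_at m ((fpos t).1, (fpos t').2).
have qE : fpos q = ((fpos t).1, (fpos t').2) by rewrite /q fpos_at.
have cq : corner (fpos q) (vpos v).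
  by rewrite qE; move: ct ct'; rewrite /corner; case: (fpos t) (fpos t') => i j [k l] /=; lia.
have Bq : block q.
  case: (eqVneq (fpos q) (fpos t')) => [/fpos_inj -> //|ne]; apply: (block_step Bt' (near_corner _ cq)).
  move: ne ct ct'; rewrite /adjacent qE /corner; case: (fpos t) (fpos t') => i j [k l] /=.
  rewrite !xpair_eqE eqxx /=; lia.
apply: (negP Bt); case: (eqVneq (fpos q) (fpos t)) => [/fpos_inj <- //|ne].
apply: (block_step Bq (near_corner _ ct)); move: ne ct ct'; rewrite /adjacent qE /corner.
by case: (fpos t) (fpos t') => i j [k l] /=; rewrite !xpair_eqE eqxx /=; lia.
Qed.

Lemma dsup_grid (c : nat * nat) : in_grid m c -> dsup (position c) p <= s.
Proof.
rewrite /in_grid sizeE; case: c => i j /andP[/= /INR_leq i_le /INR_leq j_le].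
rewrite plus_INR in i_le j_le; have h0 := INR_gt0 h_gt0.
have h_mesh : INR h * mesh = s by rewrite /mesh; field; lra.
have i0 := pos_INR i; have j0 := pos_INR j.
by apply/dsup_le; rewrite /position /mesh_point /grid_point /= -/mesh; split; apply: Rabs_le; nra.
Qed.

Lemma frontier_near (v : vertex m) : frontier block v -> near_region (2 * mesh) (position (vpos v)).
Proof. by case/andP=> _ /existsP[t /andP[Bt ct]]; apply: block_corner_near Bt ct. Qed.

Definition far_point (x : pt) : Prop := ~ near_region (3 * mesh) x.

Lemma face_at_vertex (v : vertex m) : exists t : face m, corner (fpos t) (vpos v).
Proof.
have /andP[v1 v2] := in_grid_vpos v.
exists (face_at m ((vpos v).1 - ((vpos v).1 == m.+1), (vpos v).2 - ((vpos v).2 == m.+1))%N).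
by rewrite fpos_at; move: v1 v2; rewrite /corner; case: (vpos v) => i j /=; lia.
Qed.

Lemma far_off_block x t : far_point (position x) -> corner (fpos t) x -> ~~ block t.
Proof.
move=> x_far cx; apply/negP => /block_corner_near/(_ cx) x_near; apply: x_far.
by apply: near_region_le x_near; lra.
Qed.

Lemma far_outer_vertex (v : vertex m) : far_point (position (vpos v)) -> outer_vertex block v.
Proof.
move=> v_far; have [t ct] := face_at_vertex v.
by apply/existsP; exists t; rewrite ct (far_off_block v_far ct).
Qed.

Lemma far_outer_edge (e : edge m) : far_point (position (src e)) -> outer_edge block e.
Proof.
move=> e_far; have [t te] := face_on_edge e; apply/existsP; exists t; rewrite te andbT.
by have /andP[ct _] := corner_of_face_bd te; apply: far_off_block e_far ct.
Qed.

Lemma not_outer_vertex_near (v : vertex m) :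
  ~~ outer_vertex block v -> near_region (2 * mesh) (position (vpos v)).
Proof.
move=> /existsPn v_in; have [t ct] := face_at_vertex v.
by have := v_in t; rewrite ct andbT negbK => Bt; apply: block_corner_near Bt ct.
Qed.

Lemma not_outer_edge_near (e : edge m) :
  ~~ outer_edge block e -> near_region (2 * mesh) (position (src e)).
Proof.
move=> /inner_edge_of_not_outer/existsP[t /andP[Bt /corner_of_face_bd/andP[ct _]]].
exact: block_corner_near Bt ct.
Qed.

Local Notation linked := (connect (outer_rel block)).

Lemma linked_far_row j i i' : (i <= i')%N -> in_grid m (i', j) ->
  (forall t, (i <= t <= i')%N -> far_point (position (t, j))) ->
  linked (vertex_at m (i, j)) (vertex_at m (i', j)).
Proof.
elim: i' => [|i' IH]; first by rewrite leqn0 => /eqP ->; rewrite connect0.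
rewrite leq_eqVlt => /orP[/eqP -> *|]; first by rewrite connect0.
rewrite ltnS => i_le /andP[/= i'_m j_m] row_far.
have i'_grid : in_grid m (i', j) by rewrite /in_grid /= j_m ltnW.
apply: connect_trans (IH i_le i'_grid _) _ => [t /andP[it ti']|]; first by apply: row_far; rewrite it leqW.
apply: connect1; have := @outer_rel_edge m block (hedge m i' j).
rewrite /src /tgt epos_hedge //; apply; apply: far_outer_edge; rewrite /src epos_hedge //.
by apply: row_far; rewrite /= i_le leqnSn.
Qed.

Lemma linked_far_column i j j' : (j <= j')%N -> in_grid m (i, j') ->
  (forall t, (j <= t <= j')%N -> far_point (position (i, t))) ->
  linked (vertex_at m (i, j)) (vertex_at m (i, j')).
Proof.
elim: j' => [|j' IH]; first by rewrite leqn0 => /eqP ->; rewrite connect0.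
rewrite leq_eqVlt => /orP[/eqP -> *|]; first by rewrite connect0.
rewrite ltnS => j_le /andP[/= i_m j'_m] column_far.
have j'_grid : in_grid m (i, j') by rewrite /in_grid /= i_m ltnW.
apply: connect_trans (IH j_le j'_grid _) _ => [t /andP[jt tj']|]; first by apply: column_far; rewrite jt leqW.
apply: connect1; have := @outer_rel_edge m block (vedge m i j').
rewrite /src /tgt epos_vedge //; apply; apply: far_outer_edge; rewrite /src epos_vedge //.
by apply: column_far; rewrite /= j_le leqnSn.
Qed.

Lemma linked_far_box (x y : nat * nat) : in_grid m x -> in_grid m y ->
  (forall z, (minn x.1 y.1 <= z.1 <= maxn x.1 y.1)%N -> (minn x.2 y.2 <= z.2 <= maxn x.2 y.2)%N ->
     far_point (position z)) ->
  linked (vertex_at m x) (vertex_at m y).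
Proof.
case: x y => i j [k l]; rewrite /in_grid => /andP[/= i_m j_m] /andP[/= k_m l_m] box_far.
apply: (@connect_trans _ _ (vertex_at m (k, j))).
  case: (leqP i k) => ik; [|rewrite outer_rel_sym]; apply: linked_far_row;
    rewrite ?/in_grid /= ?i_m ?j_m ?k_m //; try lia;
    by move=> t ht; apply: box_far => /=; lia.
case: (leqP j l) => jl; [|rewrite outer_rel_sym]; apply: linked_far_column;
  rewrite ?/in_grid /= ?j_m ?k_m ?l_m //; try lia;
  by move=> t ht; apply: box_far => /=; lia.
Qed.

Section CentralBall.
Variable e : R.
Hypothesis ball_region : forall x, dsup x p <= e -> region x.

Lemma mesh_coord_toward_center (i j : nat) : (minn i h <= j <= maxn i h)%N ->
  Rabs (mesh * (INR i - INR h)) <= e -> Rabs (mesh * (INR j - INR h)) <= e.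
Proof.
move=> between; rewrite !(Rabs_mult mesh) => i_near; apply: Rle_trans i_near.
apply: Rmult_le_compat_l; first exact: Rabs_pos.
have [/andP[/INR_leq ? /INR_leq ?]|/andP[/INR_leq ? /INR_leq ?]] : (i <= j <= h)%N \/ (h <= j <= i)%N by lia.
  by split_Rabs; lra.
by split_Rabs; lra.
Qed.

Lemma mesh_point_toward_center x y :
  (minn x.1 h <= y.1 <= maxn x.1 h)%N -> (minn x.2 h <= y.2 <= maxn x.2 h)%N ->
  dsup (position x) p <= e -> dsup (position y) p <= e.
Proof.
have cancel (u v : R) : u + v - u = v by ring.
move=> y1 y2; rewrite /position /mesh_point /grid_point => /dsup_le; rewrite /= !cancel => -[x1 x2].
apply/dsup_le; rewrite /= !cancel.
by split; [apply: mesh_coord_toward_center y1 x1 | apply: mesh_coord_toward_center y2 x2].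
Qed.

Lemma block_step_near t t' : adjacent t t' || adjacent t' t -> dsup (position (fpos t')) p <= e ->
  block t -> block t'.
Proof.
move=> tt' t'_near Bt; apply: block_step Bt _ tt'; apply/sumboolP.
by exists (position (fpos t')); split; [exact: ball_region | rewrite dsup_refl; lra].
Qed.

Lemma block_of_near_center (t : face m) : dsup (position (fpos t)) p <= e -> block t.
Proof.
suff near_block d (i j : nat) : (i - h + (h - i) + (j - h + (h - j)) <= d)%N ->
    (i < m.+1)%N -> (j < m.+1)%N -> dsup (position (i, j)) p <= e -> block (face_at m (i, j)).
  move=> t_near; have [t1 t2] := fpos_lt t; have := near_block _ (fpos t).1 (fpos t).2 (leqnn _) t1 t2.
  by rewrite -surjective_pairing face_at_fpos; apply.
elim: d i j => [|d IH] i j dist i_m j_m ij_near.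
  by have [-> ->] : i = h /\ j = h by [lia|]; apply: connect0.
have from i' j' : (minn i h <= i' <= maxn i h)%N -> (minn j h <= j' <= maxn j h)%N ->
    (i' - h + (h - i') + (j' - h + (h - j')) <= d)%N -> (i' < m.+1)%N -> (j' < m.+1)%N ->
    adjacent (face_at m (i', j')) (face_at m (i, j)) || adjacent (face_at m (i, j)) (face_at m (i', j')) ->
    block (face_at m (i, j)).
  move=> i'_between j'_between dist' i'_m j'_m adj; apply: block_step_near adj _ _; first by rewrite fpos_at.
  by apply: IH => //; apply: mesh_point_toward_center ij_near.
have fposE k l : (k < m.+1)%N -> (l < m.+1)%N -> fpos (face_at m (k, l)) = (k, l) by move=> *; rewrite fpos_at.
case: (ltngtP i h) => ih.
- by apply: (from i.+1 j); rewrite ?/adjacent ?fposE ?eqxx ?orbT //; lia.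
- by apply: (from i.-1 j); rewrite ?/adjacent ?fposE ?prednK ?eqxx ?orbT //; lia.
case: (ltngtP j h) => jh.
- by apply: (from i j.+1); rewrite ?/adjacent ?fposE ?eqxx ?orbT //; lia.
- by apply: (from i j.-1); rewrite ?/adjacent ?fposE ?prednK ?eqxx ?orbT //; lia.
- by rewrite ih jh; apply: connect0.
Qed.

Lemma block_of_corner_near (t : face m) v : corner (fpos t) v -> dsup (position v) p + mesh <= e -> block t.
Proof.
move=> /mesh_point_corner ct v_near; apply: block_of_near_center.
have := dsup_triangle (position (fpos t)) (position v) p.
by rewrite (dsup_sym (position (fpos t)) (position v)); lra.
Qed.

Lemma near_center_not_outer_vertex (v : vertex m) : dsup (position (vpos v)) p + mesh <= e -> ~~ outer_vertex block v.
Proof.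
move=> v_near; apply/existsPn => t; rewrite negb_and negbK.
by case ct: (corner _ _); [rewrite (block_of_corner_near ct) | rewrite orbT].
Qed.

Lemma near_center_not_outer_edge (x : edge m) : dsup (position (src x)) p + mesh <= e -> ~~ outer_edge block x.
Proof.
move=> x_near; apply/existsPn => t; rewrite negb_and negbK.
case: (eqVneq (face_bd t x) 0%Z) => [_|nz]; first by rewrite orbT.
by have /andP[ct _] := corner_of_face_bd nz; rewrite (block_of_corner_near ct).
Qed.
End CentralBall.
End Block.

(** * Dynamics of the block *)

Definition nearest_vertex (p : pt) (s : R) (x : pt) (h : nat) : nat * nat :=
  discretize (fun=> x) p s h (h, h).

Lemma nearest_vertex_converges p s x sg : 0 < s -> increasing_seq sg -> dsup x p <= s ->
  converges (fun n => mesh_point p s (sg n) (nearest_vertex p s x (sg n))) x.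
Proof.
move=> s0 sg_inc x_in; apply: (@box_step_converges (fun=> x) p s s0 sg sg_inc (fun n => (sg n, sg n)) _ p) => //.
- by move=> n; apply: box_step_image.
- by apply: converges_ext (converges_const p) => n; rewrite mesh_point_center.
- by move=> e e0; exists 1; split=> [|y _]; [lra | rewrite dsup_refl].
Qed.

Lemma fpos_inner_mesh_point p s h v : 0 < s -> (0 < h)%N -> dsup (mesh_point p s h v) p < s ->
  fpos (face_at (mesh_size h) v) = v.
Proof.
move=> s0 h0 /dsup_lt; have mesh0 := mesh_gt0 s0 h0; have h_gt0 := INR_gt0 h0.
have h_mesh : INR h * (s / INR h) = s by field; lra.
have coord_lt (i : nat) : s / INR h * (INR i - INR h) < s -> (i < (mesh_size h).+1)%N.
  by rewrite mesh_sizeS // => i_lt; apply/ltP/INR_lt; rewrite plus_INR; nra.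
by rewrite /mesh_point /grid_point /= => -[v1 v2]; apply: fpos_at; apply: coord_lt; split_Rabs; lra.
Qed.

Section BlockDynamics.
Variables (f : pt -> pt) (p : pt) (r s : R) (k : nat).
Hypothesis square : isolating_square f p r.
Hypotheses (s_gt0 : 0 < s) (s_r : s <= r) (k_gt0 : (0 < k)%N).
Hypothesis orbit_interior : forall j x, dsup x p <= s -> orbit_in f p r j x -> dsup (fiter f j x) p <= s ->
  forall i, (i <= j)%N -> dsup (fiter f i x) p < r.
Hypothesis orbit_middle : forall x, orbit_in f p r (k + k) x -> dsup (fiter f k x) p < s.
Let g := fiter f k.

Definition block_region (x : pt) : Prop :=
  [/\ dsup x p <= s, orbit_in f p r k x & dsup (fiter f k x) p <= s].

Lemma block_region_center : block_region p.
Proof.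
have fp := isolating_fixed square.
by split; rewrite ?fiter_fixed ?dsup_refl //; try lra; apply: orbit_in_fixed square _.
Qed.

Lemma block_region_step x : block_region x -> continuous_at g x /\ dsup (g x) p <= s.
Proof. by move=> [_ orb gx]; split=> //; apply: orbit_in_continuous square _ _ _ orb _. Qed.

Lemma block_region_closed u x : converges u x -> (forall n, block_region (u n)) -> block_region x.
Proof.
move=> ux u_in.
have orb : orbit_in f p r k x.
  by apply: (orbit_in_limit square ux); apply: eventually_all => n; have [] := u_in n.
have g_cont : continuous_at g x by apply: orbit_in_continuous square _ _ _ orb _.
split=> //; first by apply: converges_in_ball ux (eventually_all _) => n; have [] := u_in n.
by apply: converges_in_ball (continuous_at_converges g_cont ux) (eventually_all _) => n; have [] := u_in n.
Qed.

Lemma near_block_region_limit sg (u : nat -> pt) x : increasing_seq sg ->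
  (forall n, near_region block_region (3 * (s / INR (sg n))) (u n)) -> converges u x -> block_region x.
Proof.
move=> sg_inc u_near ux; have [v v_near] := choice _ u_near.
apply: (@block_region_closed v) => [|n]; last by have [] := v_near n.
apply: converges_near ux (vanishing_scale (ltac:(lra) : 0 < 3) (vanishing_mesh s_gt0 sg_inc)) _.
by apply: eventually_all => n; rewrite dsup_sym; have [] := v_near n.
Qed.

Lemma orbit_in_of_region N x : (forall t, (t <= N)%N -> block_region (fiter g t x)) ->
  orbit_in f p r (N * k) x.
Proof.
elim: N => [|N IH] in_region.
  move=> i; rewrite mul0n leqn0 => /eqP ->.
  by have [x_in _ _] := in_region 0%N isT; rewrite /= in x_in *; lra.
rewrite mulSn; apply: orbit_in_cat; first by apply: IH => t tN; apply: in_region; exact: leqW.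
by rewrite fiterM; have [] := in_region N (leqnSn N).
Qed.

Lemma periodic_in_region N x : (0 < N)%N -> (forall t, (t <= N)%N -> block_region (fiter g t x)) ->
  fiter g N x = x -> x = p.
Proof.
move=> N0 in_region x_fixed; apply: (periodic_orbit_fixed square (n := (N * k)%N)).
- by rewrite muln_gt0 N0.
- exact: orbit_in_of_region.
- by rewrite fiterM.
Qed.

Lemma central_ball_in_region : exists e, [/\ 0 < e, e <= s & forall x, dsup x p <= e -> block_region x].
Proof.
have [d [d0 near]] := fiter_near_fixed square k s_gt0.
exists (Rmin d s); split; [exact: Rmin_glb_lt | exact: Rmin_r |] => x x_in.
have := Rmin_l d s; have := Rmin_r d s => min_r min_l.
split; [lra | | by apply: near => //; lra].
by move=> i ik; have := near x ltac:(lra) i ik; lra.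
Qed.

Lemma isolating_iterates_exist N : exists q, [/\ 0 < q, 2 * q < s & isolating_iterates g p s q N].
Proof.
have [e [e0 e_s ball]] := central_ball_in_region.
have [d [d0 near]] := fiter_near_fixed square (N * k) e0.
have min_l := Rmin_l (d / 4) (s / 4); have min_r := Rmin_r (d / 4) (s / 4).
exists (Rmin (d / 4) (s / 4)); split; [apply: Rmin_glb_lt; lra | lra |].
have in_region x : dsup x p <= 2 * Rmin (d / 4) (s / 4) -> forall t, (t <= N)%N -> block_region (fiter g t x).
  by move=> x_in t tN; apply: ball; rewrite -fiterM; apply: near; [lra | rewrite leq_mul2r tN orbT].
split=> x x_in t tN.
  by have region_t := in_region x x_in t tN; split; [have [] := block_region_step region_t | have [] := region_t].
apply: periodic_in_region => [|t' t't]; first by case/andP: tN.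
by apply: in_region => //; case/andP: tN => _; apply: leq_trans.
Qed.

(* Otherwise there is an orbit segment of length 2k with its middle outside the square of radius [s]. *)
Lemma exit_gap : exists eta, 0 < eta /\
  forall x, block_region x -> s <= dsup (g x) p -> ~ near_region block_region eta (g x).
Proof.
have [eta [eta0 gap]] : exists eta, 0 < eta /\ forall q : pt * pt,
    [/\ block_region q.1, s <= dsup (g q.1) p, block_region q.2 & dsup q.2 (g q.1) <= eta] -> False.
  apply: tolerance_exists => eta q eta_van q_spec.
  have first_in n : dsup (q n).1 p <= s by have [[]] := q_spec n.
  have [t [x [t_inc tx _]]] := bounded_subseq first_in.
  have x_region : block_region x by apply: (block_region_closed tx) => n; have [] := q_spec (t n).
  have [g_cont _] := block_region_step x_region; have gx := continuous_at_converges g_cont tx.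
  have gx_out : s <= dsup (g x) p.
    by apply: converges_off_ball gx (eventually_all _) => n; have [] := q_spec (t n).
  have gx_region : block_region (g x).
    apply: (@block_region_closed (fun n => (q (t n)).2)) => [|n]; last by have [] := q_spec (t n).
    apply: converges_near gx (vanishing_subseq t_inc eta_van) (eventually_all _) => n.
    by have [] := q_spec (t n).
  have orb : orbit_in f p r (k + k) x by case: x_region gx_region => _ orb _ [_ orb' _]; apply: orbit_in_cat.
  by exists 0%N; have := orbit_middle orb; rewrite -/g; lra.
exists eta; split=> // x x_region gx_out [y [y_region xy]]; apply: (gap (x, y)); split=> //=.
by rewrite dsup_sym.
Qed.

Lemma off_region_limit u x : converges u x -> block_region x ->
  (forall n, dsup (u n) p <= s) -> (forall n, ~ block_region (u n)) -> s <= dsup (g x) p.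
Proof.
move=> ux [x_in orb gx_in] u_in u_off.
have u_orbit : eventually (fun n => forall i, (i < k.+1)%N -> dsup (fiter f i (u n)) p < r).
  apply: eventually_below => i ik; have x_lt := orbit_interior x_in orb gx_in ik.
  have f_cont : continuous_at (fiter f i) x by apply: orbit_in_continuous square _ _ _ orb (ltnW ik).
  have := continuous_at_converges f_cont ux (ltac:(lra) : 0 < r - dsup (fiter f i x) p).
  by apply: eventually_imp => n /=; have := dsup_triangle (fiter f i (u n)) (fiter f i x) p; lra.
have g_cont : continuous_at g x by apply: orbit_in_continuous square _ _ _ orb _.
apply: converges_off_ball (continuous_at_converges g_cont ux) _; apply: eventually_imp u_orbit => n u_orb.
apply: Rnot_lt_le => gu_in; apply: (u_off n); split; [exact: u_in | | exact: Rlt_le].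
by move=> i ik; left; apply: u_orb.
Qed.

Lemma frontier_images_far : exists eta, 0 < eta /\ eventually (fun h =>
  forall q : (nat * nat) * (nat * nat) * (nat * nat), let position := mesh_point p s h in
  [/\ ~ block_region (position q.1.1) /\ dsup (position q.1.1) p <= s,
      near_region block_region (3 * (s / INR h)) (position q.1.1),
      dsup (position q.1.2) (position q.1.1) <= 3 * (s / INR h) & box_step (discretize g p s h) q.1.2 q.2] ->
  ~ near_region block_region eta (position q.2)).
Proof.
have [eta [eta0 gap]] := exit_gap; exists (eta / 2); split; first lra.
apply: eventually_forall => sg q sg_inc q_spec.
have v_in n : dsup (mesh_point p s (sg n) (q n).1.1) p <= s by have [[]] := q_spec n.
have [t [x [t_inc vx _]]] := bounded_subseq v_in; have sgt_inc := increasing_seq_comp sg_inc t_inc.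
have x_region : block_region x by apply: (near_block_region_limit sgt_inc _ vx) => n; have [] := q_spec (t n).
have [g_cont gx_in] := block_region_step x_region.
have mesh_small := vanishing_scale (ltac:(lra) : 0 < 3) (vanishing_mesh s_gt0 sgt_inc).
have x_cv : converges (fun n => mesh_point p s (sg (t n)) (q (t n)).1.2) x.
  by apply: converges_near vx mesh_small (eventually_all _) => n; have [] := q_spec (t n).
have steps n : box_step (discretize g p s (sg (t n))) (q (t n)).1.2 (q (t n)).2 by have [] := q_spec (t n).
have y_cv := box_step_converges s_gt0 sgt_inc steps x_cv g_cont gx_in.
have gx_out : s <= dsup (g x) p.
  by apply: (off_region_limit vx x_region) => n; have [[]] := q_spec (t n).
have [n y_near] := eventually_exists (y_cv (eta / 2) ltac:(lra)).
exists (t n) => /near_region_triangle near_gx; apply: (gap x x_region gx_out).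
by apply: near_region_le (near_gx (eta / 2) (g x) _); [lra | rewrite dsup_sym; left].
Qed.

Lemma unstable_not_ball_region z : unstable f p r z -> z <> p ->
  ~ (forall x, dsup x p <= s -> block_region x).
Proof.
move=> z_unst zp ball.
have ball_stable x : dsup x p <= s -> stable f p r x.
  move=> x_in i; have orbit_s t : dsup (fiter g t x) p <= s by elim: t => // t /ball[].
  by apply: (orbit_in_of_region (N := i)) => [t _|]; [apply: ball | rewrite leq_pmulr].
have [y [yz y_unst]] := unstable_orbit square (k + k) z_unst.
have y_orbit : orbit_in f p r (k + k) y by move=> i ik; apply: (has_past_in (j := 0)); apply: y_unst.
have fy : fiter f k y = p.
  apply: (unstable_stable_fixed square); first by apply: y_unst; rewrite leq_addr.
  by apply/ball_stable/Rlt_le/orbit_middle.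
by apply: zp; rewrite -yz fiterD fy fiter_fixed //; apply: isolating_fixed square.
Qed.

Lemma eventually_outer_vertex z : unstable f p r z -> z <> p ->
  eventually (fun h => exists v : vertex (mesh_size h), outer_vertex (@block p s h block_region) v).
Proof.
move=> z_unst zp; apply: NNPP => /not_eventually[sg0 [sg0_inc no_outer]].
pose sg n := sg0 (1 + n)%N; have sg_inc : increasing_seq sg := increasing_seq_shift 1 sg0_inc.
have sg_gt0 n : (0 < sg n)%N by apply: leq_trans (increasing_seq_ge (1 + n) sg0_inc).
apply: (unstable_not_ball_region z_unst zp) => x x_in.
apply: (near_block_region_limit sg_inc _ (nearest_vertex_converges s_gt0 sg_inc x_in)) => n.
set v := nearest_vertex p s x (sg n).
have v_grid : in_grid (mesh_size (sg n)) v by apply: discretize_grid.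
have v_in : ~~ outer_vertex (@block p s (sg n) block_region) (vertex_at _ v).
  by apply/negP => v_out; apply: (no_outer (1 + n)%N); exists (vertex_at _ v).
have mesh0 := mesh_gt0 s_gt0 (sg_gt0 n).
have := not_outer_vertex_near s_gt0 (sg_gt0 n) block_region_center v_in; rewrite vpos_at //.
by apply: near_region_le; lra.
Qed.

Definition block_cell (h : nat) (v : nat * nat) : Prop :=
  near_region block_region (3 * (s / INR h)) (mesh_point p s h v) /\ dsup (mesh_point p s h v) p <= s.

Lemma block_cell_in h v : block_cell h v -> dsup (mesh_point p s h v) p <= s.
Proof. by case. Qed.

Lemma block_cell_limit sg c x : increasing_seq sg -> (forall n, block_cell (sg n) (c n)) ->
  converges (fun n => mesh_point p s (sg n) (c n)) x -> block_region x.
Proof. by move=> sg_inc cells; apply: near_block_region_limit => // n; have [] := cells n. Qed.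

Lemma block_cell_near h v : (0 < h)%N -> in_grid (mesh_size h) v ->
  near_region block_region (2 * (s / INR h)) (mesh_point p s h v) -> block_cell h v.
Proof.
move=> h0 v_grid v_near; split; last exact: dsup_grid v_grid.
by apply: near_region_le v_near; have := mesh_gt0 s_gt0 h0; lra.
Qed.

Lemma block_cell_block h (q : face (mesh_size h)) : (0 < h)%N -> @block p s h block_region q ->
  block_cell h (fpos q).
Proof.
move=> h0 Bq; apply: block_cell_near (in_grid_fpos q) _ => //.
exact: block_corner_near block_region_center _ _ Bq (corner_refl _).
Qed.

Lemma block_walk_of_exp h N i q : (0 < h)%N -> let B := @block p s h block_region in
  (restr_mx (predC (outer_face_index B)) (face_mx (mesh_size h) (discretize g p s h)) ^+ N.+1)%R i (enum_rank q)
    != 0%R ->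
  exists x, [/\ box_walk (discretize g p s h) N.+1 x, forall t, (t <= N.+1)%N -> block_cell h (x t) &
    x N.+1 = fpos q].
Proof.
move=> h0 B /exp_walk[w [w0 wN w_walk]].
have step t : (t < N.+1)%N -> [/\ B (enum_val (w t)), B (enum_val (w t.+1)) &
    box_step (discretize g p s h) (fpos (enum_val (w t))) (fpos (enum_val (w t.+1)))].
  move=> /w_walk; rewrite restr_mxE /= /outer_face_index !negbK -/B.
  case: ifP => [/andP[B_t B_tS] nz|//]; split=> //; apply: box_step_face; last by rewrite !enum_valK.
  by move=> v _; apply: discretize_grid.
exists (fun t => fpos (enum_val (w t))); split; last by rewrite wN enum_rankK.
  by move=> t /step[].
move=> t tN; apply: block_cell_block => //.
by move: tN; rewrite leq_eqVlt => /orP[/eqP ->|/step[]//]; have [] := step N (ltnSn N).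
Qed.

Lemma eventually_no_block_walk q : dsup q p <= s -> ~ unstable f p r q ->
  exists N, eventually (fun h => forall x, ~ [/\ box_walk (discretize g p s h) N.+1 x,
    forall t, (t <= N.+1)%N -> block_cell h (x t) & x N.+1 = nearest_vertex p s q h]).
Proof.
move=> q_in /not_all_ex_not[N no_past]; exists N.
apply: (@eventually_forall _ _ (fun _ _ => False)) => sg x sg_inc x_spec; case: no_past.
have is_walk n : box_walk (discretize g p s (sg n)) N.+1 (x n) by have [] := x_spec n.
have cells n t : (t <= N.+1)%N -> block_cell (sg n) (x n t) by have [_ + _] := x_spec n; apply.
have [t [y [t_inc y_region y_cv]]] := cell_walk_limit s_gt0 block_cell_in
  block_cell_limit block_region_step sg_inc is_walk cells.
apply: (has_past_le (j := (N.+1 * k)%N)); first by apply: leq_trans (leqnSn N) (leq_pmulr _ k_gt0).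
exists y; split; first exact: orbit_in_of_region.
rewrite fiterM; apply: converges_unique (y_cv N.+1 (leqnn _)) _.
apply: converges_ext (converges_subseq t_inc (nearest_vertex_converges s_gt0 sg_inc q_in)) => n /=.
by have [_ _ ->] := x_spec (t n).
Qed.

Lemma eventually_nilpotent_column e q : (forall x, dsup x p <= e -> block_region x) -> e <= s ->
  dsup q p < e -> ~ unstable f p r q ->
  exists N, eventually (fun h => exists Q : face (mesh_size h), @block p s h block_region Q /\
    forall i, (restr_mx (predC (outer_face_index (@block p s h block_region)))
      (face_mx (mesh_size h) (discretize g p s h)) ^+ N)%R i (enum_rank Q) = 0%R).
Proof.
move=> ball e_s q_in q_past; have [N no_walk] := eventually_no_block_walk (ltac:(lra) : dsup q p <= s) q_past.
exists N.+1; have near := nearest_vertex_converges s_gt0 increasing_seq_id (ltac:(lra) : dsup q p <= s).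
apply: eventually_imp (eventually_and no_walk
  (eventually_and (near (e - dsup q p) ltac:(lra)) (eventually_ge 1))) => h [no_walk_h [near_q h0]].
rewrite /= in near_q; set v := nearest_vertex p s q h in near_q no_walk_h.
have v_in : dsup (mesh_point p s h v) p < e by have := dsup_triangle (mesh_point p s h v) q p; lra.
have vE : fpos (face_at (mesh_size h) v) = v by apply: (@fpos_inner_mesh_point p s) => //; lra.
exists (face_at (mesh_size h) v); split.
  by apply: (block_of_near_center s_gt0 h0 block_region_center ball); rewrite vE; left.
move=> i; apply/eqP; apply: contraT => /(block_walk_of_exp h0)[x [walk cells x_end]].
by case: (no_walk_h x); rewrite x_end vE.
Qed.
End BlockDynamics.

(** * The index formula *)

Section Buckets.
Variables (width mesh s : R) (h K : nat).
Hypotheses (width_gt0 : 0 < width) (mesh_pos : 0 < mesh) (h_mesh : INR h * mesh = s).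
Hypothesis K_large : 2 * s / width < INR K.+1.

Definition bucket (i : nat) : 'I_K.+1 := inord (nfloor (INR i * mesh / width)).

Lemma bucket_bounds i : (i <= h + h)%N ->
  INR (bucket i) * width <= INR i * mesh < (INR (bucket i) + 1) * width.
Proof.
move=> /INR_leq i_le; rewrite plus_INR in i_le; have i0 := pos_INR i.
have quotient0 : 0 <= INR i * mesh / width by apply: Rle_mult_inv_pos => //; nra.
have quotientE : INR i * mesh / width * width = INR i * mesh by field; lra.
have [floor_le floor_gt] := nfloor_spec quotient0.
rewrite /bucket inordK; first by nra.
apply/ltP/INR_lt; apply: Rle_lt_trans floor_le (Rle_lt_trans _ _ _ _ K_large).
by apply: Rmult_le_compat_r; [left; apply: Rinv_0_lt_compat | nra].
Qed.

Lemma bucket_near i j : (i <= h + h)%N -> (j <= h + h)%N -> bucket i = bucket j ->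
  Rabs (mesh * (INR i - INR j)) <= width.
Proof.
move=> /bucket_bounds i_bounds /bucket_bounds + ij; rewrite -ij => j_bounds.
by rewrite Rmult_minus_distr_l; apply: Rabs_le; lra.
Qed.
End Buckets.

Lemma Rabs_between mesh (i j l : nat) e : 0 <= mesh -> (minn i j <= l <= maxn i j)%N ->
  Rabs (mesh * (INR i - INR j)) <= e -> Rabs (mesh * (INR l - INR i)) <= e.
Proof.
move=> mesh0 between; rewrite !Rabs_mult => ij_near; apply: Rle_trans ij_near.
apply: Rmult_le_compat_l; first exact: Rabs_pos.
have [/andP[/INR_leq ? /INR_leq ?]|/andP[/INR_leq ? /INR_leq ?]] : (i <= l <= j)%N \/ (j <= l <= i)%N by lia.
  by split_Rabs; lra.
by split_Rabs; lra.
Qed.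

Section BlockIndex.
Variables (f : pt -> pt) (p : pt) (r s : R) (k : nat).
Hypothesis square : isolating_square f p r.
Hypotheses (s_gt0 : 0 < s) (s_r : s <= r) (k_gt0 : (0 < k)%N).
Let g := fiter f k.
Let region := block_region f p r s k.

Definition block_trace (h n : nat) : Z :=
  let M := @block p s h region in let a := discretize g p s h in
  Lefschetz_restr (predC (outer_vertex_index M)) (predC (outer_edge_index M)) (predC (outer_face_index M))
    (vertex_mx (mesh_size h) a) (edge_mx (mesh_size h) a) (face_mx (mesh_size h) a) n.

Section AtScale.
Variables (h K : nat) (eta : R).
Hypothesis h_gt0 : (0 < h)%N.
Let mesh := s / INR h.
Let m := mesh_size h.
Let a := discretize g p s h.
Let M := @block p s h region.
Let position := mesh_point p s h.
Hypothesis mesh_eta : 16 * mesh <= eta.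
Hypothesis K_large : 2 * s / (eta / 4) < INR K.+1.
Hypothesis images_far : forall q : (nat * nat) * (nat * nat) * (nat * nat),
  [/\ ~ region (position q.1.1) /\ dsup (position q.1.1) p <= s, near_region region (3 * mesh) (position q.1.1),
      dsup (position q.1.2) (position q.1.1) <= 3 * mesh & box_step a q.1.2 q.2] ->
  ~ near_region region eta (position q.2).

Let mesh_pos : 0 < mesh. Proof. exact: mesh_gt0. Qed.
Let center_in : region p. Proof. by apply: block_region_center. Qed.
Let a_grid v : in_grid m v -> in_grid m (a v). Proof. by move=> _; apply: discretize_grid. Qed.

Let frontier_step_far v y : frontier M v -> box_step a (vpos v) y -> ~ near_region region eta (position y).
Proof.
move=> fv step; apply: (images_far (q := (vpos v, vpos v, y))); split=> //=.
- by split; [apply: (frontier_off_region s_gt0 h_gt0 center_in fv) | apply: dsup_grid (in_grid_vpos v)].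
- by apply: near_region_le (frontier_near s_gt0 h_gt0 center_in fv); rewrite -/mesh; lra.
- by rewrite dsup_refl; lra.
Qed.

Let far_point_near x y d : ~ near_region region eta x -> dsup y x <= d -> d + 3 * mesh <= eta ->
  far_point s h region y.
Proof.
move=> x_far yx d_eta /near_region_triangle y_near; apply: x_far; rewrite dsup_sym in yx.
by apply: near_region_le (y_near _ _ yx); rewrite -/mesh; lra.
Qed.

Let frontier_step_far_point v y : frontier M v -> box_step a (vpos v) y -> far_point s h region (position y).
Proof.
move=> fv step; apply: (far_point_near (frontier_step_far fv step) (d := 0)); last lra.
by rewrite dsup_refl; lra.
Qed.

Let frontier_vertex v : frontier M v -> outer_vertex M (vertex_map a v).
Proof.
move=> fv; apply: (far_outer_vertex s_gt0 h_gt0 center_in); rewrite vpos_vertex_map //.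
exact: frontier_step_far_point fv (box_step_image _ _).
Qed.

Let frontier_edge (e e' : edge m) :
  outer_edge M e -> inner_edge M e -> edge_map a e e' != 0%R -> outer_edge M e'.
Proof.
move=> /outer_edge_ends[src_out _] /inner_edge_ends[src_in _] nz.
have fe : frontier M (vertex_at m (src e)) by rewrite /frontier src_out src_in.
apply: (far_outer_edge s_gt0 h_gt0 center_in); apply: (frontier_step_far_point fe).
by rewrite vpos_at ?in_grid_src //; apply: (@box_step_edge m); rewrite kernel_mxE.
Qed.

Let label (v : vertex m) : 'I_#|{: 'I_K.+1 * 'I_K.+1}| :=
  enum_rank (bucket (eta / 4) mesh K (vpos v).1, bucket (eta / 4) mesh K (vpos v).2).

Let label_linked v w : frontier M v -> frontier M w -> label (vertex_map a v) = label (vertex_map a w) ->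
  connect (outer_rel M) (vertex_map a v) (vertex_map a w).
Proof.
move=> fv fw /enum_rank_inj; rewrite !vpos_vertex_map // => -[label1 label2].
have v_grid := a_grid (in_grid_vpos v); have w_grid := a_grid (in_grid_vpos w).
have h_mesh : INR h * mesh = s by rewrite /mesh; field; have := INR_gt0 h_gt0; lra.
have near := bucket_near (ltac:(lra) : 0 < eta / 4) mesh_pos h_mesh K_large.
have [near1 near2] : Rabs (mesh * (INR (a (vpos v)).1 - INR (a (vpos w)).1)) <= eta / 4 /\
    Rabs (mesh * (INR (a (vpos v)).2 - INR (a (vpos w)).2)) <= eta / 4.
  move: v_grid w_grid; rewrite /in_grid /m mesh_sizeS // => /andP[v1 v2] /andP[w1 w2].
  by split; apply: near.
apply: (linked_far_box s_gt0 h_gt0 center_in) => // y y1 y2.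
apply: (far_point_near (frontier_step_far fv (box_step_image _ _)) (d := eta / 4)); last lra.
have cancel (x u v' : R) : x + mesh * (u - INR h) - (x + mesh * (v' - INR h)) = mesh * (u - v') by ring.
apply/dsup_le; rewrite /position /mesh_point /grid_point /= -/mesh !cancel.
by split; [apply: Rabs_between y1 near1 | apply: Rabs_between y2 near2]; lra.
Qed.

Lemma block_trace_divisor_sum N v0 q : outer_vertex M v0 -> M q ->
  (forall i, (restr_mx (predC (outer_face_index M)) (face_mx m a) ^+ N)%R i (enum_rank q) = 0%R) ->
  let C := #|{: 'I_K.+1 * 'I_K.+1}|.+1 in
  exists al, some_positive C al /\ forall n, block_trace h n.+1 = (1 - Z.of_nat (divisor_sum C al n.+1))%Z.
Proof.
move=> v0_outer Mq nilpotent_column.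
have card_le := card_exit_map_image v0 label_linked.
have M_connected : face_connected M by apply: block_connected.
have [al [al_pos traceE]] := exit_trace_divisor_sum M_connected a_grid v0_outer frontier_vertex frontier_edge
  card_le Mq nilpotent_column.
by exists al; split=> // n; apply: traceE.
Qed.
End AtScale.

Lemma discrete_trace_block h N q e e' : (0 < h)%N -> 0 < q < s ->
  (forall x, dsup x p <= e -> region x) -> e' <= e / 2 -> e' <= q / 2 ->
  s / INR h < Rmin (e / 2) (q / 4) ->
  (forall x, [/\ box_walk (discretize g p s h) N.+1 x, x N.+1 = x 0%N & dsup (mesh_point p s h (x 0%N)) p <= q] ->
    forall t, (t <= N.+1)%N -> dsup (mesh_point p s h (x t)) p <= e') ->
  (forall x, [/\ box_walk (discretize g p s h) N.+1 x, x N.+1 = x 0%N &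
      forall t, (t <= N.+1)%N -> block_cell f p r s k h (x t)] -> dsup (mesh_point p s h (x 0%N)) p <= e') ->
  discrete_trace g p s h N.+1 q = block_trace h N.+1.
Proof.
move=> h0 [q0 q_s] ball e'_e e'_q mesh_small start cells.
have mesh_pos : 0 < s / INR h by apply: mesh_gt0.
have [mesh_e mesh_q] : s / INR h <= e / 2 /\ s / INR h <= q / 4.
  by have := Rmin_l (e / 2) (q / 4); have := Rmin_r (e / 2) (q / 4); lra.
have center_in : region p by apply: block_region_center.
pose M := @block p s h region; pose position := mesh_point p s h.
have a_grid v : in_grid (mesh_size h) v -> in_grid (mesh_size h) (discretize g p s h v).
  by move=> _; apply: discretize_grid.
have in_square_near v : dsup (position v) p <= e' ->
    in_square (h - square_radius q s h) (h + square_radius q s h) v &&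
    in_square (h - square_radius q s h) (h + square_radius q s h) (v.1.+1, v.2.+1).
  by move=> v_near; apply: near_center_in_square => //; [lra | apply: Rle_trans v_near e'_q].
apply: (local_trace_restr a_grid (near := fun v => dsup (position v) p <= e')
  (inside := block_cell f p r s k h) (AV := predC (outer_vertex M)) (AE := predC (outer_edge M))
  (AS := predC (fun t => ~~ M t))).
- by move=> x walk closed /(dsup_in_square p s_gt0 h0 q0 q_s) x0; apply: start.
- by move=> x walk closed x_in; apply: cells.
- move=> v v_near; rewrite /= (near_center_not_outer_vertex s_gt0 h0 center_in ball); last by rewrite -/position; lra.
  by have := in_square_near _ v_near; rewrite /vertex_in_square; case: (vpos v) => i j /=; rewrite /in_square /=; lia.
- move=> x x_near; rewrite /= (near_center_not_outer_edge s_gt0 h0 center_in ball); last by rewrite -/position; lra.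
  have := in_square_near _ x_near; rewrite /edge_in_square /src /tgt /src_at /tgt_at.
  by case: (epos x) => [[] [i j]] /=; rewrite /in_square /=; lia.
- move=> t t_near; have Mt : M t.
    by apply: (block_of_near_center s_gt0 h0 center_in ball); rewrite -/position; lra.
  by rewrite /= negbK Mt; exact: in_square_near t_near.
- by move=> v v_in; apply: block_cell_near (in_grid_vpos v) (not_outer_vertex_near s_gt0 h0 center_in v_in).
- by move=> x x_in; apply: block_cell_near (in_grid_src x) (not_outer_edge_near s_gt0 h0 center_in x_in).
- by move=> t; rewrite /= negbK; apply: block_cell_block.
Qed.

Hypothesis orbit_interior : forall j x, dsup x p <= s -> orbit_in f p r j x -> dsup (fiter f j x) p <= s ->
  forall i, (i <= j)%N -> dsup (fiter f i x) p < r.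
Hypothesis orbit_middle : forall x, orbit_in f p r (k + k) x -> dsup (fiter f k x) p < s.
Variable z : pt.
Hypotheses (z_unstable : unstable f p r z) (z_p : z <> p).
Hypothesis stable_near : forall e, 0 < e -> exists q, dsup q p < e /\ ~ unstable f p r q.

Lemma eventually_block_trace_divisor_sum : exists C, eventually (fun h => exists al,
  some_positive C al /\ forall n, block_trace h n.+1 = (1 - Z.of_nat (divisor_sum C al n.+1))%Z).
Proof.
have [e [e0 e_s ball]] := central_ball_in_region k square s_gt0 s_r.
have [q [q_near q_stable]] := stable_near e0.
have [N nilpotent] := eventually_nilpotent_column square s_gt0 s_r k_gt0 ball e_s q_near q_stable.
have outer := eventually_outer_vertex square s_gt0 s_r k_gt0 orbit_middle z_unstable z_p.
have [eta [eta0 images_far]] := frontier_images_far square s_gt0 orbit_interior orbit_middle.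
pose K := nfloor (2 * s / (eta / 4)).
have K_large : 2 * s / (eta / 4) < INR K.+1.
  have quotient0 : 0 <= 2 * s / (eta / 4) by apply: Rle_mult_inv_pos; lra.
  by rewrite S_INR; have [] := nfloor_spec quotient0.
have small_mesh := vanishing_mesh s_gt0 increasing_seq_id (ltac:(lra) : 0 < eta / 16).
exists #|{: 'I_K.+1 * 'I_K.+1}|.+1.
apply: eventually_imp (eventually_and (eventually_and nilpotent outer)
  (eventually_and (eventually_and images_far small_mesh) (eventually_ge 1))).
move=> h [[[t [Mt column]] [v v_outer]] [[far mesh_small] h0]].
have mesh_eta : 16 * (s / INR h) <= eta by rewrite /= in mesh_small; lra.
have [al [al_pos traceE]] := block_trace_divisor_sum h0 mesh_eta K_large far v_outer Mt column.
by exists al.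
Qed.

Lemma eventually_discrete_trace_block nmax q : 0 < q -> 2 * q < s -> isolating_iterates g p s q nmax ->
  eventually (fun h => forall N, (N < nmax)%N -> discrete_trace g p s h N.+1 q = block_trace h N.+1).
Proof.
move=> q0 q_s [within only_fixed].
have [e [e0 e_s ball]] := central_ball_in_region k square s_gt0 s_r.
have g_fixed : g p = p by apply: fiter_fixed (isolating_fixed square).
pose e' := Rmin (e / 2) (q / 2).
have e'0 : 0 < e' by apply: Rmin_glb_lt; lra.
have e'_e : e' <= e / 2 by apply: Rmin_l.
have e'_q : e' <= q / 2 by apply: Rmin_r.
have start_near : eventually (fun h => forall N, (N < nmax)%N -> forall x,
    [/\ box_walk (discretize g p s h) N.+1 x, x N.+1 = x 0%N & dsup (mesh_point p s h (x 0%N)) p <= q] ->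
    forall t, (t <= N.+1)%N -> dsup (mesh_point p s h (x t)) p <= e').
  apply: eventually_below => N N_lt; apply: eventually_closed_walk_near => //.
    by move=> x x_near t t_N; apply: within; [lra | lia].
  by move=> x x_near; apply: only_fixed; [lra | lia].
have cells_near : eventually (fun h => forall N, (N < nmax)%N -> forall x,
    [/\ box_walk (discretize g p s h) N.+1 x, x N.+1 = x 0%N &
      forall t, (t <= N.+1)%N -> block_cell f p r s k h (x t)] -> dsup (mesh_point p s h (x 0%N)) p <= e').
  apply: eventually_below => N _; apply: (eventually_closed_cell_walk_near s_gt0 (region := region)) => //.
  - by move=> h v; apply: block_cell_in.
  - exact: block_cell_limit square s_gt0.
  - by move=> X; apply: block_region_step.
  - by move=> X; apply: periodic_in_region.
have small_mesh := vanishing_mesh s_gt0 increasing_seq_id (Rmin_glb_lt _ _ _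
  (ltac:(lra) : 0 < e / 2) (ltac:(lra) : 0 < q / 4)).
apply: eventually_imp (eventually_and (eventually_and start_near cells_near)
  (eventually_and small_mesh (eventually_ge 1))) => h [[start cells] [/= mesh_small h0]] N N_lt.
have q_bounds : 0 < q < s by lra.
exact: discrete_trace_block h0 q_bounds ball e'_e e'_q mesh_small (start N N_lt) (cells N N_lt).
Qed.

Lemma block_index : exists C, forall nmax q, 0 < q -> 2 * q < s -> isolating_iterates g p s q nmax ->
  exists al, some_positive C al /\ forall n, (0 < n <= nmax)%N ->
    circle_index (fiter g n) p q (1 - Z.of_nat (divisor_sum C al n)).
Proof.
have [C traces] := eventually_block_trace_divisor_sum.
exists C => nmax q q0 q_s iso; have [within only_fixed] := iso.
have winding : eventually (fun h => forall N, (N < nmax)%N -> (0 < h)%N /\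
    circle_index (fiter g N.+1) p q (discrete_trace g p s h N.+1 q)).
  apply: eventually_below => N N_lt; apply: eventually_winding_discrete_trace => //.
    by move=> x x_near t t_N; apply: within; [lra | lia].
  by move=> x x_near; apply: only_fixed; [lra | lia].
have [h [[al [al_pos traceE]] [traces_agree index]]] := eventually_exists (eventually_and traces
  (eventually_and (eventually_discrete_trace_block q0 q_s iso) winding)).
exists al; split=> // -[//|N] /andP[_ N_lt].
by rewrite -traceE -traces_agree //; have [] := index N N_lt.
Qed.
End BlockIndex.

(** * The index sequence *)

Lemma common_radius (P : nat -> R -> Prop) r N : 0 < r ->
  (forall j, (j < N)%N -> exists r0, 0 < r0 /\ forall q, 0 < q <= r0 -> P j q) ->
  exists r', 0 < r' <= r /\ forall j, (j < N)%N -> forall q, 0 < q <= r' -> P j q.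
Proof.
move=> r_gt0; elim: N => [|N IH] radii; first by exists r; split; [lra|].
have [r' [r'_bounds small]] := IH (fun j j_lt => radii j (ltnW j_lt)).
have [r0 [r0_gt0 small_N]] := radii N (leqnn _).
have min_l := Rmin_l r' r0; have min_r := Rmin_r r' r0.
have min_gt0 := Rmin_glb_lt _ _ _ (proj1 r'_bounds) r0_gt0.
exists (Rmin r' r0); split; first lra.
move=> j; rewrite ltnS leq_eqVlt => /orP[/eqP-> q q_small|j_lt q q_small]; first by apply: small_N; lra.
by apply: small => //; lra.
Qed.

Section IndexSequence.
Variables (f : pt -> pt) (p : pt) (r s : R).
Hypothesis square : isolating_square f p r.
Hypotheses (s_gt0 : 0 < s) (s_r : s <= r).

Definition small_index n r0 i := [/\ 0 < r0, 2 * r0 < s, isolating_iterates f p s r0 n &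
  forall q, 0 < q <= r0 -> circle_index (fiter f n) p q i].

Lemma small_index_exists n : (0 < n)%N -> exists r0 i, small_index n r0 i.
Proof.
case: n => // n _; have f_fixed := isolating_fixed square.
have [r0 [r0_gt0 r0_s iso]] := isolating_iterates_exist square s_gt0 s_r (k := 1) isT n.+1.
have [i [index _]] := circle_index_radius s_gt0 f_fixed r0_gt0 r0_s r0_gt0 r0_s iso iso.
exists r0, i; split=> // q [q_gt0 q_le].
have q_iso : isolating_iterates f p s q n.+1 by apply: isolating_iterates_le iso.
have q_s : 2 * q < s by lra.
have [i' [index' q_index]] := circle_index_radius s_gt0 f_fixed r0_gt0 r0_s q_gt0 q_s iso q_iso.
by rewrite (winding_number_unique index index').
Qed.

Lemma index_sequence : exists i : nat -> Z, forall n, (0 < n)%N -> exists r0, small_index n r0 (i n).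
Proof.
have [n|i small] := @choice nat Z (fun n i => (0 < n)%N -> exists r0, small_index n r0 i).
  case: n => [|n]; first by exists 0%Z.
  by have [r0 [i small]] := small_index_exists (ltn0Sn n); exists i => _; exists r0.
by exists i.
Qed.

Variable i : nat -> Z.
Hypothesis small : forall n, (0 < n)%N -> exists r0, small_index n r0 (i n).

Lemma index_sequence_prime q m : prime q -> (0 < m)%N -> exists c, i (q * m) = (i m + c * Z.of_nat q)%Z.
Proof.
move=> q_prime m_gt0; have q_gt0 := prime_gt0 q_prime.
have [r0 [r0_gt0 r0_s iso]] := isolating_iterates_exist square s_gt0 s_r m_gt0 q.
have [r1 [r1_gt0 _ _ index_m]] := small m_gt0.
have qm_gt0 : (0 < q * m)%N by rewrite muln_gt0 q_gt0.
have [r2 [r2_gt0 _ _ index_qm]] := small qm_gt0.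
pose r' := Rmin r0 (Rmin r1 r2).
have r'_0 : r' <= r0 by apply: Rmin_l.
have [r'_1 r'_2] : r' <= r1 /\ r' <= r2.
  by have := Rmin_r r0 (Rmin r1 r2); have := Rmin_l r1 r2; have := Rmin_r r1 r2; rewrite -/r'; lra.
have r'_gt0 : 0 < r' by do 2 (apply: Rmin_glb_lt => //).
have r'_s : 2 * r' < s by lra.
have iso' := isolating_iterates_le r'_0 (leqnn q) iso.
have [im [c [im_index qm_index]]] :=
  circle_index_prime s_gt0 (fiter_fixed m (isolating_fixed square)) q_prime r'_gt0 r'_s iso'.
exists c; rewrite -(winding_number_unique im_index (index_m _ (conj r'_gt0 r'_1))).
apply: winding_number_unique (index_qm _ (conj r'_gt0 r'_2)) _.
by apply: winding_number_ext qm_index => t _; rewrite fiterM.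
Qed.

Lemma index_sequence_multiples k C :
  (0 < k)%N ->
  (forall nmax q, 0 < q -> 2 * q < s -> isolating_iterates (fiter f k) p s q nmax ->
    exists al, some_positive C al /\ forall n, (0 < n <= nmax)%N ->
      circle_index (fiter (fiter f k) n) p q (1 - Z.of_nat (divisor_sum C al n))) ->
  forall nmax, exists al, some_positive C al /\
    forall n, (0 < n <= nmax)%N -> (1 - i (n * k)%N)%Z = Z.of_nat (divisor_sum C al n).
Proof.
move=> k_gt0 k_index nmax.
have [r0 [r0_gt0 r0_s iso]] := isolating_iterates_exist square s_gt0 s_r k_gt0 nmax.
have [j _|q [q_bounds index]] := common_radius (N := nmax)
    (P := fun j q => circle_index (fiter f (j.+1 * k)) p q (i (j.+1 * k)%N)) r0_gt0.
  have jk_gt0 : (0 < j.+1 * k)%N by rewrite muln_gt0.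
  by have [r1 [r1_gt0 _ _ index]] := small jk_gt0; exists r1.
have iso_q : isolating_iterates (fiter f k) p s q nmax by apply: isolating_iterates_le iso; [lra|].
have [al [al_pos al_index]] : exists al, some_positive C al /\ forall n, (0 < n <= nmax)%N ->
    circle_index (fiter (fiter f k) n) p q (1 - Z.of_nat (divisor_sum C al n)) by apply: k_index => //; lra.
exists al; split=> // -[//|n] n_le; have q_le : 0 < q <= q by lra.
suff -> : i (n.+1 * k)%N = (1 - Z.of_nat (divisor_sum C al n.+1))%Z by lia.
apply: winding_number_unique (index n n_le q q_le) _.
by apply: winding_number_ext (al_index n.+1 n_le) => t _; rewrite fiterM.
Qed.
End IndexSequence.

Lemma index_formula f p r : isolating_square f p r -> (exists z, unstable f p r z /\ z <> p) ->
  (forall e, 0 < e -> exists q, dsup q p < e /\ ~ unstable f p r q) ->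
  exists s C al, [/\ 0 < s <= r, some_positive C al &
    forall n, (0 < n)%N -> exists r0, small_index f p s n r0 (1 - Z.of_nat (divisor_sum C al n))].
Proof.
move=> square [z [z_unstable z_p]] stable_near.
have [s [[s_gt0 s_r] orbit_interior]] := orbit_in_interior square.
have [k0 orbit_middle] := orbit_in_middle square s_gt0.
have [i small] := index_sequence square s_gt0 s_r.
have [k k_ge|q m q_prime m_gt0|C [al [al_pos formula]]] :=
    divisor_sum_of_congruences (b := fun n => (1 - i n)%Z) (ltn0Sn k0).
- have k_gt0 : (0 < k)%N by lia.
  have [C k_index] := block_index square s_gt0 s_r k_gt0 orbit_interior (orbit_middle k (ltnW k_ge))
    z_unstable z_p stable_near.
  by exists C; exact: (index_sequence_multiples square s_gt0 s_r small k_gt0 k_index).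
- by have [c ->] := index_sequence_prime square s_gt0 s_r small q_prime m_gt0; exists (- c)%Z; lia.
exists s, C, al; split=> // n n_gt0; have [r0 small_n] := small n n_gt0.
by exists r0; rewrite -formula // (_ : 1 - (1 - i n) = i n)%Z //; lia.
Qed.

Lemma fp_index_small_index (U : pt -> Prop) f p r s n r0 k : isolating_square f p r ->
  (forall x, dsup x p <= r -> U x) -> 0 < s <= r -> (0 < n)%N -> small_index f p s n r0 k ->
  fp_index (fiter_dom U f n) (fiter f n) p k.
Proof.
move=> square square_in s_bounds n_gt0 [r0_gt0 r0_s [within only_fixed] index].
split; first exact: fiter_fixed (isolating_fixed square).
have near x : dist2 x p <= r0 -> dsup x p <= 2 * r0 by have := dsup_le_dist2 x p; lra.
exists r0; split=> //; split; last split; last split.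
- move=> x /near x_near j j_lt; apply: square_in.
  by have [_] := within x x_near j (ltac:(lia)); lra.
- move=> x /near x_near e e_gt0.
  have f_cont : continuous_at (fiter f n) x.
    by apply: continuous_at_fiter => j j_lt; have [] := within x x_near j (ltnW j_lt).
  have [d [d_gt0 close]] := f_cont (e / 2) (ltac:(lra)); exists d; split=> // y _ xy.
  have := dsup_le_dist2 x y; have := dist2_le_dsup (fiter f n x) (fiter f n y) => image_le xy_le.
  by have := close y (ltac:(lra)); lra.
- by move=> x /near x_near; apply: only_fixed => //; rewrite n_gt0 leqnn.
- by apply: index; lra.
Qed.

Lemma dvdn_modulo d n : (0 < d)%N -> (d %| n) = Nat.eqb (Nat.modulo n d) 0.
Proof.
move=> d_gt0; apply/dvdnP/Nat.eqb_spec => [[c ->]|mod0]; first by rewrite -multE Nat.Div0.mod_mul.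
by exists (Nat.div n d); have := Nat.div_mod n d (ltac:(lia)); nia.
Qed.

Lemma sum_Z_filter (P : pred nat) (F : nat -> Z) a len :
  sum_Z (List.map F (List.filter P (List.seq a len))) = (\sum_(a <= d < a + len | P d) F d)%R.
Proof.
elim: len a => [|len IH] a; first by rewrite addn0 big_geq.
rewrite /= addnS big_ltn_cond; last by lia.
by rewrite -addSn -IH; case: (P a).
Qed.

Definition positive_support C (al : nat -> nat) := List.filter (fun d => (0 < al d)%N) (List.seq 1 C).

Lemma mem_positive_support C al d : List.In d (positive_support C al) <-> (0 < d <= C)%N /\ (0 < al d)%N.
Proof. by rewrite filter_In in_seq; split=> -[d_bounds al_d]; split=> //; lia. Qed.

Lemma positive_support_neq_nil C al : some_positive C al -> positive_support C al <> nil.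
Proof. by move=> [d /mem_positive_support d_in] nilE; rewrite nilE in d_in. Qed.

Lemma positive_support_uniq C al : List.NoDup (positive_support C al).
Proof. by apply: NoDup_filter; apply: seq_NoDup. Qed.

Lemma positive_support_pos C al d : List.In d (positive_support C al) -> (1 <= d)%coq_nat /\ (1 <= al d)%coq_nat.
Proof. by move=> /mem_positive_support[d_bounds al_d]; split; lia. Qed.

Lemma sigk_divisor_sum C al n : Z.of_nat (divisor_sum C al n) =
  sum_Z (List.map (fun k => (Z.of_nat (al k) * sigk k n)%Z) (positive_support C al)).
Proof.
rewrite sum_Z_filter add1n /divisor_sum -natr_Z natr_sum big_mkcond [RHS]big_mkcond.
rewrite big_nat_cond [RHS]big_nat_cond; apply: eq_bigr => d /andP[/andP[d_gt0 _] _].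
rewrite /sigk -dvdn_modulo // natr_Z; case: (d %| n); case: (posnP (al d)) => [al_d|_] /=; rewrite ?al_d; lia.
Qed.

Lemma fp_index_positive_support U f p r : isolating_square f p r -> (forall x, dsup x p <= r -> U x) ->
  (exists z, unstable f p r z /\ z <> p) ->
  (forall e, 0 < e -> exists q, dsup q p < e /\ ~ unstable f p r q) ->
  exists C al, some_positive C al /\ forall n, (1 <= n)%coq_nat -> fp_index (fiter_dom U f n) (fiter f n) p
    (sigk 1 n - sum_Z (List.map (fun k => Z.of_nat (al k) * sigk k n) (positive_support C al)))%Z.
Proof.
move=> square square_in unstable_point stable_near.
have [s [C [al [s_bounds al_pos small]]]] := index_formula square unstable_point stable_near.
exists C, al; split=> // n n_ge1; have n_gt0 : (0 < n)%N by lia.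
have [r0 small_n] := small n n_gt0.
rewrite -sigk_divisor_sum (_ : sigk 1 n = 1%Z); last by rewrite /sigk Nat.mod_1_r.
exact: fp_index_small_index square square_in s_bounds n_gt0 small_n.
Qed.

Section NeitherSinkNorSource.
Variables (U : pt -> Prop) (f : pt -> pt) (p : pt) (r : R).
Hypotheses (square : isolating_square f p r) (square_in : forall x, dsup x p <= r -> U x).
Hypothesis isolated : isolated_fixed_set U f p.

Lemma unstable_point_of_not_sink : ~ is_sink U f p -> exists z, unstable f p r z /\ z <> p.
Proof.
move=> not_sink; apply: NNPP => no_unstable; apply: not_sink.
apply: (sink_of_unstable square square_in isolated) => x x_unstable.
by apply: NNPP => x_p; apply: no_unstable; exists x.
Qed.

Lemma not_unstable_near_of_not_source : ~ is_source U f p ->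
  forall e, 0 < e -> exists q, dsup q p < e /\ ~ unstable f p r q.
Proof.
move=> not_source e e_gt0; apply: NNPP => all_unstable; apply: not_source.
have r_gt0 := isolating_radius_gt0 square.
pose rho := Rmin (e / 2) r.
have rho_e : rho <= e / 2 by apply: Rmin_l.
have rho_r : rho <= r by apply: Rmin_r.
have rho_gt0 : 0 < rho by apply: Rmin_glb_lt; lra.
apply: (source_of_stable square square_in isolated (conj rho_gt0 rho_r)) => x x_stable.
apply: NNPP => x_p; apply: all_unstable; exists x; split; first by have := x_stable 0%N => /=; lra.
by move=> x_unstable; apply: x_p; apply: (unstable_stable_fixed square) => // j; have := x_stable j; lra.
Qed.
End NeitherSinkNorSource.

End IsolatedFixedPoint.

Import IsolatedFixedPoint.

Theorem theorem1 (U : pt -> Prop) (f : pt -> pt) (p : pt)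
  (hU : open2 U) (hf : cont_on2 U f) (hp : U p) (hfix : f p = p)
  (hiso : isolated_fixed_set U f p)
  (hsink : ~ is_sink U f p) (hsource : ~ is_source U f p) :
  exists (F : list nat) (a : nat -> nat),
    F <> nil /\ NoDup F /\
    (forall k, In k F -> (1 <= k)%nat /\ (1 <= a k)%nat) /\
    forall n : nat, (1 <= n)%nat ->
      fp_index (fiter_dom U f n) (fiter f n) p
        (sigk 1 n - sum_Z (map (fun k => (Z.of_nat (a k) * sigk k n)%Z) F))%Z.
Proof.
destruct (isolating_square_exists hU hf hp hiso) as [r [square square_in]].
pose proof (unstable_point_of_not_sink square square_in hiso hsink) as unstable_point.
pose proof (not_unstable_near_of_not_source square square_in hiso hsource) as stable_near.
destruct (fp_index_positive_support square square_in unstable_point stable_near)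
  as [C [al [al_pos index]]].
exists (positive_support C al), al.
split; [exact (positive_support_neq_nil al_pos) | split; [apply positive_support_uniq | split]].
- apply positive_support_pos.
- exact index.
Qed.
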